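(* Let $R\subset\mathbb R^N$ be a root system with multiplicity function $k\ge0$. For $\lambda,z\in\mathbb R^N$ let $(X_t^{\lambda,z})_{t\ge0}$ denote the Dunkl process of type $R$ with multiplicity $k$, drift vector $\lambda$, and start in $z$. If $(\lambda,x)\in\mathbb R^N\times\mathbb R^N$ is a regular pair, then the random variables $(X_t^{\lambda,tx}-t(\lambda+x))/\sqrt t$ (where $X_t^{\lambda,tx}$ is the value at time $t$ of the process started in $tx$) tend in distribution to the standard normal distribution $N(0,I_N)$ on $\mathbb R^N$ as $t\to\infty$.
   Context: Let $N\ge1$ and let $\mathbb R^N$ carry the usual scalar product $\langle\cdot,\cdot\rangle$ and norm $\|\cdot\|$. A root system $R$ is a finite set of vectors in $\mathbb R^N\setminus\{0\}$ such that the reflections $\sigma_\alpha$ on the hyperplanes $\alpha^\perp$ ($\alpha\in R$) generate a finite group $W$ of orthogonal transformations and $\sigma_\alpha(R)=R$ for all $\alpha\in R$. Fix a positive subsystem $R_+\subset R$. A multiplicity function is a $W$-invariant map $k:R\to[0,\infty)$. The (closed) Weyl chambers are the sets $\{x\in\mathbb R^N:\langle x,\alpha\rangle\ge0\ \text{for all }\alpha\in R_+\}$ for the various choices of positive subsystems $R_+$. A vector is regular if it does not lie in the boundary of a Weyl chamber. Regular pairs: $(x,\lambda)\in\mathbb R^N\times\mathbb R^N$ is called regular if $x$ and $\lambda$ are regular and lie in the interior of the same Weyl chamber $C$, and if $\|x-\lambda\|<C(x,\lambda):=\max\{\mathrm{dist}(x,\partial C),\mathrm{dist}(\lambda,\partial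 C)\}$, where $\mathrm{dist}$ is the Euclidean distance of a point and a set. (This condition is symmetric in $x,\lambda$.) The Dunkl operators are $T_\xi(k)f(x)=\partial_\xi f(x)+\sum_{\alpha\in R_+}k(\alpha)\langle\alpha,\xi\rangle\frac{f(x)-f(\sigma_\alpha(x))}{\langle\alpha,x\rangle}$. The Dunkl kernel $E_k:\mathbb C^N\times\mathbb C^N\to\mathbb C$ is characterized by the property that for each $w\in\mathbb C^N$ the function $f=E_k(\cdot,w)$ is the unique holomorphic solution of $T_\xi(k)f=\langle\xi,w\rangle f$ for all $\xi\in\mathbb C^N$ with $f(0)=1$ (here $\langle\cdot,\cdot\rangle$ is extended bilinearly); one has $E_k(x,y)>0$ for $x,y\in\mathbb R^N$. Put $w_k(x)=\prod_{\alpha\in R_+}|\langle\alpha,x\rangle|^{2k(\alpha)}$, $\gamma=\sum_{\alpha\in R_+}k(\alpha)$, and $c_k=\left(\int_{\mathbb R^N}e^{-\|y\|^2/2}w_k(y)\,dy\right)^{-1}$. The Dunkl process of type $R$ with multiplicity $k$ and drift $\lambda$ is the Feller process on $\mathbb R^N$ (with RCLL paths) having transition probabilities $$K_t^{\lambda,k,Dunkl}(x,A)=\frac{c_k e^{-\|\lambda\|^2t/2}}{t^{\gamma+N/2}}\int_A e^{-(\|x\|^2+\|y\|^2)/(2t)}\,\frac{E_k\left(\frac{x}{\sqrt t},\frac{y}{\sqrt t}\right)E_k(y,\lambda)}{E_k(x,\lambda)}\,w_k(y)\,dy$$ for $t>0$, $x\in\mathbb R^N$ and Borel sets $A\subset\mathbb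 R^N$. *)

(* Defs.v *)
From HB Require Import structures.
From mathcomp Require Import all_boot all_order all_algebra finmap complex.
From mathcomp Require Import all_classical all_reals all_analysis.
From mathcomp Require Import measurable_realfun.

Set Implicit Arguments.
Unset Strict Implicit.
Unset Printing Implicit Defensive.

Import Order.TTheory GRing.Theory Num.Theory.
Import numFieldNormedType.Exports.

Local Open Scope classical_set_scope.
Local Open Scope ring_scope.

Section borel.
Variable R : realType.

Definition borelRV (n : nat) := g_sigma_algebraType (@open 'rV[R]_n).

Definition row_cons (n : nat) (p : R * 'rV[R]_n) : 'rV[R]_n.+1 :=
  \row_i (if unlift ord0 i is Some j then p.2 0 j else p.1).

Lemma row_cons0 n (p : R * 'rV[R]_n) : row_cons p 0 0 = p.1.
Proof. by rewrite mxE unlift_none. Qed.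

Lemma row_consS n (p : R * 'rV[R]_n) j : row_cons p 0 (lift ord0 j) = p.2 0 j.
Proof. by rewrite mxE liftK. Qed.

Lemma row_consK n : cancel (@row_cons n)
  (fun v : 'rV[R]_n.+1 => (v 0 0, \row_j v 0 (lift ord0 j))).
Proof.
move=> [x v]; congr pair; first by rewrite row_cons0.
by apply/rowP => j; rewrite mxE row_consS.
Qed.

Lemma row_cons_ball n (x y : R) (u v : 'rV[R]_n) (e : R) :
  0 < e -> ball x e y -> ball u e v -> ball (row_cons (x, u)) e (row_cons (y, v)).
Proof.
move=> e0 xy [_ uv]; split=> // i j; rewrite !mxE.
by case: (unlift ord0 j) => [k|] //=; exact: uv.
Qed.

Lemma rat_approx_rV n (v : 'rV[R]_n) (e : R) : 0 < e ->
  exists q : 'rV[rat]_n, ball (map_mx ratr q : 'rV[R]_n) e v.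
Proof.
move=> e0.
have /choice[q qP] (i : 'I_n) : exists q : rat, ball (ratr q : R) e (v 0 i).
  have /rat_in_itvoo[q /itvP qre] : v 0 i - e < v 0 i + e.
    by rewrite ltrBlDr -addrA ltrDl addr_gt0.
  exists q; rewrite /ball/= ltr_distl.
  by rewrite !qre.
exists (\row_i q i); split=> // i j.
by rewrite !mxE ord1; exact: qP.
Qed.

Lemma measurable_row_cons n :
  measurable_fun [set: measurableTypeR R * borelRV n]
    (@row_cons n : _ -> borelRV n.+1).
Proof.
apply: (@measurability _ _ (measurableTypeR R * borelRV n)%type (borelRV n.+1) setT _
  (@open 'rV[R]_n.+1) erefl).
move=> _ [U oU <-].
rewrite setTI.
pose T := (rat * 'rV[rat]_n * rat)%type.
pose box (t : T) : set (measurableTypeR R * borelRV n) :=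
  ball (ratr t.1.1 : R) (ratr t.2) `*` ball (map_mx ratr t.1.2 : 'rV[R]_n) (ratr t.2).
pose F t := if pselect (box t `<=` @row_cons n @^-1` U) then box t else set0.
suff -> : @row_cons n @^-1` U = \bigcup_(t in [set: T]) F t.
  have cT : countable [set: T] by exact: (@countableP T setT).
  apply: (countable_bigcupT_measurable cT) => t.
  rewrite /F; case: pselect => [tU|tU] /=; last exact: measurable0.
  apply: measurableX.
    by apply: open_measurable; exact: ball_open.
  by apply: sub_sigma_algebra; exact: ball_open.
apply/seteqP; split=> [[x v] Uxv|z [t _]]; last first.
  by rewrite /F; case: pselect => [tU|tU] /=; [exact: tU|case].
have /nbhs_ballP[e /= e0 eU] : nbhs (row_cons (x, v)) U.
  by move: oU; rewrite openE; exact.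
have /rat_in_itvoo[r /itvP r0e] : 0 < e / 2 by rewrite divr_gt0.
have r0 : 0 < ratr r :> R by rewrite r0e.
have [q qv] := rat_approx_rV v r0.
have [p px] := rat_approx_rV (\row_(i < 1) x) r0.
exists (p 0 0, q, r) => //.
have bxv : box (p 0 0, q, r) (x, v).
  by split=> //=; case: px => _ /(_ 0 0); rewrite !mxE.
have tU : box (p 0 0, q, r) `<=` @row_cons n @^-1` U.
  move=> [y w] [/= py qw]; apply: eU.
  have [/= bx bv] := bxv.
  have : ball (row_cons (x, v)) (ratr r + ratr r) (row_cons (y, w)).
    apply: row_cons_ball; first by rewrite addr_gt0.
      by apply: ball_triangle py; exact: ball_sym.
    by apply: ball_triangle qw; exact: ball_sym.
  by apply: le_ball; rewrite (splitr e) lerD// ltW// r0e.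
by rewrite /F; case: pselect.
Qed.

Lemma measurable_row_uncons n :
  measurable_fun [set: borelRV n.+1]
    ((fun v : 'rV[R]_n.+1 => (v 0 0, \row_j v 0 (lift ord0 j)))
      : _ -> measurableTypeR R * borelRV n).
Proof.
apply/measurable_fun_pairP; split.
  apply: (measurability _ (RGenOpens.measurableE R)).
  move=> _ [_ [a [b ->] <-]]; rewrite setTI.
  apply: sub_sigma_algebra; apply: open_comp; last exact: interval_open.
  by move=> v _; exact: coord_continuous.
apply: (@measurability _ _ (borelRV n.+1) (borelRV n) setT _ (@open 'rV[R]_n) erefl).
move=> _ [U oU <-]; rewrite setTI.
apply: sub_sigma_algebra; apply: open_comp oU => v _ /=.
move=> A /nbhs_ballP[e e0 eA]; apply/nbhs_ballP; exists e => // w [_ vw].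
by apply: eA; split=> // i j; rewrite !mxE; exact: vw.
Qed.

Local Open Scope ereal_scope.

(* the n-fold product measure mu \x ... \x mu, as a measure on 'rV[R]_n *)
Fixpoint prod_rV (mu : set (measurableTypeR R) -> \bar R) (n : nat) :
    set (borelRV n) -> \bar R :=
  if n is m.+1 then pushforward (mu \x @prod_rV mu m) (@row_cons m : _ -> borelRV m.+1)
  else \d_(0%R : borelRV 0).

End borel.
Arguments prod_rV {R} mu n _.

Section prod_rV_measure.
Variable R : realType.
Variable mu : {sigma_finite_measure set (measurableTypeR R) -> \bar R}.
Local Open Scope ereal_scope.

Section step.
Variables (n : nat) (m : {sigma_finite_measure set (borelRV R n) -> \bar R}).

Definition cons_measure :=
  pushforward (mu \x m) (@row_cons R n : _ -> borelRV R n.+1).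

HB.instance Definition _ := Measure.copy cons_measure
  (measure_function_pushforward__canonical__measure_function_Measure
    (mu \x m) (@measurable_row_cons R n)).

Let cons_measure_sigma_finite : sigma_finite setT cons_measure.
Proof.
have /sigma_finiteP[F [TF ndF Foo]] := sigma_finiteT mu.
have /sigma_finiteP[G [TG ndG Goo]] := sigma_finiteT m.
pose g (v : borelRV R n.+1) : measurableTypeR R * borelRV R n :=
  ((v : 'rV[R]_n.+1) 0 0, \row_j (v : 'rV[R]_n.+1) 0 (lift ord0 j))%R.
exists (fun k => g @^-1` (F k `*` G k)).
  apply/esym/seteqP; split=> // v _.
  have : [set: measurableTypeR R] (g v).1 by [].
  rewrite TF => -[i _ Fi].
  have : [set: borelRV R n] (g v).2 by [].
  rewrite TG => -[j _ Gj].
  exists (maxn i j) => //; split.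
    exact: (subsetPset _ _ (ndF _ _ (leq_maxl _ _))).
  exact: (subsetPset _ _ (ndG _ _ (leq_maxr _ _))).
move=> k; have [mF Fk] := Foo k; have [mG Gk] := Goo k; split.
  rewrite -[X in measurable X]setTI; apply: measurable_row_uncons => //.
  exact: measurableX.
rewrite /cons_measure /pushforward -comp_preimage.
rewrite (_ : g \o _ = idfun); last by apply/funext => z /=; exact: row_consK.
rewrite preimage_id product_measure1E// lte_mul_pinfty//.
by rewrite ge0_fin_numE.
Qed.

HB.instance Definition _ := Measure_isSigmaFinite.Build _ _ _ cons_measure
  cons_measure_sigma_finite.

End step.

Fact prod_rV_subproof n :
  exists m : {sigma_finite_measure set (borelRV R n) -> \bar R},
    (m : set _ -> \bar R) = prod_rV mu n.
Proof.
elim: n => [|n [m mE]].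
  by exists (\d_(0%R : borelRV R 0) : {sigma_finite_measure set _ -> \bar R}).
exists (cons_measure m : {sigma_finite_measure set _ -> \bar R}).
by rewrite /= -mE.
Qed.

Let prod_rV0 n : prod_rV mu n set0 = 0.
Proof. by have [m <-] := prod_rV_subproof n; exact: measure0. Qed.

Let prod_rV_ge0 n A : 0 <= prod_rV mu n A.
Proof. by have [m <-] := prod_rV_subproof n; exact: measure_ge0. Qed.

Let prod_rV_sigma_additive n : semi_sigma_additive (prod_rV mu n).
Proof.
by have [m <-] := prod_rV_subproof n; exact: measure_semi_sigma_additive.
Qed.

HB.instance Definition _ n := isMeasure.Build _ _ _ (prod_rV mu n)
  (@prod_rV0 n) (@prod_rV_ge0 n) (@prod_rV_sigma_additive n).

Let prod_rV_sigma_finite n : sigma_finite setT (prod_rV mu n).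
Proof. by have [m <-] := prod_rV_subproof n; exact: sigma_finiteT. Qed.

HB.instance Definition _ n := Measure_isSigmaFinite.Build _ _ _ (prod_rV mu n)
  (@prod_rV_sigma_finite n).

End prod_rV_measure.

Section prod_rV_probability.
Variables (R : realType) (P : probability (measurableTypeR R) R).
Local Open Scope ereal_scope.

Let prod_rV_setT n : prod_rV P n setT = 1.
Proof.
elim: n => [|n ih]; first by rewrite /= diracT.
rewrite /= /pushforward preimage_setT -setXTT.
have [m mE] := prod_rV_subproof P n.
rewrite -mE product_measure1E// mE ih mule1.
exact: (@probability_setT _ _ _ P).
Qed.

HB.instance Definition _ n := Measure_isProbability.Build _ _ _ (prod_rV P n)
  (@prod_rV_setT n).

End prod_rV_probability.

Definition lebesgue_rV (R : realType) (n : nat) :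
    {sigma_finite_measure set (borelRV R n) -> \bar R} :=
  prod_rV (@lebesgue_measure R) n.

(* N(0, I_n): the law of n independent N(0, 1) variables *)
Definition std_normal_rV (R : realType) (n : nat) :
    probability (borelRV R n) R :=
  prod_rV (normal_prob (0 : R) 1) n.

Section root_system.

Definition dot (F : pzSemiRingType) (n : nat) (u v : 'rV[F]_n) : F :=
  \sum_i u 0 i * v 0 i.

(* for F = C this is the C-bilinear, not the Hermitian, formula *)
Definition reflection (F : fieldType) (n : nat) (a x : 'rV[F]_n) : 'rV[F]_n :=
  x - (2 * dot a x / dot a a) *: a.

Variables (R : realType) (n : nat).
Local Notation V := 'rV[R]_n.
Implicit Types (Rt Rp : {fset V}) (k : V -> R).

(* the library norm `|x| on 'rV[R]_n is the sup norm *)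
Definition enorm (x : V) : R := Num.sqrt (dot x x).

(* reflections are involutions, so the group they generate consists of the
   finite words in them *)
Definition weyl_group Rt : set (V -> V) :=
  [set g | exists2 s : seq V, {subset s <= Rt} &
                              g = foldr (fun a h => reflection a \o h) id s].

Definition root_system Rt : Prop :=
  [/\ 0 \notin Rt, finite_set (weyl_group Rt) &
      forall a, a \in Rt -> reflection a @` [set` Rt] = [set` Rt]].

(* Rp is the part of Rt on one side of a hyperplane containing no root *)
Definition positive_subsystem Rt Rp : Prop :=
  exists2 b : V, forall a, a \in Rt -> dot a b != 0 &
                 forall a, (a \in Rp) = (a \in Rt) && (0 < dot a b).

Definition multiplicity Rt k : Prop :=
  forall a, a \in Rt -> 0 <= k a /\ forall g, weyl_group Rt g -> k (g a) = k a.

Definition weyl_chamber Rt : set (set V) :=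
  [set C | exists2 Rp, positive_subsystem Rt Rp &
                       C = [set x | forall a, a \in Rp -> 0 <= dot x a]].

Definition frontier (A : set V) : set V := closure A `\` A°.

(* +oo when A is empty, which happens for A = frontier C if Rt is empty *)
Definition dist (x : V) (A : set V) : \bar R :=
  ereal_inf [set (enorm (x - a))%:E | a in A].

Definition regular Rt (x : V) : Prop :=
  forall C, weyl_chamber Rt C -> ~ frontier C x.

Definition regular_pair Rt (x lam : V) : Prop :=
  [/\ regular Rt x, regular Rt lam &
      exists C, [/\ weyl_chamber Rt C, C° x, C° lam &
        ((enorm (x - lam))%:E < maxe (dist x (frontier C)) (dist lam (frontier C)))%E]].

End root_system.

Section dunkl_kernel.
Variables (R : realType) (n : nat).
Local Notation V := 'rV[R]_n.
Local Notation C := R[i].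
Local Notation CV := 'rV[R[i]]_n.
Implicit Types (Rp : {fset V}) (k : V -> R) (E : CV -> CV -> C).

Definition toC (x : V) : CV := map_mx (real_complex R) x.

Definition holomorphic (f : CV -> C) : Prop :=
  forall z, differentiable (f : CV -> C^o) z.

Definition directional (xi : CV) (f : CV -> C) (z : CV) : C :=
  'D_xi (f : CV -> C^o) z.

(* (f(z) - f(sigma_a z)) / <a, z>, extended to the hyperplane <a, z> = 0 by its
   limit there (f being holomorphic), since division by 0 yields 0 *)
Definition difference_quotient (a : V) (f : CV -> C) (z : CV) : C :=
  if dot (toC a) z == 0 then 2 / dot (toC a) (toC a) * directional (toC a) f z
  else (f z - f (reflection (toC a) z)) / dot (toC a) z.

Definition dunkl_operator Rp k (xi : CV) (f : CV -> C) (z : CV) : C :=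
  directional xi f z +
  \sum_(a <- Rp) real_complex R (k a) * dot (toC a) xi * difference_quotient a f z.

Definition dunkl_eigenfunction Rp k (w : CV) (f : CV -> C) : Prop :=
  [/\ holomorphic f, f 0 = 1 &
      forall xi z, dunkl_operator Rp k xi f z = dot xi w * f z].

Definition dunkl_kernel Rp k E : Prop :=
  forall w, dunkl_eigenfunction Rp k w (E^~ w) /\
            forall g, dunkl_eigenfunction Rp k w g -> g = E^~ w.

(* E_k is real on R^n x R^n, so taking real parts loses nothing *)
Definition real_kernel E (x y : V) : R := complex.Re (E (toC x) (toC y)).

Definition dunkl_weight Rp k (x : V) : R :=
  \prod_(a <- Rp) `|dot a x| `^ (2 * k a).

Definition dunkl_gamma Rp k : R := \sum_(a <- Rp) k a.

Definition dunkl_const Rp k : R :=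
  (fine (\int[lebesgue_rV R n]_y
    (expR (- (enorm y ^+ 2 / 2)) * dunkl_weight Rp k y)%:E))^-1.

Definition dunkl_transition Rp k E (lam : V) (t : R) (x : V)
    (A : set (borelRV R n)) : \bar R :=
  ((dunkl_const Rp k * expR (- (enorm lam ^+ 2 * t / 2))
      / t `^ (dunkl_gamma Rp k + n%:R / 2))%:E *
   \int[lebesgue_rV R n]_(y in A)
     (expR (- ((enorm x ^+ 2 + enorm y ^+ 2) / (2 * t))) *
      (real_kernel E ((Num.sqrt t)^-1 *: x) ((Num.sqrt t)^-1 *: y)
         * real_kernel E y lam / real_kernel E x lam) *
      dunkl_weight Rp k y)%:E)%E.

End dunkl_kernel.

Section process.
Variables (R : realType) (n : nat).
Local Notation V := 'rV[R]_n.
Implicit Types K : R -> V -> set (borelRV R n) -> \bar R.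

Definition semigroup_op K (t : R) (f : V -> R) (x : V) : R :=
  fine (\int[K t x]_y (f y)%:E).

Definition C0 (f : V -> R) : Prop :=
  continuous f /\
  forall e, 0 < e -> exists M, forall x, M < enorm x -> `|f x| < e.

(* the Feller property on C_0(R^n), with strong continuity at 0 in sup norm *)
Definition feller_transition K : Prop :=
  forall f, C0 f ->
    (forall t, 0 < t -> C0 (semigroup_op K t f)) /\
    (forall e, 0 < e ->
       \forall t \near 0^'+, forall x, `|semigroup_op K t f x - f x| < e).

Variables (d : measure_display) (T : measurableType d).
Implicit Types X : R -> T -> V.

Definition past X (s : R) : set (set T) :=
  <<s [set X u @^-1` B | u in [set u : R | 0 <= u <= s]
                       & B in @measurable _ (borelRV R n)] >>.

Definition rcll (x : R -> V) : Prop :=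
  (forall t, 0 <= t -> x s @[s --> t^'+] --> x t) /\
  (forall t, 0 < t -> cvg (x s @[s --> t^'-])).

(* X is indexed by R, but only the times t >= 0 matter *)
Record feller_process K (P : probability T R) X (z : V) : Prop := FellerProcess {
  feller_process_transition : feller_transition K ;
  feller_process_measurable : forall t, 0 <= t ->
    measurable_fun [set: T] (X t : T -> borelRV R n) ;
  feller_process_start : P [set w | X 0 w = z] = 1%E ;
  feller_process_markov : forall s t, 0 <= s -> s < t ->
    forall A : set (borelRV R n), measurable A -> forall F, past X s F ->
      P (F `&` X t @^-1` A) = (\int[P]_(w in F) K (t - s)%R (X s w) A)%E ;
  feller_process_rcll : forall w, rcll (X^~ w) }.

End process.

(* the Y t may live on different probability spaces *)
Definition cvg_in_distribution (R : realType) (n : nat) (d : measure_display)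
    (T : R -> measurableType d) (P : forall t, probability (T t) R)
    (Y : forall t, T t -> 'rV[R]_n) (nu : probability (borelRV R n) R) : Prop :=
  forall f : 'rV[R]_n -> R, continuous f ->
    (exists M, forall x, `|f x| <= M) ->
    ('E_(P t)[(fun w => f (Y t w))] @[t --> +oo%R] -->
     \int[nu]_y (f y)%:E)%E.

(* Main.v *)
Require Import Defs.
From HB Require Import structures.
From mathcomp Require Import all_boot all_order all_algebra finmap complex.
From mathcomp Require Import all_classical all_reals all_analysis.
From mathcomp Require Import measurable_realfun ring lra.

Set Implicit Arguments.
Unset Strict Implicit.
Unset Printing Implicit Defensive.

Import Order.TTheory GRing.Theory Num.Theory.
Import numFieldNormedType.Exports.

Local Open Scope classical_set_scope.
Local Open Scope ring_scope.

(** Why the convergence holds. Along a ray [s |-> s *: y] the eigenvalue equations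
    of the Dunkl operators become, for the finitely many functions
    [s |-> E (s y g) w] with [g] in the Weyl group, a linear system of ordinary
    differential equations with a dissipative singularity at [0]. An energy
    estimate ([radial_system_zero]) shows that its solutions are determined by
    their values at [0], and the system has symmetries that yield
    [E x y = E y x] ([real_kernel_sym]) and [E (c x) y = E x (c y)]
    ([real_kernelZ]). Hence the density at time [t] of the process with drift
    [lam] started in [t x] is, up to a factor depending only on [t],
<<
      rho t y = exp (- |y|^2 / (2 t)) E(y, lam) E(y, x) w(y).
>>
    As [lam], [x] and hence [xi = lam + x] lie in the same open chamber, simple
    transitivity of the Weyl group on the chambers gives
    [<eta g, mu> < <eta, mu>] for [g != 1], [eta] near [xi] and [mu] either [lam]
    or [x] ([weylW_lt]). In the linear system this gap makes the values at the other
    orbit points smaller than the value at [t eta] by a factor of order [1/t]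
    ([ray_dominant], and [uniform_dominant] for a ball of directions [eta] around
    [xi]). Consequently the logarithm of
    [E(t eta, mu) exp (- t <eta, mu>) w(eta)^(1/2)] varies by [O(1/t)] on this ball
    ([log_kernel_part_close]). Applied to [mu = lam] and to [mu = x], this cancels
    the weight in [rho] and leaves
<<
      rho t y / rho t (t xi) = exp (- |y - t xi|^2 / (2 t)) (1 + O(1/t))
>>
    for [|y - t xi| <= delta t]. Near the other points of the orbit of [t xi] the
    density is smaller by a factor of order [1/t^2], and elsewhere it is in a
    Gaussian tail; together, the error is [O(1/t)] times a sum of wider Gaussians
    centered at the orbit of [t xi] ([gaussian_approximation]).

    Integrating against a bounded continuous function of [(y - t xi) / sqrt t]
    gives the standard normal expectation up to [O(1/t)], once the normalization
    is known; it is, because transition probabilities have mass 1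
    ([integral_ratio_close], [quotient_close]). The same fact gives
    positivity of the kernel: where it vanished, the transition probability would
    vanish as well, so it has no zeros and keeps the sign of [E(0, y) = 1]
    ([real_kernel_gt0]). *)

(** * Scalar product and reflections *)

Section dot_product.
Variables (R : realType) (n : nat).
Local Notation V := 'rV[R]_n.
Implicit Types (u v w a : V) (g : 'M[R]_n).

Lemma dotC u v : dot u v = dot v u.
Proof. by apply: eq_bigr => i _; rewrite mulrC. Qed.

Lemma dotDl u v w : dot (u + v) w = dot u w + dot v w.
Proof. by rewrite -big_split; apply: eq_bigr => i _; rewrite mxE mulrDl. Qed.

Lemma dotZl c u v : dot (c *: u) v = c * dot u v.
Proof. by rewrite mulr_sumr; apply: eq_bigr => i _; rewrite mxE mulrA. Qed.

Lemma dotNl u v : dot (- u) v = - dot u v.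
Proof. by rewrite -scaleN1r dotZl mulN1r. Qed.

Lemma dotBl u v w : dot (u - v) w = dot u w - dot v w.
Proof. by rewrite dotDl dotNl. Qed.

Lemma dot0l v : dot 0 v = 0.
Proof. by rewrite -(scale0r 0) dotZl mul0r. Qed.

Lemma dotDr u v w : dot u (v + w) = dot u v + dot u w.
Proof. by rewrite dotC dotDl !(dotC u). Qed.

Lemma dotZr c u v : dot u (c *: v) = c * dot u v.
Proof. by rewrite dotC dotZl dotC. Qed.

Lemma dotNr u v : dot u (- v) = - dot u v.
Proof. by rewrite dotC dotNl dotC. Qed.

Lemma dotBr u v w : dot u (v - w) = dot u v - dot u w.
Proof. by rewrite dotDr dotNr. Qed.

Lemma dot_suml (I : Type) (r : seq I) (F : I -> V) v :
  dot (\sum_(i <- r) F i) v = \sum_(i <- r) dot (F i) v.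
Proof.
by elim/big_ind2 : _ => [|u1 x1 u2 x2 <- <-|//]; rewrite ?dot0l ?dotDl.
Qed.

Lemma dot_ge0 v : 0 <= dot v v.
Proof. by apply: sumr_ge0 => i _; rewrite -expr2 sqr_ge0. Qed.

Lemma dot_eq0 v : (dot v v == 0) = (v == 0).
Proof.
apply/idP/eqP => [|->]; last by rewrite dot0l.
rewrite psumr_eq0 => [/allP v0|i _]; last by rewrite -expr2 sqr_ge0.
apply/rowP => i; rewrite mxE; apply/eqP.
by have := v0 i (mem_index_enum _); rewrite /= mulf_eq0 orbb.
Qed.

Lemma dot_gt0 v : v != 0 -> 0 < dot v v.
Proof. by rewrite lt0r dot_ge0 dot_eq0 andbT. Qed.

Lemma dotE u v : dot u v = (u *m v^T) 0 0.
Proof. by rewrite mxE; apply: eq_bigr => i _; rewrite mxE. Qed.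

Lemma dot_mulmx u v g : dot (u *m g) v = dot u (v *m g^T).
Proof. by rewrite !dotE trmx_mul trmxK mulmxA. Qed.

(** Cauchy-Schwarz as Young's inequality: scalar products are bounded by a sum of
    squared lengths, which [c] distributes between the two vectors. *)
Lemma dot_young u v c : 0 < c -> 2 * `|dot u v| <= c * dot u u + c^-1 * dot v v.
Proof.
move=> c0; have := dot_ge0 (c *: u - v); have := dot_ge0 (c *: u + v).
rewrite !(dotDl, dotDr, dotNl, dotNr, dotZl, dotZr) (dotC v u) => h1 h2.
rewrite -(ler_pM2l c0) mulrDr mulrA (mulrA _ c^-1) divff ?gt_eqF// mul1r.
have [uv0|uv0] := ltP (dot u v) 0; first by rewrite ltr0_norm //; nra.
by rewrite ger0_norm //; nra.
Qed.

(** Reflections are encoded as matrices acting on row vectors from the right, so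
    that the group they generate is a finite set of matrices, over which sums can
    be taken. *)
Definition refl_mx a : 'M[R]_n := 1%:M - (2 / dot a a) *: (a^T *m a).

Lemma mul_refl_mx v a : v *m refl_mx a = reflection a v.
Proof.
rewrite /refl_mx mulmxBr mulmx1 -scalemxAr mulmxA /reflection.
congr (_ - _); rewrite [v *m a^T]mx11_scalar mul_scalar_mx -dotE scalerA.
by rewrite (dotC v) mulrAC.
Qed.

Lemma refl_mxE v a : v *m refl_mx a = v - (2 * dot a v / dot a a) *: a.
Proof. exact: mul_refl_mx. Qed.

Lemma tr_refl_mx a : (refl_mx a)^T = refl_mx a.
Proof. by rewrite /refl_mx linearB linearZ /= trmx1 trmx_mul trmxK. Qed.

Lemma mulmx_refl_self a : a != 0 -> a *m refl_mx a = - a.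
Proof.
move=> /dot_gt0 a0; rewrite refl_mxE -mulrA divff ?gt_eqF// mulr1.
by rewrite scaler_nat mulr2n opprD addrA subrr sub0r.
Qed.

Lemma refl_mxK a : a != 0 -> refl_mx a *m refl_mx a = 1%:M.
Proof.
move=> a0; rewrite {1}/refl_mx mulmxBl mul1mx -scalemxAl -mulmxA.
rewrite mulmx_refl_self // mulmxN scalerN opprK.
by rewrite /refl_mx addrNK.
Qed.

Lemma refl_mxZ c a : c != 0 -> refl_mx (c *: a) = refl_mx a.
Proof.
move=> c0; have [->|a0] := eqVneq a 0; first by rewrite scaler0.
rewrite /refl_mx; congr (_ - _); rewrite dotZl dotZr.
rewrite [(c *: a)^T]linearZ /= -scalemxAl.
rewrite -scalemxAr !scalerA; congr (_ *: _).
by field; rewrite c0 dot_eq0 a0.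
Qed.

Lemma refl_mxN a : refl_mx (- a) = refl_mx a.
Proof. by rewrite -scaleN1r refl_mxZ // oppr_eq0 oner_eq0. Qed.

Lemma refl_mx_conj a g : g *m g^T = 1%:M ->
  refl_mx (a *m g) = g^T *m refl_mx a *m g.
Proof.
move=> gg; have gg' : g^T *m g = 1%:M by exact: mulmx1C.
rewrite /refl_mx mulmxBr mulmxBl mulmx1 gg' trmx_mul; congr (_ - _).
by rewrite -scalemxAr -scalemxAl !mulmxA dot_mulmx -mulmxA gg mulmx1.
Qed.

End dot_product.

(** * Simple transitivity of the Weyl group on the open chambers *)

Section weyl.
Variables (R : realType) (n : nat).
Local Notation V := 'rV[R]_n.
Variable Rt : {fset V}.
Hypothesis HRt : root_system Rt.
Implicit Types (a b v c : V) (g : 'M[R]_n) (s D : seq V).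

Lemma root_neq0 a : a \in Rt -> a != 0.
Proof. by case: HRt => R0 _ _ aR; apply: contraNneq R0 => <-. Qed.

Lemma root_refl a b : a \in Rt -> b \in Rt -> b *m refl_mx a \in Rt.
Proof.
case: HRt => _ _ /(_ a) HR aR bR; rewrite mul_refl_mx.
have : (reflection a @` [set` Rt]) (reflection a b) by exists b.
by rewrite (HR aR).
Qed.

Lemma root_systemN a : a \in Rt -> - a \in Rt.
Proof.
by move=> aR; rewrite -mulmx_refl_self ?root_neq0// root_refl.
Qed.

(** Letters are composed in the order of [weyl_group]: the head acts last. *)
Definition word_mx s : 'M[R]_n := foldr (fun a g => g *m refl_mx a) 1%:M s.

Lemma word_mx_cat s1 s2 : word_mx (s1 ++ s2) = word_mx s2 *m word_mx s1.
Proof. by elim: s1 => [|a s IH] /=; rewrite ?mulmx1// IH mulmxA. Qed.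

Lemma word_mx_orth s : {subset s <= Rt} -> word_mx s *m (word_mx s)^T = 1%:M.
Proof.
elim: s => [|a s IH] sR /=; first by rewrite trmx1 mulmx1.
rewrite trmx_mul tr_refl_mx -mulmxA (mulmxA (refl_mx a)) refl_mxK ?mul1mx.
  by apply: IH => b bs; apply: sR; rewrite inE bs orbT.
by rewrite root_neq0// sR// mem_head.
Qed.

Lemma word_mx_root s a : {subset s <= Rt} -> a \in Rt -> a *m word_mx s \in Rt.
Proof.
elim: s => [|b s IH] sR aR /=; first by rewrite mulmx1.
rewrite mulmxA; apply: root_refl; first by rewrite sR// mem_head.
by apply: IH => // x xs; apply: sR; rewrite inE xs orbT.
Qed.

Lemma tr_word_mx s : (word_mx s)^T = word_mx (rev s).
Proof.
elim: s => [|a s IH] /=; first by rewrite trmx1.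
rewrite trmx_mul tr_refl_mx IH rev_cons -cats1 word_mx_cat /=.
by rewrite mul1mx.
Qed.

Section simple_system.
Variable c : V.
Hypothesis cR : forall a, a \in Rt -> dot a c != 0.

Definition pos_root a := (a \in Rt) && (0 < dot a c).

Lemma pos_rootN a : a \in Rt -> ~~ pos_root a -> pos_root (- a).
Proof.
move=> aR; rewrite /pos_root aR root_systemN//= dotNl oppr_gt0 -leNgt.
by rewrite le_eqVlt (negbTE (cR aR)).
Qed.

Definition in_cone D v :=
  exists2 x : V -> R, (forall d, 0 <= x d) & v = \sum_(d <- D) x d *: d.

Definition generating D :=
  {subset D <= pos_root} /\ (forall a, pos_root a -> in_cone D a).

Lemma generating_pos : generating [seq a <- Rt | pos_root a].
Proof.
split=> [a|a pa]; first by rewrite mem_filter => /andP[].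
exists (fun d => (d == a)%:R) => [d|]; first exact: ler0n.
rewrite (bigD1_seq a) ?filter_uniq ?fset_uniq//=; last first.
  by rewrite mem_filter pa /=; case/andP: pa.
by rewrite eqxx scale1r big1 ?addr0// => d /negbTE ->; rewrite scale0r.
Qed.

(** Least cardinality stands in for linear independence: it makes every element
    span an extremal ray of the cone of the positive roots. *)
Definition simple_system D :=
  generating D /\ forall D', generating D' -> (size D <= size D')%N.

Lemma simple_system_ex : exists D, simple_system D.
Proof.
have ex : exists m, `[< exists2 D, generating D & size D = m >].
  exists (size [seq a <- Rt | pos_root a]); apply/asboolP.
  by eexists; first exact: generating_pos.
case: (ex_minnP ex) => m /asboolP[D gD <-] mn; exists D; split=> // D' gD'.
by apply: mn; apply/asboolP; exists D'.
Qed.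

Variable D : seq V.
Hypothesis HD : simple_system D.

Lemma simple_root a : a \in D -> pos_root a.
Proof. by case: HD => -[h _] _ /h. Qed.

Lemma simple_root_root a : a \in D -> a \in Rt.
Proof. by move=> /simple_root/andP[]. Qed.

Lemma simple_not_in_cone a : a \in D -> ~ in_cone (rem a D) a.
Proof.
move=> aD [y y0 ay]; case: HD => -[DR Dgen] /(_ (rem a D)) mn.
have : generating (rem a D).
  split=> [b /mem_rem/DR//|b /Dgen[x x0 ->]].
  exists (fun d => x a * y d + x d) => [d|].
    by rewrite addr_ge0 ?mulr_ge0.
  rewrite (big_rem a)//= [X in x a *: X]ay scaler_sumr -big_split/=.
  by apply: eq_bigr => d _; rewrite scalerDl scalerA.
by move=> /mn; rewrite size_rem//; case: (D) aD => //= ? l; rewrite ltnn.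
Qed.

(** If [b] were sent to a negative root [- d], then the multiple [b + d] of [a]
    would be a sum of two vectors of the cone, and since [a] is extremal in the
    cone, [b] would be proportional to [a]. *)
Lemma simple_refl_pos a b : a \in D -> pos_root b ->
  pos_root (b *m refl_mx a) \/ exists2 t, 0 < t & b = t *: a.
Proof.
move=> aD pb; have aR := simple_root_root aD; case/andP: (pb) => bR bc.
have [|np] := boolP (pos_root (b *m refl_mx a)); first by left.
right; have := pos_rootN (root_refl aR bR) np.
rewrite refl_mxE opprB; set t := _ / _ => pd.
have [_ gen] := HD.1; have [x x0 xE] := gen _ pb; have [y y0 yE] := gen _ pd.
have [ac0 a0] : 0 < dot a c /\ a != 0.
  by split; [case/andP: (simple_root aD)|exact: root_neq0].
have key : t *: a = \sum_(d <- D) (x d + y d) *: d.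
  under eq_bigr do rewrite scalerDl.
  by rewrite big_split/= -xE -yE addrC subrK.
rewrite (big_rem a)//= in key.
have key2 : (t - (x a + y a)) *: a = \sum_(d <- rem a D) (x d + y d) *: d.
  by rewrite scalerBl key addrAC subrr add0r.
have [tz|tz] := ltP (x a + y a) t.
  exfalso; apply: (simple_not_in_cone aD).
  exists (fun d => (t - (x a + y a))^-1 * (x d + y d)) => [d|].
    by rewrite mulr_ge0 ?addr_ge0 ?invr_ge0 ?subr_ge0 ?(ltW tz).
  under eq_bigr do rewrite -scalerA.
  by rewrite -scaler_sumr -key2 scalerA mulVf ?scale1r ?subr_eq0 ?gt_eqF.
have z0 : forall d, d \in rem a D -> x d = 0.
  have : \sum_(d <- rem a D) (x d + y d) * dot d c == 0.
    rewrite eq_le; apply/andP; split.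
      have -> : \sum_(d <- rem a D) (x d + y d) * dot d c =
                dot (\sum_(d <- rem a D) (x d + y d) *: d) c.
        by rewrite dot_suml; apply: eq_bigr => d _; rewrite dotZl.
      by rewrite -key2 dotZl mulr_le0_ge0 ?subr_le0// ltW.
    rewrite big_seq; apply: sumr_ge0 => d /mem_rem/simple_root/andP[_ dc].
    by rewrite mulr_ge0 ?addr_ge0// ltW.
  rewrite big_seq psumr_eq0 => [/allP zz d dD|d /mem_rem/simple_root/andP[_ dc]].
    have := zz _ dD; rewrite dD /= mulf_eq0 => /orP[|]; last first.
      by rewrite gt_eqF//; case/andP: (simple_root (mem_rem dD)).
    by rewrite paddr_eq0// => /andP[/eqP].
  by rewrite mulr_ge0 ?addr_ge0// ltW.
have bE : b = x a *: a.
  rewrite {1}xE (big_rem a)//= big_seq big1 ?addr0// => d dD.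
  by rewrite z0// scale0r.
exists (x a) => //; rewrite lt0r x0 andbT; apply/eqP => xa0.
by move: bc; rewrite bE xa0 scale0r dot0l ltxx.
Qed.

(** Descent on the number of roots of smaller height: a positive root that is
    not a multiple of a simple one has a simple reflection lowering it. *)
Lemma refl_mx_simple_word a : pos_root a ->
  exists2 s, {subset s <= D} & refl_mx a = word_mx s.
Proof.
pose N a := #|` [fset b in Rt | dot b c < dot a c]%fset|.
have [m] := ubnP (N a); elim: m a => // m IH a aN pa.
have [_ gen] := HD.1; have [x x0 xE] := gen _ pa.
have /andP[aR ac] := pa.
have [|[d dD ad]] : (forall d, d \in D -> dot d a <= 0) \/
    exists2 d, d \in D & 0 < dot d a.
  have [h|h] := pselect (exists2 d, d \in D & 0 < dot d a); first by right.
  left=> d dD; rewrite leNgt; apply/negP => h'; by apply: h; exists d.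
  move=> h; exfalso; have := dot_gt0 (root_neq0 aR).
  rewrite {1}xE dot_suml ltNge big_seq sumr_le0// => d dD.
  by rewrite dotZl mulr_ge0_le0 ?h.
have dR := simple_root_root dD.
have [pd|[t t0 ->]] := simple_refl_pos dD pa; last first.
  exists [:: d]; first by move=> ?; rewrite inE => /eqP ->.
  by rewrite refl_mxZ ?gt_eqF//= mul1mx.
have lower : dot (a *m refl_mx d) c < dot a c.
  rewrite refl_mxE dotBl dotZl ltrBlDr ltrDl mulr_gt0 ?divr_gt0 ?mulr_gt0//.
    exact/dot_gt0/root_neq0.
  by case/andP: (simple_root dD).
have [|s sD sE] := IH (a *m refl_mx d) _ pd.
  rewrite -ltnS; apply: leq_trans aN; rewrite ltnS /N.
  apply: fproper_ltn_card; rewrite fproperE; apply/andP; split.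
    apply/fsubsetP => b.
    by rewrite !inE /= => /andP[-> /lt_trans]; exact.
  by apply/fsubsetPn; exists (a *m refl_mx d); rewrite !inE /= ?ltxx ?andbF// root_refl.
exists (d :: rcons s d).
  by move=> b; rewrite inE mem_rcons inE orbA orbb => /orP[/eqP ->|/sD].
have dd := refl_mxK (root_neq0 dR).
have : refl_mx d *m refl_mx (a *m refl_mx d) *m refl_mx d = refl_mx a.
  rewrite refl_mx_conj ?tr_refl_mx// !mulmxA dd mul1mx -mulmxA dd.
  by rewrite mulmx1.
by rewrite /= -cats1 word_mx_cat/= mul1mx -sE => ->.
Qed.

Lemma root_word_simple s : {subset s <= Rt} ->
  exists2 s', {subset s' <= D} & word_mx s = word_mx s'.
Proof.
elim: s => [|a s IH] sR; first by exists [::].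
have [|s1 s1D s1E] := IH; first by move=> b bs; apply: sR; rewrite inE bs orbT.
have aR : a \in Rt by rewrite sR// mem_head.
have [s2 s2D s2E] : exists2 s2, {subset s2 <= D} & refl_mx a = word_mx s2.
  have [pa|npa] := boolP (pos_root a); first exact: refl_mx_simple_word.
  by rewrite -refl_mxN; apply/refl_mx_simple_word/pos_rootN.
exists (s2 ++ s1); last by rewrite word_mx_cat/= s1E s2E.
by move=> b; rewrite mem_cat => /orP[/s2D|/s1D].
Qed.

(** The exchange condition: if the inverse of the word turns the positive root [b]
    negative, then some of its letters have moved [b] to a multiple of the simple
    root of the next letter, which can therefore be cancelled. *)
Lemma exchange s b : {subset s <= D} -> pos_root b ->
  ~~ pos_root (b *m (word_mx s)^T) ->
  exists s', [/\ {subset s' <= D}, size s = (size s').+1 &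
                 word_mx s *m refl_mx b = word_mx s'].
Proof.
elim: s b => [|a s IH] b sD pb /=; first by rewrite trmx1 mulmx1 pb.
rewrite trmx_mul tr_refl_mx mulmxA => nb.
have aD : a \in D by rewrite sD// mem_head.
have a0 : a != 0 by exact/root_neq0/simple_root_root.
have sD' : {subset s <= D} by move=> x xs; rewrite sD// inE xs orbT.
have [pab|[t t0 bE]] := simple_refl_pos aD pb; last first.
  exists s; split=> //.
  by rewrite bE refl_mxZ ?gt_eqF// -mulmxA refl_mxK// mulmx1.
have [s' [s'D ss' E]] := IH _ sD' pab nb.
exists (a :: s'); split; first by move=> x; rewrite inE => /orP[/eqP ->|/s'D].
  by rewrite /= ss'.
rewrite /= -E refl_mx_conj ?tr_refl_mx ?refl_mxK//.
by rewrite !mulmxA -!(mulmxA _ (refl_mx a) (refl_mx a)) refl_mxK// mulmx1.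
Qed.

(** In a nonempty word that preserves the chamber of [c], the inverse of the part
    before the last letter to act makes the root of that letter negative; the
    exchange condition then shortens the word by two letters. *)
Lemma simple_word_fix s : {subset s <= D} ->
  (forall a, a \in Rt -> 0 < dot a c * dot a (c *m word_mx s)) ->
  word_mx s = 1%:M.
Proof.
have [m] := ubnP (size s); elim: m s => // m IH [|a s] //= sm sD h.
have aD : a \in D by rewrite sD// mem_head.
have pa := simple_root aD; have /andP[aR ac] := pa.
have sD' : {subset s <= D} by move=> x xs; rewrite sD// inE xs orbT.
have na : ~~ pos_root (a *m (word_mx s)^T).
  have := h _ aR; rewrite mulmxA.
  rewrite pmulr_rgt0// (dotC a) dot_mulmx tr_refl_mx mulmx_refl_self ?root_neq0//.
  rewrite dotNr oppr_gt0 dot_mulmx dotC => h'.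
  by rewrite /pos_root negb_and -leNgt (ltW h') orbT.
have [s' [s'D ss' E]] := exchange sD' pa na.
rewrite E; apply: IH => //; last by move=> b bR; rewrite -E; exact: h.
by move: sm; rewrite ss' !ltnS => /ltnW.
Qed.

End simple_system.

Lemma word_mx_fix c s : (forall a, a \in Rt -> dot a c != 0) ->
  {subset s <= Rt} ->
  (forall a, a \in Rt -> 0 < dot a c * dot a (c *m word_mx s)) ->
  word_mx s = 1%:M.
Proof.
move=> cR sR h; have [D HD] := simple_system_ex c.
have [s' s'D E] := root_word_simple cR HD sR.
by rewrite E; apply: (simple_word_fix cR HD s'D) => a aR; rewrite -E h.
Qed.

Definition weylW : {fset 'M[R]_n} :=
  fset_set [set g : 'M[R]_n | weyl_group Rt (mulmx^~ g)].

Lemma weyl_word s v :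
  v *m word_mx s = foldr (fun a h => reflection a \o h) id s v.
Proof.
by elim: s v => [|a s IH] v /=; rewrite ?mulmx1// mulmxA mul_refl_mx IH.
Qed.

Lemma mulmx_inj (g h : 'M[R]_n) : (fun v : V => v *m g) = (fun v => v *m h) -> g = h.
Proof.
move=> gh; apply/row_matrixP => i; rewrite !rowE.
exact: (congr1 (fun f => f (delta_mx 0 i)) gh).
Qed.

Lemma weylWP g : g \in weylW <-> exists2 s, {subset s <= Rt} & g = word_mx s.
Proof.
have fin : finite_set [set g : 'M[R]_n | weyl_group Rt (mulmx^~ g)].
  case: HRt => _ fW _.
  have := @finite_preimage _ _ (weyl_group Rt) (fun g : 'M[R]_n => mulmx^~ g).
  by apply=> // x y _ _; exact: mulmx_inj.
rewrite in_fset_set// inE /=; split=> -[s sR sE]; exists s => //.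
  by apply: mulmx_inj; rewrite sE; apply/funext => v; rewrite weyl_word.
by rewrite sE; apply/funext => v; rewrite weyl_word.
Qed.

Lemma weylW1 : 1%:M \in weylW. Proof. by apply/weylWP; exists [::]. Qed.

Lemma weylW_refl a : a \in Rt -> refl_mx a \in weylW.
Proof.
move=> aR; apply/weylWP; exists [:: a]; last by rewrite /= mul1mx.
by move=> b; rewrite inE => /eqP ->.
Qed.

Lemma weylWM g h : g \in weylW -> h \in weylW -> g *m h \in weylW.
Proof.
move=> /weylWP[s sR ->] /weylWP[t tR ->]; apply/weylWP.
exists (t ++ s); last by rewrite word_mx_cat.
by move=> x; rewrite mem_cat => /orP[/tR|/sR].
Qed.

Lemma weylW_tr g : g \in weylW -> g^T \in weylW.
Proof.
move=> /weylWP[s sR ->]; apply/weylWP; exists (rev s); last exact: tr_word_mx.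
by move=> x; rewrite mem_rev => /sR.
Qed.

Lemma weylW_orth g : g \in weylW -> g *m g^T = 1%:M.
Proof. by move=> /weylWP[s sR ->]; exact: word_mx_orth. Qed.

Lemma weylW_orthV g : g \in weylW -> g^T *m g = 1%:M.
Proof. by move=> /weylW_orth; exact: mulmx1C. Qed.

Lemma weylW_dot g u v : g \in weylW -> dot (u *m g) (v *m g) = dot u v.
Proof. by move=> gW; rewrite dot_mulmx -mulmxA weylW_orth// mulmx1. Qed.

Lemma weylW_root g a : g \in weylW -> a \in Rt -> a *m g \in Rt.
Proof. by move=> /weylWP[s sR ->]; exact: word_mx_root. Qed.

Lemma weylW_mult (k : V -> R) g a : multiplicity Rt k ->
  g \in weylW -> a \in Rt -> k (a *m g) = k a.
Proof.
move=> Hk /weylWP[s sR ->] aR; have [_ /(_ (mulmx^~ (word_mx s)))] := Hk a aR.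
by apply; exists s => //; apply/funext => v; rewrite weyl_word.
Qed.

Definition regular_vec v := forall a, a \in Rt -> dot a v != 0.

Definition same_chamber u v := forall a, a \in Rt -> 0 < dot a u * dot a v.

Lemma same_chamber_regl u v : same_chamber u v -> regular_vec u.
Proof.
by move=> uv a aR; apply/eqP => au; have := uv a aR; rewrite au mul0r ltxx.
Qed.

Lemma same_chamber_sym u v : same_chamber u v -> same_chamber v u.
Proof. by move=> uv a aR; rewrite mulrC uv. Qed.

Lemma same_chamber_trans u v w :
  same_chamber u v -> same_chamber v w -> same_chamber u w.
Proof.
move=> uv vw a aR; have := mulr_gt0 (uv a aR) (vw a aR).
rewrite (_ : dot a u * dot a v * _ = dot a u * dot a w * dot a v ^+ 2); last by ring.
by apply: contraLR; rewrite -!leNgt => h; rewrite mulr_le0_ge0 ?sqr_ge0.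
Qed.

Lemma seq_max_ex (T : eqType) (s : seq T) (F : T -> R) x0 : x0 \in s ->
  exists2 x, x \in s & forall y, y \in s -> F y <= F x.
Proof.
elim: s x0 => // x s IH x0 _; case: s IH => [_|y s IH].
  by exists x; rewrite ?mem_head// => z; rewrite inE => /eqP ->.
have [z zs zmax] := IH y (mem_head _ _).
have [xz|zx] := leP (F x) (F z).
  by exists z => [|w]; rewrite inE ?zs ?orbT// => /orP[/eqP ->|/zmax].
exists x => [|w]; first exact: mem_head.
by rewrite inE => /orP[/eqP ->//|/zmax/le_trans]; apply; exact: ltW.
Qed.

Lemma weylW_max_dominant g u v : g \in weylW ->
  (forall h, h \in weylW -> dot (u *m h) v <= dot (u *m g) v) ->
  forall a, a \in Rt -> 0 <= dot a (u *m g) * dot a v.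
Proof.
move=> gW gmax a aR; have := gmax _ (weylWM gW (weylW_refl aR)).
have a0 := dot_gt0 (root_neq0 aR).
rewrite mulmxA refl_mxE dotBl dotZl gerBl.
by rewrite mulrAC pmulr_lge0 ?invr_gt0// -mulrA pmulr_rge0.
Qed.

(** The point of the orbit of [u] that is nearest to [v] works: if a root
    separated the two, its reflection would bring the point closer to [v]. *)
Lemma weylW_dominant u v : exists2 g, g \in weylW &
  forall a, a \in Rt -> 0 <= dot a (u *m g) * dot a v.
Proof.
have [g gW gmax] := @seq_max_ex _ weylW (fun g => dot (u *m g) v) _ weylW1.
by exists g => //; exact: weylW_max_dominant.
Qed.

(** Reflecting a maximizer shows that it lies in the chamber of [v]; by simple
    transitivity it is [u] itself. *)
Lemma weylW_lt u v g : same_chamber u v -> g \in weylW -> g != 1%:M ->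
  dot (u *m g) v < dot u v.
Proof.
move=> uv; have uR := same_chamber_regl uv.
have maxP h : h \in weylW ->
    (forall h', h' \in weylW -> dot (u *m h') v <= dot (u *m h) v) -> h = 1%:M.
  move=> hW hmax; have /weylWP[s sR hE] := hW; rewrite hE.
  apply: (word_mx_fix uR sR); rewrite -hE.
  apply: (same_chamber_trans uv) => a aR; rewrite mulrC.
  have h1 := weylW_max_dominant hW hmax aR; have h2 := uv a aR.
  have h3 : dot a (u *m h) != 0.
    by rewrite dotC dot_mulmx dotC uR// weylW_root// weylW_tr.
  rewrite lt_neqAle h1 andbT eq_sym mulf_neq0//.
  by apply: contraTneq h2 => ->; rewrite mulr0 ltxx.
move=> gW g1; have [h hW hmax] := @seq_max_ex _ weylW (fun g => dot (u *m g) v) _ weylW1.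
have h1 := maxP _ hW hmax; rewrite h1 mulmx1 in hmax.
rewrite lt_neqAle hmax// andbT; apply: contra g1 => /eqP E.
by apply/eqP/maxP => // h' h'W; rewrite E hmax.
Qed.

(** The limit case of [weylW_lt], obtained by moving [u] slightly towards [v] so
    that it enters the open chamber. *)
Lemma weylW_le u v g : regular_vec v ->
  (forall a, a \in Rt -> 0 <= dot a u * dot a v) -> g \in weylW ->
  dot (u *m g) v <= dot u v.
Proof.
move=> vR uv gW; have [->|g1] := eqVneq g 1%:M; first by rewrite mulmx1.
apply/ler_addgt0Pr => e e0.
pose M := 1 + `|dot v v| + `|dot (v *m g) v|.
have M0 : 0 < M by rewrite /M -addrA ltr_pwDl// addr_ge0.
have sc : same_chamber (u + (e / M) *: v) v.
  move=> a aR; rewrite dotDr dotZr mulrDl ltr_wpDl ?uv//.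
  rewrite -mulrA mulr_gt0 ?divr_gt0//.
  by rewrite -expr2 lt0r sqr_ge0 sqrf_eq0 vR.
have := weylW_lt sc gW g1.
rewrite mulmxDl -scalemxAl !dotDl !dotZl => h.
have hM : e / M * (dot v v - dot (v *m g) v) <= e.
  rewrite mulrAC ler_pdivrMr// ler_pM2l// /M.
  by have := ler_norm (dot v v); have := ler_norm (- dot (v *m g) v); rewrite normrN; lra.
rewrite mulrBr in hM; lra.
Qed.

End weyl.

(** * Reindexing sums over the roots *)

Section reindexing.

Lemma perm_fset_map (K : choiceType) (A : {fset K}) (f : K -> K) :
  {in A &, injective f} -> {in A, forall x, f x \in A} ->
  perm_eq [seq f x | x <- A] A.
Proof.
move=> finj fA; have u : uniq [seq f x | x <- A].
  by rewrite map_inj_in_uniq ?fset_uniq.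
have sub : {subset [seq f x | x <- A] <= A}.
  by move=> _ /mapP[x xA ->]; exact: fA.
have [_ h] := uniq_min_size u sub (eq_leq (esym (size_map _ _))).
exact: uniq_perm.
Qed.

Lemma big_fset_map (T : Type) (idx : T) (op : Monoid.com_law idx)
    (K : choiceType) (A : {fset K}) (f : K -> K) (F : K -> T) :
  {in A &, injective f} -> {in A, forall x, f x \in A} ->
  \big[op/idx]_(x <- A) F (f x) = \big[op/idx]_(x <- A) F x.
Proof.
move=> finj fA; rewrite -(big_map f xpredT F).
exact/perm_big/perm_fset_map.
Qed.

Variables (R : realType) (n : nat).
Local Notation V := 'rV[R]_n.

(** The Dunkl operators and the weight are written over the positive roots, on
    which the Weyl group does not act; this passes to all roots, where a sum can
    be reindexed by a group element. *)
Lemma big_positive_half (T : Type) (idx : T) (op : Monoid.com_law idx)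
    (Rt Rp : {fset V}) (F : V -> T) :
  root_system Rt -> positive_subsystem Rt Rp ->
  (forall a, a \in Rt -> F (- a) = F a) ->
  \big[op/idx]_(a <- Rt) F a =
    op (\big[op/idx]_(a <- Rp) F a) (\big[op/idx]_(a <- Rp) F a).
Proof.
move=> HRt [b bR HRp] FN; rewrite (bigID (mem Rp))/=; congr (op _ _).
  rewrite -big_filter; apply: perm_big; apply: uniq_perm.
  - by rewrite filter_uniq// fset_uniq.
  - by rewrite fset_uniq.
  by move=> a; rewrite mem_filter; apply: andb_idr; rewrite /= HRp => /andP[].
rewrite -big_filter.
rewrite [RHS](_ : _ = \big[op/idx]_(a <- Rp) F (- a)); last first.
  by apply: eq_big_seq => a; rewrite HRp => /andP[aR _]; rewrite FN.
rewrite -[RHS](big_map -%R xpredT F); apply: perm_big; apply: uniq_perm.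
- by rewrite filter_uniq// fset_uniq.
- by rewrite map_inj_uniq ?fset_uniq//; exact: oppr_inj.
move=> a; rewrite mem_filter; apply/andP/mapP => [[na aR]|[c cp ->]].
  exists (- a); last by rewrite opprK.
  move: na; rewrite /= !HRp aR (root_systemN HRt aR)/= dotNl oppr_gt0 -leNgt.
  by rewrite le_eqVlt (negbTE (bR a aR)).
move: cp; rewrite /= !HRp => /andP[cR c0]; rewrite root_systemN//=.
by rewrite dotNl oppr_gt0 -leNgt (ltW c0).
Qed.

End reindexing.

(** * Differentiation in one real variable *)

Section real_derivatives.
Variable R : realType.
Implicit Types (f g : R -> R) (s : R).

Lemma is_derive_mul f g s df dg : is_derive s 1 f df -> is_derive s 1 g dg ->
  is_derive s 1 (fun x => f x * g x) (df * g s + f s * dg).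
Proof.
move=> hf hg; have := is_deriveM hf hg.
by rewrite addrC /GRing.scale/= (mulrC (g s)).
Qed.

Lemma is_derive_add f g s df dg : is_derive s 1 f df -> is_derive s 1 g dg ->
  is_derive s 1 (fun x => f x + g x) (df + dg).
Proof. by move=> hf hg; exact: is_deriveD. Qed.

Lemma is_derive_sub f g s df dg : is_derive s 1 f df -> is_derive s 1 g dg ->
  is_derive s 1 (fun x => f x - g x) (df - dg).
Proof. by move=> hf hg; exact: is_deriveB. Qed.

Lemma is_derive_cmul c f s df : is_derive s 1 f df ->
  is_derive s 1 (fun x => c * f x) (c * df).
Proof. by move=> hf; exact: is_deriveZ. Qed.

Lemma is_derive_bigsum (I : eqType) (r : seq I) (F : I -> R -> R) (dF : I -> R) s :
  (forall i, i \in r -> is_derive s 1 (F i) (dF i)) ->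
  is_derive s 1 (fun x => \sum_(i <- r) F i x) (\sum_(i <- r) dF i).
Proof.
elim: r => [|i r IH] h.
  rewrite big_nil (_ : (fun x => _) = cst 0); first exact: is_derive_cst.
  by apply/funext => x; rewrite big_nil.
rewrite big_cons (_ : (fun x => _) = fun x => F i x + \sum_(i <- r) F i x).
  apply: is_derive_add; first by apply: h; rewrite mem_head.
  by apply: IH => j jr; apply: h; rewrite inE jr orbT.
by apply/funext => x; rewrite big_cons.
Qed.

Lemma continuous_bigsum (I : eqType) (r : seq I) (F : I -> R -> R) s :
  (forall i, i \in r -> {for s, continuous (F i)}) ->
  {for s, continuous (fun x => \sum_(i <- r) F i x)}.
Proof.
elim: r => [|i r IH] h.
  rewrite (_ : (fun x => _) = cst 0); first exact: cst_continuous.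
  by apply/funext => x; rewrite big_nil.
rewrite (_ : (fun x => _) = fun x => F i x + \sum_(i <- r) F i x).
  apply: continuousD; first by apply: h; rewrite mem_head.
  by apply: IH => j jr; apply: h; rewrite inE jr orbT.
by apply/funext => x; rewrite big_cons.
Qed.

Lemma is_derive_exp f s df : is_derive s 1 f df ->
  is_derive s 1 (fun x => expR (f x)) (expR (f s) * df).
Proof. by move=> hf; have := is_derive1_comp (is_derive_expR (f s)) hf. Qed.

Lemma is_derive_logarithm f s df : 0 < f s -> is_derive s 1 f df ->
  is_derive s 1 (fun x => ln (f x)) (df / f s).
Proof.
move=> f0 hf; have := is_derive1_comp (is_derive1_ln f0) hf.
by rewrite mulrC.
Qed.

Lemma is_derive_inv s : s != 0 ->
  is_derive s 1 (fun x : R => x^-1) (- s ^- 2).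
Proof.
move=> s0; have := @is_deriveV _ id s 1 1 s0 (is_derive_id _ _).
by rewrite [_ *: 1]mulr1.
Qed.

Lemma is_derive_linear (c s : R) : is_derive s 1 (fun x : R => c * x) c.
Proof.
by have := is_derive_cmul c (is_derive_id s 1); rewrite mulr1.
Qed.

Lemma is_derive_continuous f s df : is_derive s 1 f df -> {for s, continuous f}.
Proof. by move=> h; apply/differentiable_continuous/derivable1_diffP; case: h. Qed.

(** A directional derivative is a derivative at the parameter [0]; translation
    turns it into a derivative at any parameter of a line. *)
Lemma is_derive_translate f s df :
  is_derive (0 : R) 1 (fun h => f (s + h)) df -> is_derive s 1 f df.
Proof.
move=> h; have hs : is_derive s 1 (fun x : R => x - s) (1 : R).
  by have := is_derive_sub (is_derive_id s 1) (is_derive_cst s s 1); rewrite subr0.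
have h0 : is_derive (s - s) 1 (fun h => f (s + h)) df by rewrite subrr.
have := @is_derive1_comp R (fun h => f (s + h)) (fun x => x - s) s df 1 h0 hs.
rewrite mulr1 => h1.
rewrite (_ : f = (fun h => f (s + h)) \o (fun x => x - s))//.
by apply/funext => x /=; rewrite addrC subrK.
Qed.

Lemma is_derive_nincr f (df : R -> R) (a b : R) : a <= b ->
  (forall x, a < x < b -> is_derive x 1 f (df x)) ->
  (forall x, a < x < b -> df x <= 0) ->
  (forall x, a <= x <= b -> {for x, continuous f}) -> f b <= f a.
Proof.
move=> ab hd hn hc.
apply: (@ler0_derive1_le_cc R f a b) => //; rewrite ?in_itv/= ?lexx ?ab//.
- by move=> x; rewrite in_itv/= => /hd; case.
- move=> x; rewrite in_itv/= => xab; rewrite derive1E.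
  by have := hd _ xab => -[_ ->]; exact: hn.
- apply: continuous_in_subspaceT => x; rewrite inE/= in_itv/= => xab.
  exact: hc.
Qed.

Lemma is_derive_ndecr f (df : R -> R) (a b : R) : a <= b ->
  (forall x, a < x < b -> is_derive x 1 f (df x)) ->
  (forall x, a < x < b -> 0 <= df x) ->
  (forall x, a <= x <= b -> {for x, continuous f}) -> f a <= f b.
Proof.
move=> ab hd hn hc; rewrite -lerN2.
apply: (@is_derive_nincr (fun x => - f x) (fun x => - df x)) => // x xab.
- by have := hd _ xab => h; exact: is_deriveN.
- by rewrite oppr_le0 hn.
- by apply: continuousN; exact: hc.
Qed.

End real_derivatives.

(** * From complex to real derivatives *)

Section complex_to_real.
Variables (R : realType) (n : nat).
Local Notation V := 'rV[R]_n.
Local Notation C := R[i].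

Lemma continuous_Re : continuous (@complex.Re R : C^o -> R).
Proof.
move=> z A /nbhs_ballP[e /= e0 eA]; apply/nbhs_ballP.
exists (e%:C%C); first by rewrite /= ltcR.
move=> w; rewrite /ball/= => zw; apply: eA; rewrite /ball/= -ltcR.
by apply: le_lt_trans zw; rewrite -raddfB normc_ge_Re.
Qed.

Lemma real_complex_ball (x y : R) (e : C) :
  ball x (complex.Re e) y -> 0 < e -> ball (x%:C%C : C^o) e (y%:C%C).
Proof.
move=> xy e0; have -> : e = (complex.Re e)%:C%C by rewrite RRe_real// gtr0_real.
by rewrite /ball/= -rmorphB normc_def /= expr0n addr0 sqrtr_sqr ltcR.
Qed.

Let CV : normedModType C := 'rV[C]_n.

Lemma continuous_toC : continuous (@toC R n : V -> CV).
Proof.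
move=> x A /nbhs_ballP[e e0 eA]; apply/nbhs_ballP.
exists (complex.Re e); first by move: e0; rewrite /= ltcE => /andP[].
move=> y [_ xy]; apply: eA; split=> // i j; rewrite !mxE.
exact: real_complex_ball.
Qed.

Lemma toCD (x y : V) : toC (x + y) = toC x + toC y.
Proof. exact: map_mxD. Qed.

Lemma toCZ (a : R) (x : V) : toC (a *: x) = a%:C%C *: toC x.
Proof. exact: map_mxZ. Qed.

(** A complex derivative is a limit over all small complex increments, in
    particular over the real ones, along which taking real parts is linear. *)
Lemma is_derive_Re_toC (f : 'rV[C]_n -> C) (z xi : V) :
  differentiable (f : CV -> C^o) (toC z : CV) ->
  is_derive (0 : R) 1 (fun s : R => complex.Re (f (toC (z + s *: xi))))
    (complex.Re ('D_(toC xi) (f : CV -> C^o) (toC z))).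
Proof.
move=> /(@diff_derivable _ _ _ _ _ (toC xi)) fd.
have cR : (fun h : R => h^-1 *: ((complex.Re (f (toC (z + (h *: 1 + 0) *: xi))))
     - complex.Re (f (toC (z + (0 : R) *: xi))))) @ 0^' -->
   complex.Re ('D_(toC xi) (f : CV -> C^o) (toC z)).
  have c1 : real_complex R h @[h --> (0:R)^'] --> (0 : C^o)^'.
    move=> A /nbhs_ballP[e e0 eA]; apply/nbhs_ballP.
    exists (complex.Re e); first by move: e0; rewrite /= ltcE => /andP[].
    move=> y xy y0; apply: eA; first exact: real_complex_ball.
    by rewrite /= fmorph_eq0.
  have := cvg_comp _ _ (cvg_comp _ _ c1 fd) (@continuous_Re _).
  apply: cvg_trans; apply: near_eq_cvg; near=> h => /=.
  rewrite scale0r addr0 [h *: 1]mulr1 addr0 toCD toCZ [toC z + _]addrC.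
  rewrite -raddfB -fmorphV; set u := f _ - f _; case: u => a b.
  rewrite [LHS](_ : _ = complex.Re ((h^-1)%:C%C * (a +i* b)%C))//.
  by rewrite /= mul0r subr0.
by apply: DeriveDef; [apply/cvg_ex; eexists; exact: cR|exact: cvg_lim cR].
Unshelve. all: by end_near.
Qed.

End complex_to_real.

(** * The Dunkl kernel along real lines *)

Section real_kernel.
Variables (R : realType) (n : nat).
Local Notation V := 'rV[R]_n.
Local Notation C := R[i].
Variables (Rt Rp : {fset V}) (k : V -> R) (E : 'rV[C]_n -> 'rV[C]_n -> C).
Hypotheses (HRt : root_system Rt) (HRp : positive_subsystem Rt Rp).
Hypotheses (Hk : multiplicity Rt k) (HE : dunkl_kernel Rp k E).
Implicit Types (x y z xi a : V) (s t : R) (g : 'M[R]_n).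
Local Notation e := (real_kernel E).
Local Notation W := (weylW Rt).

Lemma dot_toC x y : dot (toC x) (toC y) = (dot x y)%:C%C.
Proof.
by rewrite /dot rmorph_sum; apply: eq_bigr => i _; rewrite !mxE rmorphM.
Qed.

Lemma toC_reflection a z : reflection (toC a) (toC z) = toC (z *m refl_mx a).
Proof.
rewrite mul_refl_mx /reflection !dot_toC /toC map_mxB map_mxZ; congr (_ - _ *: _).
by rewrite fmorph_div rmorphM rmorph_nat.
Qed.

Lemma mult_ge0 a : a \in Rt -> 0 <= k a.
Proof. by move=> /Hk[]. Qed.

Lemma multN a : a \in Rt -> k (- a) = k a.
Proof.
move=> aR; rewrite -(weylW_mult HRt Hk (weylW_refl HRt aR) aR).
by rewrite mulmx_refl_self// (root_neq0 HRt aR).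
Qed.

Lemma real_kernel0 y : e 0 y = 1.
Proof.
have [[_ f0 _] _] := HE (toC y).
by rewrite /real_kernel (_ : toC 0 = 0) ?f0//; apply/rowP => i; rewrite !mxE.
Qed.

Lemma continuous_real_kernel y : continuous (e^~ y : V -> R).
Proof.
have [[hf _ _] _] := HE (toC y) => x.
have c1 := @continuous_toC R n x.
have c2 := differentiable_continuous (hf (toC x)).
exact: (cvg_comp _ _ (cvg_comp _ _ c1 c2) (@continuous_Re R _)).
Qed.

Lemma Re_realM (c : R) (u : C) : complex.Re (c%:C%C * u) = c * complex.Re u.
Proof. by case: u => a b /=; rewrite mul0r subr0. Qed.

Lemma positive_sub_root a : a \in Rp -> a \in Rt.
Proof. by case: HRp => b _ ->; case/andP. Qed.

(** The real part of the eigenvalue equation. The difference quotient in [a] is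
    described by its product with [dot a z], which also covers the points of the
    reflecting hyperplane, where the quotient is a derivative. *)
Lemma real_kernel_line z xi y : exists2 q : V -> R,
  (forall a, a \in Rp -> dot a z * q a = e z y - e (z *m refl_mx a) y) &
  is_derive (0 : R) 1 (fun s : R => e (z + s *: xi) y)
    (dot xi y * e z y - \sum_(a <- Rp) k a * dot a xi * q a).
Proof.
have [[hf _ heq] _] := HE (toC y).
exists (fun a => complex.Re (difference_quotient a (E^~ (toC y)) (toC z))).
  move=> a aR; rewrite /difference_quotient dot_toC fmorph_eq0.
  have [az0|az0] := eqVneq (dot a z) 0.
    by rewrite refl_mxE az0 mul0r mulr0 mul0r scale0r subr0 subrr.
  rewrite toC_reflection -fmorphV mulrC mulrC -Re_realM mulrCA -rmorphM divff//.
  by rewrite mulr1 raddfB.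
suff <- : complex.Re (directional (toC xi) (E^~ (toC y)) (toC z)) =
    dot xi y * e z y - \sum_(a <- Rp) k a * dot a xi *
      complex.Re (difference_quotient a (E^~ (toC y)) (toC z)).
  exact: is_derive_Re_toC (hf (toC z)).
have := heq (toC xi) (toC z).
rewrite /dunkl_operator dot_toC => /(congr1 (@complex.Re R)).
rewrite raddfD Re_realM => <-; rewrite raddf_sum /= -[LHS]addr0 -addrA.
congr (_ + _); apply/esym/eqP; rewrite subr_eq0; apply/eqP/eq_bigr => a _.
by rewrite dot_toC -rmorphM Re_realM.
Qed.

Lemma sum_positive_half (F : V -> R) : (forall a, a \in Rt -> F (- a) = F a) ->
  \sum_(a <- Rp) F a = \sum_(a <- Rt) F a / 2.
Proof.
move=> FN; rewrite -mulr_suml (big_positive_half _ HRt HRp FN)/=.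
by field.
Qed.

(** Along a ray, the direction is proportional to the point and the difference
    quotients turn into differences, also on the reflection hyperplanes. *)
Lemma real_kernel_radial x y s : s != 0 ->
  is_derive s 1 (fun s => e (s *: x) y)
    (dot x y * e (s *: x) y - s^-1 * \sum_(a <- Rt)
       k a / 2 * (e (s *: x) y - e (s *: (x *m refl_mx a)) y)).
Proof.
move=> s0; apply: is_derive_translate.
have [q qE hq] := real_kernel_line (s *: x) x y.
rewrite (_ : (fun h : R => e ((s + h) *: x) y) = fun h => e (s *: x + h *: x) y).
  apply: (is_derive_eq hq); congr (_ - _).
  rewrite mulr_sumr [RHS](_ : _ = \sum_(a <- Rt)
      s^-1 * (k a * (e (s *: x) y - e (s *: (x *m refl_mx a)) y)) / 2).
    rewrite -sum_positive_half; last first.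
      by move=> a aR; rewrite multN// refl_mxN.
    apply: eq_big_seq => a aR.
    have := qE a aR; rewrite dotZr -scalemxAl => <-.
    by field.
  by apply: eq_bigr => a _; field.
by apply/funext => h; rewrite scalerDl.
Qed.

(** Off the reflecting hyperplanes the difference quotients are true quotients,
    so that the equation is explicit in every direction. *)
Lemma real_kernel_segment z xi y t :
  (forall a, a \in Rt -> dot a (z + t *: xi) != 0) ->
  is_derive t 1 (fun s => e (z + s *: xi) y)
    (dot xi y * e (z + t *: xi) y - \sum_(a <- Rt)
       k a / 2 * (dot a xi / dot a (z + t *: xi)) *
       (e (z + t *: xi) y - e ((z + t *: xi) *m refl_mx a) y)).
Proof.
move=> reg; apply: is_derive_translate.
have [q qE hq] := real_kernel_line (z + t *: xi) xi y.
rewrite (_ : (fun h : R => e (z + (t + h) *: xi) y) =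
             fun h => e (z + t *: xi + h *: xi) y).
  apply: (is_derive_eq hq); congr (_ - _).
  rewrite [RHS](_ : _ = \sum_(a <- Rt) (k a * (dot a xi / dot a (z + t *: xi)) *
       (e (z + t *: xi) y - e ((z + t *: xi) *m refl_mx a) y)) / 2).
    rewrite -sum_positive_half; last first.
      by move=> a aR; rewrite multN// refl_mxN !dotNl invrN mulrNN.
    apply: eq_big_seq => a aR; rewrite -qE//; field.
    exact/reg/positive_sub_root.
  by apply: eq_bigr => a _; ring.
by apply/funext => h; rewrite scalerDl addrA.
Qed.

End real_kernel.

(** * Uniqueness for the radial system *)

Section radial_system.
Variables (R : realType) (n : nat).
Local Notation V := 'rV[R]_n.
Variables (Rt : {fset V}) (k : V -> R).
Hypotheses (HRt : root_system Rt) (Hk : multiplicity Rt k).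
Implicit Types (x y a : V) (g h : 'M[R]_n).
Local Notation W := (weylW Rt).

Lemma sum_weylW_mulr (T : 'M[R]_n -> R) h : h \in W ->
  \sum_(g <- W) T (g *m h) = \sum_(g <- W) T g.
Proof.
move=> hW; apply: big_fset_map => [g1 g2 _ _|g gW].
  by move=> /(congr1 (mulmx^~ h^T)); rewrite -!mulmxA (weylW_orth HRt hW) !mulmx1.
exact: weylWM.
Qed.

Lemma sum_root_mulr (T : V -> R) g : g \in W ->
  \sum_(a <- Rt) T (a *m g) = \sum_(a <- Rt) T a.
Proof.
move=> gW; apply: big_fset_map => [a b _ _|a aR].
  by move=> /(congr1 (mulmx^~ g^T)); rewrite -!mulmxA (weylW_orth HRt gW) !mulmx1.
exact: weylW_root.
Qed.

Lemma sum_weylW_refl_sub (T : 'M[R]_n -> R) a : a \in Rt ->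
  \sum_(g <- W) (T g - T (g *m refl_mx a)) = 0.
Proof.
by move=> aR; rewrite sumrB sum_weylW_mulr ?subrr// weylW_refl.
Qed.

(** Pairing [g] with [g *m refl_mx a] turns the sum into half of the sum of the
    squares of the differences. *)
Lemma refl_energy_ge0 (T : 'M[R]_n -> R) a : a \in Rt ->
  0 <= \sum_(g <- W) (T g - T (g *m refl_mx a)) * T g.
Proof.
move=> aR; rewrite -(pmulr_lge0 _ (ltr0Sn R 1)) mulr_suml.
rewrite [leRHS](_ : _ = \sum_(g <- W) (T g - T (g *m refl_mx a)) ^+ 2).
  by apply: sumr_ge0 => g _; exact: sqr_ge0.
apply/eqP; rewrite -subr_eq0 -sumrB.
rewrite -[X in _ == X](sum_weylW_refl_sub (fun g => T g ^+ 2) aR).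
by apply/eqP/eq_bigr => g _; ring.
Qed.

(** The energy [sum_g F_g^2], damped by an exponential, does not increase: the
    singular part of the system is dissipative because [k >= 0]. *)
Lemma radial_system_zero (d : 'M[R]_n -> R) (F : 'M[R]_n -> R -> R) :
  (forall g, g \in W -> {for 0, continuous (F g)}) ->
  (forall g, g \in W -> F g 0 = 0) ->
  (forall g (s : R), g \in W -> 0 < s -> is_derive s 1 (F g)
     (d g * F g s - s^-1 * \sum_(a <- Rt)
       k a / 2 * (F g s - F (g *m refl_mx a) s))) ->
  forall g (s : R), g \in W -> 0 <= s -> F g s = 0.
Proof.
move=> Fc F0 dF g s gW s0.
pose c := \sum_(g <- W) `|d g|.
have dc h : h \in W -> d h <= c.
  move=> hW; rewrite /c (big_rem h)//= (le_trans (ler_norm _))// lerDl.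
  exact: sumr_ge0.
pose dFe h s := d h * F h s - s^-1 * \sum_(a <- Rt)
       k a / 2 * (F h s - F (h *m refl_mx a) s).
pose S s := expR (- (2 * c) * s) * \sum_(g <- W) F g s * F g s.
have Fcont h u : h \in W -> 0 <= u -> {for u, continuous (F h)}.
  move=> hW; rewrite le_eqVlt => /predU1P[<-|u0]; first exact: Fc.
  by have := dF h u hW u0; exact: is_derive_continuous.
have Ss : S s <= S 0.
  apply: (@is_derive_nincr _ S (fun s => expR (- (2 * c) * s) * (- (2 * c)) *
    (\sum_(g <- W) F g s * F g s) + expR (- (2 * c) * s) *
    \sum_(g <- W) (dFe g s * F g s + F g s * dFe g s))) => // u.
  - move=> /andP[u0 _]; apply: is_derive_mul.
      by apply: is_derive_exp; exact: is_derive_linear.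
    apply: is_derive_bigsum => h hW.
    by apply: is_derive_mul; exact: dF.
  - move=> /andP[u0 _]; rewrite -mulrA -mulrDr pmulr_rle0 ?expR_gt0//.
    have -> : \sum_(g <- W) (dFe g u * F g u + F g u * dFe g u) =
        2 * \sum_(g <- W) d g * (F g u * F g u) -
        2 * (u^-1 * \sum_(a <- Rt) k a / 2 * \sum_(g <- W)
          (F g u - F (g *m refl_mx a) u) * F g u).
      rewrite [X in _ - 2 * (_ * X)](_ : _ = \sum_(g <- W) (\sum_(a <- Rt)
          k a / 2 * (F g u - F (g *m refl_mx a) u)) * F g u).
        rewrite !mulr_sumr -sumrB; apply: eq_bigr => h _.
        by rewrite /dFe; ring.
      under [RHS]eq_bigr do rewrite mulr_suml.
      rewrite exchange_big/=; apply: eq_bigr => a _; rewrite mulr_sumr.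
      by apply: eq_bigr => h _; rewrite mulrA.
    have h1 : \sum_(g <- W) d g * (F g u * F g u) <=
              c * \sum_(g <- W) F g u * F g u.
      rewrite mulr_sumr big_seq [leRHS]big_seq; apply: ler_sum => h hW.
      by rewrite ler_wpM2r ?dc// -expr2 sqr_ge0.
    have h2 : 0 <= u^-1 * \sum_(a <- Rt) k a / 2 * \sum_(g <- W)
          (F g u - F (g *m refl_mx a) u) * F g u.
      rewrite mulr_ge0 ?invr_ge0 ?(ltW u0)// big_seq sumr_ge0// => a aR.
      by rewrite mulr_ge0 ?divr_ge0 ?refl_energy_ge0//; case: (Hk aR).
    by lra.
  - move=> /andP[u0 _]; apply: cvgM.
      apply: (@continuous_comp _ _ _ (fun s => - (2 * c) * s) expR).
        exact: mulrl_continuous.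
      exact: continuous_expR.
    apply: continuous_bigsum => h hW.
    by apply: cvgM; exact: Fcont.
have : \sum_(g <- W) F g s * F g s <= 0.
  rewrite -(pmulr_rle0 _ (expR_gt0 (- (2 * c) * s))) (le_trans Ss)//.
  by rewrite /S big_seq big1 ?mulr0// => h hW; rewrite F0// mulr0.
have Fpos h : 0 <= F h s * F h s by rewrite -expr2 sqr_ge0.
rewrite (big_rem g)//= => Fle.
apply/eqP; rewrite -sqrf_eq0 expr2 eq_le Fpos andbT.
by apply: le_trans Fle; rewrite lerDl sumr_ge0.
Qed.

End radial_system.

(** * Symmetry, homogeneity and positivity of the kernel *)

Section kernel_identities.
Variables (R : realType) (n : nat).
Local Notation V := 'rV[R]_n.
Local Notation C := R[i].
Variables (Rt Rp : {fset V}) (k : V -> R) (E : 'rV[C]_n -> 'rV[C]_n -> C).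
Hypotheses (HRt : root_system Rt) (HRp : positive_subsystem Rt Rp).
Hypotheses (Hk : multiplicity Rt k) (HE : dunkl_kernel Rp k E).
Implicit Types (x y z a : V) (s : R) (g : 'M[R]_n).
Local Notation e := (real_kernel E).
Local Notation W := (weylW Rt).

Lemma continuous_real_kernel_ray x y : continuous (fun s => e (s *: x) y).
Proof.
move=> s; apply: (@continuous_comp _ _ _ (fun s => s *: x) (e^~ y)).
  exact: scalel_continuous.
exact: (continuous_real_kernel HE).
Qed.

(** As functions of [s], the families [e (s x g) y] and [e (s y g^T) x] indexed by
    the Weyl group solve the same radial system: transposition exchanges left and
    right multiplication by reflections, which is undone by permuting the roots. *)
Lemma real_kernel_sym x y : e x y = e y x.
Proof.
pose F (g : 'M[R]_n) (s : R) :=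
  e (s *: (x *m g)) y - e (s *: (y *m g^T)) x.
suff : F 1%:M 1 = 0.
  by rewrite /F !scale1r trmx1 !mulmx1 => /eqP; rewrite subr_eq0 => /eqP.
apply: (@radial_system_zero R n Rt k HRt Hk (fun g => dot (x *m g) y) F
  _ _ _ 1%:M 1 (weylW1 HRt) ler01).
- move=> g _; rewrite /F; apply: continuousB; exact: continuous_real_kernel_ray.
- by move=> g _; rewrite /F !scale0r !(real_kernel0 HE) subrr.
move=> g s gW s0; have sn0 : s != 0 by rewrite gt_eqF.
apply: is_derive_eq.
  apply: is_derive_sub; exact: (real_kernel_radial HRt HRp Hk HE).
rewrite /F (_ : \sum_(a <- Rt) k a / 2 *
    (e (s *: (y *m g^T)) x - e (s *: (y *m g^T *m refl_mx a)) x) =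
  \sum_(a <- Rt) k a / 2 *
    (e (s *: (y *m g^T)) x - e (s *: (y *m (g *m refl_mx a)^T)) x)).
  rewrite [dot (y *m _) x]dotC -dot_mulmx opprD opprK addrACA -mulrBr.
  congr (_ + _); rewrite addrC -mulrBr -mulrN; congr (_ * _).
  rewrite -sumrB -sumrN; apply: eq_bigr => a _.
  by rewrite mulmxA; ring.
rewrite -[RHS](sum_root_mulr HRt _ gW); apply: eq_big_seq => a aR.
rewrite (weylW_mult HRt Hk gW aR) refl_mx_conj ?(weylW_orth HRt gW)//.
rewrite !trmx_mul trmxK tr_refl_mx !mulmxA.
by rewrite -(mulmxA _ g g^T) (weylW_orth HRt gW) mulmx1.
Qed.

(** Scaling either argument multiplies the diagonal coefficients of the radial
    system by [c] and leaves its singular part unchanged. *)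
Lemma real_kernelZ c x y : e (c *: x) y = e x (c *: y).
Proof.
pose F (g : 'M[R]_n) (s : R) :=
  e (s *: (c *: (x *m g))) y - e (s *: (x *m g)) (c *: y).
suff : F 1%:M 1 = 0.
  by rewrite /F !scale1r !mulmx1 => /eqP; rewrite subr_eq0 => /eqP.
apply: (@radial_system_zero R n Rt k HRt Hk (fun g => c * dot (x *m g) y) F
  _ _ _ 1%:M 1 (weylW1 HRt) ler01).
- move=> g _; rewrite /F; apply: continuousB; exact: continuous_real_kernel_ray.
- by move=> g _; rewrite /F !scale0r !(real_kernel0 HE) subrr.
move=> g s gW s0; have sn0 : s != 0 by rewrite gt_eqF.
apply: is_derive_eq.
  apply: is_derive_sub; exact: (real_kernel_radial HRt HRp Hk HE).
rewrite /F dotZl dotZr opprD opprK addrACA -mulrBr; congr (_ + _).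
rewrite addrC -mulrBr -mulrN; congr (_ * _).
rewrite -sumrB -sumrN; apply: eq_bigr => a _.
by rewrite -scalemxAl mulmxA; ring.
Qed.

(** A kernel without zeros keeps along each ray the sign that it has at the
    origin. *)
Lemma real_kernel_gt0 : (forall x y, e x y != 0) -> forall x y, 0 < e x y.
Proof.
move=> en0 x y; rewrite ltNge; apply/negP => ele.
have cont : {within `[0, 1], continuous (fun s : R => e (s *: x) y)}.
  by apply: continuous_subspaceT => s; exact: continuous_real_kernel_ray.
have [|s _ /eqP] := IVT ler01 cont (v := 0).
  by rewrite scale0r scale1r (real_kernel0 HE) ge_min ele orbT le_max ler01.
by rewrite (negbTE (en0 _ _)).
Qed.

End kernel_identities.

(** * Asymptotics of the Dunkl kernel inside a Weyl chamber *)

Section finite_bounds.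
Variables (R : realType) (n : nat).
Local Notation V := 'rV[R]_n.

Lemma seq_pos_lb (T : eqType) (s : seq T) (F : T -> R) :
  (forall x, x \in s -> 0 < F x) ->
  exists2 c, 0 < c & forall x, x \in s -> c <= F x.
Proof.
elim: s => [|x s IH] h; first by exists 1.
have [|c c0 cs] := IH; first by move=> y ys; apply: h; rewrite inE ys orbT.
exists (Num.min c (F x)); first by rewrite lt_min c0 h// mem_head.
by move=> y; rewrite inE ge_min => /orP[/eqP ->|/cs ->//]; rewrite lexx orbT.
Qed.

Lemma dot_small (u : V) (eps : R) : 0 < eps ->
  exists2 r, 0 < r & forall v : V, dot v v <= r -> `|dot v u| <= eps.
Proof.
move=> e0; pose c := (dot u u + 1) / eps.
have c0 : 0 < c by rewrite divr_gt0// ltr_wpDl ?dot_ge0.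
exists (eps / c); first by rewrite divr_gt0.
move=> v vr; have := dot_young v u c0.
have h1 : c * dot v v <= eps by rewrite mulrC -ler_pdivlMr.
have h2 : c^-1 * dot u u <= eps.
  rewrite mulrC ler_pdivrMr// /c mulrCA divff ?gt_eqF// mulr1.
  by rewrite lerDl ler01.
by lra.
Qed.

Lemma dot_small_seq (s : seq V) (eps : R) : 0 < eps ->
  exists2 r, 0 < r & forall v : V, dot v v <= r ->
    forall u, u \in s -> `|dot v u| <= eps.
Proof.
move=> e0; elim: s => [|u s [r1 r10 h1]]; first by exists 1.
have [r2 r20 h2] := dot_small u e0.
exists (Num.min r1 r2) => [|v]; first by rewrite lt_min r10.
rewrite le_min => /andP[/h1 {}h1 /h2 {}h2] w.
by rewrite inE => /orP[/eqP ->|/h1].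
Qed.

Lemma dot_bound (u v : V) (r : R) : dot v v <= r -> `|dot u v| <= dot u u + r.
Proof.
move=> vr; have := dot_young u v ltr01; rewrite invr1 !mul1r.
by have := dot_ge0 u; have := dot_ge0 v; lra.
Qed.

Lemma continuous_dot_sub (c : V) : continuous (fun v : V => dot (v - c) (v - c)).
Proof.
rewrite /dot; apply: continuous_big => [|i _ v]; first exact: add_continuous.
have h1 := @coord_continuous R 1 n 0 i v.
have h2 : {for v, continuous (fun x : V => (x - c) 0 i)}.
  rewrite (_ : (fun x : V => _) = fun x : V => x 0 i + (- c) 0 i).
    have h3 := continuousD h1 (@cst_continuous V R ((- c) 0 i) v).
    exact: h3.
  by apply/funext => x; rewrite mxE.
exact: (continuousM h2 h2).
Qed.

Lemma continuous_dotr (u : V) : continuous (fun v : V => dot u v).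
Proof.
rewrite /dot; apply: continuous_big => [|i _ v]; first exact: add_continuous.
have h := continuousM (@cst_continuous V R (u 0 i) v) (@coord_continuous R 1 n 0 i v).
exact: h.
Qed.

Lemma compact_ball_dot (c : V) (r : R) : compact [set v : V | dot (v - c) (v - c) <= r].
Proof.
apply: bounded_closed_compact.
  exists (`|c| + (1 + `|r|)); split; first exact: num_real.
  move=> M hM v /= vr; apply: le_trans (ltW hM).
  rewrite -{1}(subrK c v) (le_trans (ler_normD _ _))// addrC lerD2l.
  have u0 : 0 <= 1 + `|r| by rewrite addr_ge0.
  rewrite /Num.Def.normr/= mx_normrE (bigmax_le _ u0)//= => -[i j] _ /=.
  rewrite ord1; have h : ((v - c) 0 j) ^+ 2 <= r.
    apply: le_trans vr; rewrite /dot (bigD1 j)//= expr2 lerDl.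
    by apply: sumr_ge0 => l _; rewrite -expr2 sqr_ge0.
  rewrite -(ler_pXn2r (n := 2))// ?nnegrE// real_normK ?num_real//.
  by have := ler_norm r; have := normr_ge0 r; nra.
rewrite (_ : mkset _ = (fun v : V => dot (v - c) (v - c)) @^-1` [set x | x <= r])//.
by apply: closed_comp => [v _|]; [exact: continuous_dot_sub|exact: closed_le].
Qed.

End finite_bounds.

Section kernel_asymptotics.
Variables (R : realType) (n : nat).
Local Notation V := 'rV[R]_n.
Local Notation C := R[i].
Variables (Rt Rp : {fset V}) (k : V -> R) (E : 'rV[C]_n -> 'rV[C]_n -> C).
Hypotheses (HRt : root_system Rt) (HRp : positive_subsystem Rt Rp).
Hypotheses (Hk : multiplicity Rt k) (HE : dunkl_kernel Rp k E).
Hypothesis Epos : forall x y : V, 0 < real_kernel E x y.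
Implicit Types (x y z a eta mu : V) (s t b : R) (g : 'M[R]_n).
Local Notation e := (real_kernel E).
Local Notation W := (weylW Rt).

Definition half_gamma : R := \sum_(a <- Rt) k a / 2.
Local Notation gam := half_gamma.

Lemma half_gamma_ge0 : 0 <= gam.
Proof.
rewrite /half_gamma big_seq sumr_ge0// => a aR.
by rewrite divr_ge0// (mult_ge0 Hk aR).
Qed.

Lemma refl_mx_neq1 a : a \in Rt -> refl_mx a != 1%:M.
Proof.
move=> aR; apply/eqP => h; have := mulmx_refl_self (root_neq0 HRt aR).
rewrite h mulmx1 => /(congr1 (dot a)); rewrite dotNr.
by have := dot_gt0 (root_neq0 HRt aR); lra.
Qed.

(** The sum of the kernel over the orbit grows at most with the largest exponent,
    since the difference part of the radial system sums to zero. *)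
Lemma real_kernel_le y mu m : (forall g, g \in W -> dot (y *m g) mu <= m) ->
  e y mu <= (\sum_(g <- W) 1) * expR m.
Proof.
move=> hm.
pose F (g : 'M[R]_n) (s : R) := e (s *: (y *m g)) mu.
pose dF g s := dot (y *m g) mu * F g s -
  s^-1 * \sum_(a <- Rt) k a / 2 * (F g s - e (s *: (y *m g *m refl_mx a)) mu).
pose u s := expR (- m * s) * \sum_(g <- W) F g s.
have u1 : u 1 <= u 0.
  apply: (@is_derive_nincr _ u (fun s => expR (- m * s) * - m *
    (\sum_(g <- W) F g s) + expR (- m * s) * \sum_(g <- W) dF g s)) => // s.
  - move=> /andP[s0 _]; apply: is_derive_mul.
      by apply: is_derive_exp; exact: is_derive_linear.
    apply: is_derive_bigsum => g gW.
    by apply: (real_kernel_radial HRt HRp Hk HE); rewrite gt_eqF.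
  - move=> /andP[s0 _]; rewrite -mulrA -mulrDr pmulr_rle0 ?expR_gt0// mulNr addrC.
    rewrite subr_le0 /dF sumrB -mulr_sumr exchange_big/=.
    rewrite [X in _ - _ * X]big_seq [X in _ - _ * X]big1 => [|a aR]; last first.
      rewrite -mulr_sumr.
      under eq_bigr do rewrite -mulmxA.
      by rewrite (sum_weylW_refl_sub HRt (fun g => F g s) aR) mulr0.
    rewrite mulr0 subr0 mulr_sumr big_seq [leRHS]big_seq.
    by apply: ler_sum => g gW; rewrite ler_wpM2r ?hm// ltW ?Epos.
  - move=> _; apply: cvgM.
      apply: (@continuous_comp _ _ _ (fun s => - m * s) expR).
        exact: mulrl_continuous.
      exact: continuous_expR.
    by apply: continuous_bigsum => g _; exact: continuous_real_kernel_ray.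
have : u 1 <= \sum_(g <- W) 1.
  apply: le_trans u1 _; rewrite /u mulr0 expR0 mul1r.
  by apply: ler_sum => g _; rewrite /F scale0r (real_kernel0 HE).
rewrite /u mulr1 expRN mulrC ler_pdivrMr ?expR_gt0//; apply: le_trans.
rewrite (big_rem _ (weylW1 HRt))/= /F scale1r mulmx1 lerDl.
by apply: sumr_ge0 => g _; exact: ltW.
Qed.

Section ray.
Variables (eta mu : V).
Local Notation m := (dot eta mu).
Local Notation f := (fun s : R => e (s *: eta) mu).
Local Notation df := (fun s : R => m * e (s *: eta) mu - s^-1 *
  \sum_(a <- Rt) k a / 2 * (e (s *: eta) mu - e (s *: (eta *m refl_mx a)) mu)).

Lemma ray_derivative_ge s : 0 < s -> (m - s^-1 * gam) * f s <= df s.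
Proof.
move=> s0; rewrite mulrBl lerD2l lerN2 -mulrA ler_wpM2l ?invr_ge0 ?(ltW s0)//.
rewrite /half_gamma mulr_suml big_seq [leRHS]big_seq; apply: ler_sum => a aR.
rewrite ler_wpM2l ?divr_ge0 ?(mult_ge0 Hk)//.
by rewrite gerBl ltW.
Qed.

(** Along a ray the kernel grows at least like [s^-gam * exp (s <eta, mu>)]. *)
Lemma ray_growth s1 s : 0 < s1 -> s1 <= s ->
  ln (f s1) - m * s1 + gam * ln s1 <= ln (f s) - m * s + gam * ln s.
Proof.
move=> s10 s1s.
apply: (@is_derive_ndecr _ (fun s => ln (f s) - m * s + gam * ln s)
  (fun s => df s / f s - m + gam * (1 / s))) => // u /andP[u1 u2].
- have u0 : 0 < u by exact: lt_trans s10 u1.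
  apply: is_derive_add.
    apply: is_derive_sub; last exact: is_derive_linear.
    apply: is_derive_logarithm; first exact: Epos.
    by apply: (real_kernel_radial HRt HRp Hk HE); rewrite gt_eqF.
  apply: is_derive_cmul; apply: is_derive_logarithm => //; exact: is_derive_id.
- have u0 : 0 < u by exact: lt_trans s10 u1.
  have := ray_derivative_ge u0; rewrite -ler_pdivlMr ?Epos// (mulrC gam).
  by lra.
- have u0 : 0 < u by exact: lt_le_trans s10 u1.
  apply: (@is_derive_continuous _ _ _ (df u / f u - m + gam * (1 / u))).
  apply: is_derive_add.
    apply: is_derive_sub; last exact: is_derive_linear.
    apply: is_derive_logarithm; first exact: Epos.
    by apply: (real_kernel_radial HRt HRp Hk HE); rewrite gt_eqF.
  apply: is_derive_cmul; apply: is_derive_logarithm => //; exact: is_derive_id.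
Qed.

Local Notation G := (fun s : R => \sum_(g <- W | g != 1%:M) e (s *: (eta *m g)) mu).

(** The other orbit points have a smaller exponent; being fed by [f] only
    through coefficients of order [1/s], they stay of order [f/s]. *)
Lemma ray_dominant b K s1 : 0 < b -> 0 < s1 ->
  (forall g, g \in W -> g != 1%:M -> dot (eta *m g) mu <= m - b) ->
  2 * gam <= K * b -> 2 * (1 + gam) <= b * s1 -> 0 <= K ->
  G s1 <= K * (s1^-1 * f s1) ->
  forall s, s1 <= s -> G s <= K * (s^-1 * f s).
Proof.
move=> b0 s10 hb hK hs1 K0 hG s s1s.
pose F (g : 'M[R]_n) (s : R) := e (s *: (eta *m g)) mu.
pose dF g s := dot (eta *m g) mu * F g s -
  s^-1 * \sum_(a <- Rt) k a / 2 * (F g s - e (s *: (eta *m g *m refl_mx a)) mu).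
pose W' := [seq g <- W | g != 1%:M].
have GE u : G u = \sum_(g <- W') F g u by rewrite big_filter.
pose u s := expR (- (m - b) * s) * (\sum_(g <- W') F g s - K * (s^-1 * f s)).
pose du v := expR (- (m - b) * v) * - (m - b) *
    (\sum_(g <- W') F g v - K * (v^-1 * f v)) + expR (- (m - b) * v) *
    (\sum_(g <- W') dF g v - K * (- v ^- 2 * f v + v^-1 * df v)).
have uD (v : R) : 0 < v -> is_derive v 1 u (du v).
  move=> v0; have vn0 : v != 0 by rewrite gt_eqF.
  apply: is_derive_mul.
    by apply: is_derive_exp; exact: is_derive_linear.
  apply: is_derive_sub.
    by apply: is_derive_bigsum => g _; exact: (real_kernel_radial HRt HRp Hk HE).
  apply: is_derive_cmul; apply: is_derive_mul; first exact: is_derive_inv.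
  exact: (real_kernel_radial HRt HRp Hk HE).
suff : u s <= u s1.
  move=> us; have : u s1 <= 0.
    by rewrite /u pmulr_rle0 ?expR_gt0// subr_le0 -GE.
  by move=> /(le_trans us); rewrite /u pmulr_rle0 ?expR_gt0// subr_le0 -GE.
apply: (@is_derive_nincr _ u du) => //.
- by move=> v /andP[/(lt_trans s10) v0 _]; exact: uD.
- move=> v /andP[s1v _]; have v0 := lt_trans s10 s1v.
  rewrite /du -mulrA -mulrDr pmulr_rle0 ?expR_gt0//.
  pose S g := \sum_(a <- Rt) k a / 2 *
     (F g v - e (v *: (eta *m g *m refl_mx a)) mu).
  have S0 : \sum_(g <- W) S g = 0.
    rewrite /S exchange_big/= big_seq big1// => a aR; rewrite -mulr_sumr.
    under eq_bigr do rewrite -mulmxA.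
    by rewrite (sum_weylW_refl_sub HRt (fun g => F g v) aR) mulr0.
  have S1 : - \sum_(g <- W') S g <= gam * f v.
    move: S0; rewrite (bigD1_seq _ (weylW1 HRt) (fset_uniq _))/= => /eqP.
    rewrite addr_eq0 big_filter => /eqP <-.
    rewrite /S /half_gamma mulr_suml big_seq [leRHS]big_seq; apply: ler_sum => a aR.
    rewrite /F mulmx1 ler_wpM2l ?divr_ge0 ?(mult_ge0 Hk)//.
    by rewrite gerBl ltW.
  have hdF : \sum_(g <- W') dF g v <=
             (m - b) * \sum_(g <- W') F g v + v^-1 * (gam * f v).
    rewrite /dF sumrB; apply: lerD.
      rewrite mulr_sumr big_seq [leRHS]big_seq; apply: ler_sum => g.
      by rewrite mem_filter => /andP[g1 gW]; rewrite ler_wpM2r ?hb// ltW ?Epos.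
    by rewrite -mulr_sumr -mulrN ler_wpM2l ?invr_ge0 ?(ltW v0).
  have i0 : 0 <= v^-1 by rewrite invr_ge0 ltW.
  have hdf := ler_wpM2l K0 (ler_wpM2l i0 (ray_derivative_ge v0)).
  have h4 : v^-1 * (1 + gam) <= b / 2.
    rewrite mulrC ler_pdivrMr//.
    have := ler_wpM2l (ltW b0) (ltW s1v); lra.
  have h6 : v^-1 * f v * (- (b * K) + gam + K * (v^-1 * (1 + gam))) <= 0.
    rewrite mulr_ge0_le0 ?(mulr_ge0 i0) ?(ltW (Epos _ _))//.
    by have := ler_wpM2l K0 h4; lra.
  have -> : v ^- 2 = v^-1 * v^-1 by rewrite expr2 invfM.
  by lra.
- move=> v /andP[s1v _]; apply: is_derive_continuous; apply: uD.
  exact: lt_le_trans s1v.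
Qed.

End ray.

(** The strict inequalities of [weylW_lt] at [xi] persist on a small ball, and
    compactness of the ball makes the initial bound of [ray_dominant] uniform. *)
Lemma uniform_dominant xi mu : same_chamber Rt xi mu ->
  exists r s1 K c, [/\ 0 < r, 0 < s1, 0 <= K, 0 < c &
    forall eta, dot (eta - xi) (eta - xi) <= r ->
      (forall a, a \in Rt -> c <= `|dot a eta|) /\
      (forall s g, s1 <= s -> g \in W -> g != 1%:M ->
        e (s *: (eta *m g)) mu <= K * (s^-1 * e (s *: eta) mu))].
Proof.
move=> sc; pose W' := [seq g <- W | g != 1%:M].
have [b0 b00 hb0] : exists2 b0, 0 < b0 &
    forall g, g \in W' -> b0 <= dot xi mu - dot (xi *m g) mu.
  apply: seq_pos_lb => g; rewrite mem_filter => /andP[g1 gW].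
  by rewrite subr_gt0 (weylW_lt HRt sc gW g1).
have [c0 c00 hc0] : exists2 c0, 0 < c0 & forall a, a \in Rt -> c0 <= `|dot a xi|.
  by apply: seq_pos_lb => a aR; rewrite normr_gt0 (same_chamber_regl sc).
have [r1 r10 hr1] : exists2 r1, 0 < r1 & forall v : V, dot v v <= r1 ->
    `|dot v mu| <= b0 / 4 by apply: dot_small; rewrite divr_gt0.
have [r2 r20 hr2] : exists2 r2, 0 < r2 & forall v : V, dot v v <= r2 ->
    forall a, a \in Rt -> `|dot v a| <= c0 / 2.
  by apply: dot_small_seq; rewrite divr_gt0.
pose r := Num.min r1 r2; have r0 : 0 < r by rewrite lt_min r10.
pose b := b0 / 2; have b_gt0 : 0 < b by rewrite divr_gt0.
pose s1 := 2 * (1 + gam) / b.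
have g0 := half_gamma_ge0.
have s10 : 0 < s1 by rewrite divr_gt0 ?mulr_gt0 ?ltr_pwDl.
pose A := [set v : V | dot (v - xi) (v - xi) <= r].
have hA1 eta g : A eta -> g \in W -> g != 1%:M ->
    dot (eta *m g) mu <= dot eta mu - b.
  rewrite /A/= le_min => /andP[q1 _] gW g1.
  have := hr1 _ q1; have := hr1 ((eta - xi) *m g).
  rewrite (weylW_dot HRt _ _ gW) => /(_ q1).
  have /hb0 : g \in W' by rewrite mem_filter g1.
  rewrite mulmxBl !dotBl !ler_norml /b => h1 /andP[_ h2] /andP[h3 _]; lra.
have hA2 eta : A eta -> dot eta mu <= dot xi mu + b0 / 4.
  rewrite /A/= le_min => /andP[q1 _].
  by have := hr1 _ q1; rewrite dotBl ler_norml => /andP[_]; lra.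
have hA3 eta a : A eta -> a \in Rt -> c0 / 2 <= `|dot a eta|.
  rewrite /A/= le_min => /andP[_ q2] aR.
  have h1 := hr2 _ q2 _ aR; have h2 := hc0 _ aR.
  have h3 : `|dot a xi| <= `|dot a eta| + `|dot (eta - xi) a|.
    rewrite -[X in _ + X]normrN -dotNl opprB dotBl (dotC xi) (dotC eta).
    by apply: le_trans (ler_normD _ _); rewrite addrC subrK.
  lra.
have [eta0 etaA hmin] : exists2 eta0, eta0 \in A &
    forall t : V, t \in A -> e (s1 *: eta0) mu <= e (s1 *: t) mu.
  apply: EVT_min_rV.
  - by exists xi; rewrite /A/= subrr dot0l ltW.
  - exact: compact_ball_dot.
  - apply: continuous_subspaceT => v.
    apply: (@continuous_comp _ _ _ (fun v : V => s1 *: v) (e^~ mu)).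
      exact: scaler_continuous.
    exact: (continuous_real_kernel HE).
pose f0 := e (s1 *: eta0) mu; have f00 : 0 < f0 by exact: Epos.
pose M0 := (\sum_(g <- W) 1) * expR (s1 * (dot xi mu + b0 / 4)).
have M00 : 0 <= M0 by rewrite mulr_ge0 ?expR_ge0// sumr_ge0.
pose M1 := \sum_(g <- W | g != 1%:M) M0.
have M10 : 0 <= M1 by exact: sumr_ge0.
pose K := 2 * gam / b + s1 * M1 / f0.
have b_ge0 := ltW b_gt0; have s1_ge0 := ltW s10; have f0_ge0 := ltW f00.
have K1 : 0 <= 2 * gam / b by apply: divr_ge0 => //; exact: mulr_ge0.
have K2 : 0 <= s1 * M1 / f0 by apply: divr_ge0 => //; exact: mulr_ge0.
have K0 : 0 <= K by exact: addr_ge0.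
exists r, s1, K, (c0 / 2); split=> //; first by rewrite divr_gt0.
move=> eta etar; split=> [a aR|s g s1s gW g1]; first exact: hA3.
have hG : \sum_(g <- W | g != 1%:M) e (s1 *: (eta *m g)) mu <=
    K * (s1^-1 * e (s1 *: eta) mu).
  apply: (@le_trans _ _ M1).
    rewrite big_seq_cond [leRHS]big_seq_cond; apply: ler_sum => h /andP[hW h1].
    apply: (real_kernel_le) => g' g'W.
    rewrite -scalemxAl dotZl ler_wpM2l ?(ltW s10)// -mulmxA.
    apply: le_trans (hA2 _ etar).
    have [->|hg1] := eqVneq (h *m g') 1%:M; first by rewrite mulmx1.
    apply: le_trans (hA1 _ _ etar _ hg1) _; first exact: (weylWM HRt).
    by rewrite gerBl ltW.
  rewrite /K mulrDl; apply: ler_wpDl.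
    by apply: mulr_ge0 => //; rewrite mulr_ge0 ?invr_ge0// ltW.
  rewrite [leRHS](_ : _ = M1 * (e (s1 *: eta) mu / f0)); last first.
    by field; rewrite !gt_eqF.
  rewrite ler_peMr// ler_pdivlMr// mul1r; apply: hmin.
  by rewrite inE.
have hK : 2 * gam <= K * b.
  have -> : K * b = 2 * gam + s1 * M1 / f0 * b.
    by rewrite /K; field; rewrite !gt_eqF.
  by rewrite lerDl mulr_ge0.
have hs1 : 2 * (1 + gam) <= b * s1 by rewrite /s1 [b * _]mulrC divfK ?gt_eqF.
have := @ray_dominant eta mu b K s1 b_gt0 s10
  (fun g => hA1 eta g etar) hK hs1 K0 hG s s1s.
apply: le_trans; rewrite -big_filter (big_rem g)/=; last by rewrite mem_filter g1.
by rewrite lerDl sumr_ge0// => h _; rewrite ltW.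
Qed.

(** The logarithm of [dunkl_weight] off the reflecting hyperplanes; squares take
    the place of absolute values because they are differentiable. *)
Definition log_weight eta : R := \sum_(a <- Rt) k a / 2 * ln ((dot a eta) ^+ 2).

(** The kernel behaves like [exp (t <eta, mu>)] divided by the square root of the
    weight; this is the logarithm of the remaining factor. *)
Definition log_kernel_part mu t eta : R :=
  ln (e (t *: eta) mu) - t * dot eta mu + log_weight eta / 2.

(** The exponential and the weight cancel the terms of the differential equation
    that contain the kernel at [t *: eta] itself; the values at the reflected
    points remain. *)
Lemma log_kernel_part_derive mu t xi zeta (u : R) :
  (forall a, a \in Rt -> dot a (xi + u *: zeta) != 0) -> 0 < t ->
  is_derive u 1 (fun u => log_kernel_part mu t (xi + u *: zeta))
    (\sum_(a <- Rt) k a / 2 * (dot a zeta / dot a (xi + u *: zeta)) *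
      (e (t *: ((xi + u *: zeta) *m refl_mx a)) mu / e (t *: (xi + u *: zeta)) mu)).
Proof.
move=> reg t0; set eta := xi + u *: zeta; rewrite -/eta in reg.
have tE (v : R) : t *: (xi + v *: zeta) = t *: xi + v *: (t *: zeta).
  by rewrite scalerDr !scalerA mulrC.
have d1 : is_derive u 1 (fun u => ln (e (t *: (xi + u *: zeta)) mu))
   ((dot (t *: zeta) mu * e (t *: eta) mu - \sum_(a <- Rt)
       k a / 2 * (dot a zeta / dot a eta) *
       (e (t *: eta) mu - e (t *: (eta *m refl_mx a)) mu)) / e (t *: eta) mu).
  apply: is_derive_logarithm; first exact: Epos.
  have reg' a : a \in Rt -> dot a (t *: xi + u *: (t *: zeta)) != 0.
    by move=> aR; rewrite -tE dotZr; apply: mulf_neq0; [rewrite gt_eqF|exact: reg].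
  have := real_kernel_segment HRt HRp Hk HE mu reg'.
  rewrite (_ : (fun u => e (t *: xi + u *: (t *: zeta)) mu) =
               fun u => e (t *: (xi + u *: zeta)) mu); last first.
    by apply/funext => v; rewrite tE.
  rewrite -tE -/eta => h; apply: (is_derive_eq h); congr (_ - _).
  apply: eq_big_seq => a aR; rewrite !dotZr -scalemxAl; congr (_ * _ * _).
  by field; rewrite (reg a aR) gt_eqF.
have dl v : is_derive u 1 (fun u => dot v (xi + u *: zeta)) (dot v zeta).
  rewrite (_ : (fun u => _) = fun u => dot v xi + dot v zeta * u); last first.
    by apply/funext => w; rewrite dotDr dotZr mulrC.
  have := is_derive_add (is_derive_cst (dot v xi) u 1) (is_derive_linear (dot v zeta) u).
  by rewrite add0r.
have d2 : is_derive u 1 (fun u => t * dot (xi + u *: zeta) mu) (t * dot zeta mu).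
  apply: is_derive_cmul; have := dl mu; rewrite (dotC mu zeta).
  by under eq_fun do rewrite dotC.
have d3 : is_derive u 1 (fun u => log_weight (xi + u *: zeta) / 2)
    (\sum_(a <- Rt) k a / 2 * (dot a zeta / dot a eta)).
  under eq_fun do rewrite mulrC.
  rewrite [X in is_derive _ _ _ X](_ : _ = 2^-1 * \sum_(a <- Rt) k a / 2 *
     ((dot a zeta * dot a eta + dot a eta * dot a zeta) / (dot a eta * dot a eta))).
    apply: is_derive_cmul; apply: is_derive_bigsum => a aR; apply: is_derive_cmul.
    under eq_fun do rewrite expr2.
    apply: is_derive_logarithm; last exact: is_derive_mul.
    by rewrite -/eta -expr2 lt0r sqr_ge0 sqrf_eq0 reg.
  rewrite mulr_sumr; apply: eq_big_seq => a aR.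
  by field; exact: reg.
apply: (is_derive_eq (is_derive_add (is_derive_sub d1 d2) d3)).
have en0 : e (t *: eta) mu != 0 by rewrite gt_eqF.
rewrite mulrBl mulfK// dotZl [_ - _ - _]addrAC subrr add0r mulr_suml addrC -sumrB.
by apply: eq_big_seq => a aR; field; rewrite en0 reg.
Qed.

Definition dominated xi mu r s1 K c :=
  forall eta, dot (eta - xi) (eta - xi) <= r ->
    (forall a, a \in Rt -> c <= `|dot a eta|) /\
    (forall s g, s1 <= s -> g \in W -> g != 1%:M ->
      e (s *: (eta *m g)) mu <= K * (s^-1 * e (s *: eta) mu)).

Lemma dominatedW xi mu r s1 K c r' s1' K' c' :
  0 < s1 -> r' <= r -> s1 <= s1' -> K <= K' -> c' <= c ->
  dominated xi mu r s1 K c -> dominated xi mu r' s1' K' c'.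
Proof.
move=> s10 rr ss KK cc h eta /le_trans/(_ rr)/h[h1 h2]; split=> [a aR|s g s1s gW g1].
  exact: le_trans (h1 _ aR).
have s1s' := le_trans ss s1s.
apply: le_trans (h2 _ _ s1s' gW g1) _; rewrite ler_wpM2r// mulr_ge0//.
  by rewrite invr_ge0 ltW// (lt_le_trans s10).
exact: ltW.
Qed.

Definition part_const r K c := \sum_(a <- Rt) k a / 2 * ((dot a a + r) / c) * K.

Lemma part_const_ge0 r K c : 0 < r -> 0 <= K -> 0 < c -> 0 <= part_const r K c.
Proof.
move=> r0 K0 c0; rewrite /part_const big_seq sumr_ge0// => a aR.
rewrite mulr_ge0// mulr_ge0 ?divr_ge0 ?(mult_ge0 Hk)//; last exact: ltW.
by rewrite addr_ge0 ?dot_ge0// ltW.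
Qed.

(** By the mean value theorem: the derivative along the segment from [xi] to [eta]
    only contains values at reflected points, which are of relative order [1/t]. *)
Lemma log_kernel_part_close xi mu r s1 K c t eta :
  0 < r -> 0 < s1 -> 0 <= K -> 0 < c -> dominated xi mu r s1 K c ->
  s1 <= t -> dot (eta - xi) (eta - xi) <= r ->
  `|log_kernel_part mu t eta - log_kernel_part mu t xi| <= part_const r K c / t.
Proof.
move=> r0 s10 K0 c0 dom s1t etar; have t0 := lt_le_trans s10 s1t.
set zeta := eta - xi in etar.
pose phi (u : R) := log_kernel_part mu t (xi + u *: zeta).
pose dphi (u : R) := \sum_(a <- Rt) k a / 2 * (dot a zeta / dot a (xi + u *: zeta)) *
      (e (t *: ((xi + u *: zeta) *m refl_mx a)) mu / e (t *: (xi + u *: zeta)) mu).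
have inball (u : R) : 0 <= u <= 1 ->
    dot (xi + u *: zeta - xi) (xi + u *: zeta - xi) <= r.
  move=> /andP[u0 u1]; rewrite addrAC subrr add0r dotZl dotZr mulrA.
  apply: le_trans etar; rewrite ler_piMl ?dot_ge0//.
  by rewrite -expr2 expr_le1.
have reg (u : R) : 0 <= u <= 1 -> forall a, a \in Rt -> dot a (xi + u *: zeta) != 0.
  move=> u01 a aR; have [h _] := dom _ (inball u u01).
  by rewrite -normr_gt0 (lt_le_trans c0)// h.
have dP (u : R) : 0 <= u <= 1 -> is_derive u 1 phi (dphi u).
  by move=> u01; exact: (log_kernel_part_derive mu (reg u u01) t0).
have [||u u01 hu] := @MVT _ phi dphi 0 1 ltr01.
- by move=> u; rewrite in_itv/= => /andP[u0 u1]; apply: dP; rewrite (ltW u0) (ltW u1).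
- apply: continuous_in_subspaceT => u; rewrite inE/= in_itv/= => u01.
  by apply: is_derive_continuous; exact: dP.
have <- : phi 1 - phi 0 = log_kernel_part mu t eta - log_kernel_part mu t xi.
  have xz : xi + zeta = eta by rewrite /zeta addrC subrK.
  by rewrite /phi scale1r scale0r addr0 xz.
have {}u01 : 0 <= u <= 1.
  by move: u01; rewrite in_itv/= => /andP[u0 u1]; rewrite (ltW u0) (ltW u1).
rewrite hu subr0 mulr1 /dphi /part_const mulr_suml.
apply: le_trans (ler_norm_sum _ _ _) _.
rewrite big_seq [leRHS]big_seq; apply: ler_sum => a aR.
have [hc hK] := dom _ (inball u u01).
have k0 : 0 <= k a / 2 by rewrite divr_ge0 ?(mult_ge0 Hk).
rewrite 2!normrM (ger0_norm k0) -!(mulrA (k a / 2)); apply: ler_wpM2l => //.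
rewrite -[leRHS]mulrA; apply: ler_pM => //.
- rewrite normrM ler_pM ?normr_ge0 ?dot_bound// normfV.
  by rewrite lef_pV2 ?hc// posrE// (lt_le_trans c0)// hc.
- rewrite normrM normfV !gtr0_norm ?Epos// ler_pdivrMr ?Epos// -mulrA.
  apply: hK => //; first exact: (weylW_refl HRt).
  exact: refl_mx_neq1.
Qed.

Local Notation w := (dunkl_weight Rp k).

Lemma dunkl_weight_roots y : w y = \prod_(a <- Rt) `|dot a y| `^ k a.
Proof.
rewrite (big_positive_half _ HRt HRp)/=; last first.
  by move=> a aR; rewrite dotNl normrN (multN HRt Hk aR).
rewrite -big_split/=; apply: eq_bigr => a _.
by rewrite mulrC powRrM powR_mulrn ?powR_ge0// expr2.
Qed.

Lemma dunkl_weight_ge0 y : 0 <= w y.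
Proof. by apply: prodr_ge0 => a _; exact: powR_ge0. Qed.

Lemma dunkl_weight_mulr y g : g \in W -> w (y *m g) = w y.
Proof.
move=> gW; have gTW := weylW_tr HRt gW; rewrite !dunkl_weight_roots.
have <- : \prod_(a <- Rt) `|dot (a *m g^T) y| `^ k (a *m g^T) =
          \prod_(a <- Rt) `|dot a y| `^ k a.
  apply: (big_fset_map _ (f := fun a => a *m g^T) (fun a => `|dot a y| `^ k a)).
    move=> a b _ _ /(congr1 (mulmx^~ g)).
    by rewrite -!mulmxA (weylW_orthV HRt gW) !mulmx1.
  by move=> a aR; exact: (weylW_root HRt gTW).
apply: eq_big_seq => a aR.
by rewrite (weylW_mult HRt Hk gTW aR) dot_mulmx trmxK.
Qed.

Lemma dunkl_weight_log y : (forall a, a \in Rt -> dot a y != 0) ->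
  w y = expR (log_weight y).
Proof.
move=> reg; rewrite dunkl_weight_roots /log_weight expR_sum.
apply: eq_big_seq => a aR; rewrite /powR normr_eq0 (negbTE (reg _ aR)).
congr expR; rewrite -real_normK ?num_real// lnXn ?normr_gt0 ?reg//.
by rewrite mulr2n; field.
Qed.

Lemma log_weightZ t y : 0 < t -> (forall a, a \in Rt -> dot a y != 0) ->
  log_weight (t *: y) = log_weight y + 2 * gam * ln t.
Proof.
move=> t0 reg; rewrite /log_weight /half_gamma mulr_sumr mulr_suml -big_split/=.
apply: eq_big_seq => a aR; rewrite dotZr exprMn.
have t2 : 0 < t ^+ 2 by rewrite exprn_gt0.
have y2 : 0 < dot a y ^+ 2 by rewrite lt0r sqr_ge0 sqrf_eq0 reg.
by rewrite lnM ?posrE// (lnXn _ t0) mulr2n; field.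
Qed.

End kernel_asymptotics.

(** * Gaussian approximation of the transition density *)

Section elementary_bounds.
Variable R : realType.
Implicit Types x z : R.

Lemma expR_sub1_le x : `|x| <= 2^-1 -> `|expR x - 1| <= 2 * `|x|.
Proof.
move=> xs; have h1 := expR_ge1Dx x; have h2 := expR_ge1Dx (- x).
have xl : x <= 2^-1 by apply: le_trans (ler_norm _) xs.
have h3 : expR x * (1 - x) <= 1.
  have := ler_wpM2l (expR_ge0 x) h2.
  by rewrite expRN divff// gt_eqF// expR_gt0.
have h4 : 0 <= (1 - 2 * x) * `|x| by rewrite mulr_ge0//; lra.
rewrite ler_norml; apply/andP; split.
  by have := ler_norm (- x); rewrite normrN; have := normr_ge0 x; lra.
rewrite -(ler_pM2r (_ : 0 < 1 - x)); last by lra.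
have h5 := ler_norm x; have h6 := normr_ge0 x.
have h7 : x <= 2 * `|x| * (1 - x) by lra.
by lra.
Qed.

Lemma expRN_le_inv x : 0 < x -> expR (- x) <= x^-1.
Proof.
move=> x0; rewrite expRN lef_pV2 ?posrE ?expR_gt0//.
by have := expR_ge1Dx x; lra.
Qed.

(** The bound [X <= C (1 + z) ^+ 2] is how scalar products with roots are
    controlled in the Gaussian tail, where [z] is the squared distance to the
    center, divided by [t]. *)
Lemma powR_le_expR (p C eps : R) : 0 <= p -> 0 <= C -> 0 < eps ->
  exists2 M, 0 < M & forall z X, 0 <= z -> 0 <= X -> X <= C * (1 + z) ^+ 2 ->
    X `^ p <= M * expR (eps * z).
Proof.
move=> p0 C0 e0; pose delta := eps / (2 * (p + 1)).
have p1 : 0 < p + 1 by rewrite ltr_wpDl.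
have d0 : 0 < delta by rewrite divr_gt0// mulr_gt0.
pose B := C * (1 + delta^-1) ^+ 2.
have B0 : 0 <= B by rewrite mulr_ge0 ?sqr_ge0.
exists (B `^ p + 1); first by rewrite ltr_wpDl ?powR_ge0.
move=> z X z0 X0 XC.
have h1 : 1 + z <= (1 + delta^-1) * expR (delta * z).
  apply: (@le_trans _ _ ((1 + delta^-1) * (1 + delta * z))).
    rewrite mulrDl mul1r mulrDr mulr1 mulKf ?gt_eqF//.
    have h0 := mulr_ge0 (ltW d0) z0.
    by have hi : 0 <= delta^-1; [rewrite invr_ge0 ltW|lra].
  by rewrite ler_wpM2l ?expR_ge1Dx// addr_ge0// invr_ge0 ltW.
have h2 : X <= B * expR (2 * (delta * z)).
  apply: le_trans XC _; rewrite -mulrA ler_wpM2l//.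
  rewrite mulrDl mul1r expRD -expr2 -exprMn.
  have a0 : 0 <= 1 + z by rewrite addr_ge0.
  by rewrite ler_pXn2r// nnegrE (le_trans a0).
apply: (@le_trans _ _ ((B * expR (2 * (delta * z))) `^ p)).
  by apply: ge0_ler_powR; rewrite ?nnegrE// (le_trans X0).
rewrite powRM ?expR_ge0// -expRM; apply: ler_pM; rewrite ?powR_ge0 ?expR_ge0//.
  by rewrite lerDl.
rewrite ler_expR /delta.
rewrite (_ : 2 * (eps / (2 * (p + 1)) * z) * p = eps * z * (p / (p + 1))); last first.
  by field; rewrite gt_eqF.
rewrite ler_piMr ?mulr_ge0// ?(ltW e0)//.
by rewrite ler_pdivrMr// mul1r lerDl.
Qed.

Lemma prod_powR_le_expR (T : eqType) (s : seq T) (p : T -> R) (C eps : R) :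
  (forall a, a \in s -> 0 <= p a) -> 0 <= C -> 0 < eps ->
  exists2 M, 0 < M & forall z (X : T -> R), 0 <= z ->
    (forall a, a \in s -> 0 <= X a <= C * (1 + z) ^+ 2) ->
    \prod_(a <- s) X a `^ p a <= M * expR (eps * z).
Proof.
move=> + C0; elim: s eps => [|a s IH] eps p0 e0.
  exists 1 => // z X z0 _; rewrite big_nil mul1r.
  by rewrite -expR0 ler_expR mulr_ge0// ltW.
have e2 : 0 < eps / 2 by rewrite divr_gt0.
have [|M1 M10 h1] := IH _ _ e2.
  by move=> b bs; apply: p0; rewrite inE bs orbT.
have [M2 M20 h2] := powR_le_expR (p0 _ (mem_head _ _)) C0 e2.
exists (M2 * M1) => [|z X z0 hX]; first exact: mulr_gt0.
rewrite big_cons; have /andP[X0 XC] := hX _ (mem_head _ _).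
rewrite (_ : M2 * M1 * _ = M2 * expR (eps / 2 * z) * (M1 * expR (eps / 2 * z))).
  apply: ler_pM; rewrite ?powR_ge0 ?h2//.
    by rewrite prodr_ge0// => b _; exact: powR_ge0.
  by apply: h1 => // b bs; apply: hX; rewrite inE bs orbT.
by rewrite mulrACA -expRD; congr (_ * expR _); field.
Qed.

End elementary_bounds.

Section gaussian_approximation.
Variables (R : realType) (n : nat).
Local Notation V := 'rV[R]_n.
Local Notation C := R[i].
Variables (Rt Rp : {fset V}) (k : V -> R) (E : 'rV[C]_n -> 'rV[C]_n -> C).
Hypotheses (HRt : root_system Rt) (HRp : positive_subsystem Rt Rp).
Hypotheses (Hk : multiplicity Rt k) (HE : dunkl_kernel Rp k E).
Hypothesis Epos : forall x y : V, 0 < real_kernel E x y.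
Implicit Types (y a eta : V) (s t : R) (g : 'M[R]_n).
Local Notation e := (real_kernel E).
Local Notation W := (weylW Rt).
Local Notation gam := (half_gamma Rt k).
Local Notation w := (dunkl_weight Rp k).
Variables (lam x : V).
Hypothesis Hsc : same_chamber Rt lam x.
Local Notation xi := (lam + x).
Local Notation q v := (dot v v).

(** Up to a factor that depends only on [t], the density at time [t] of the
    process started in [t *: x]; it is symmetric in [lam] and [x]. *)
Definition rho t y : R := expR (- (q y / (2 * t))) * e y lam * e y x * w y.

Lemma center_same_chamber : same_chamber Rt xi lam /\ same_chamber Rt xi x.
Proof.
have h (c d : R) : 0 < c * d -> 0 < (c + d) * c.
  by move=> cd; rewrite mulrDl -expr2 ltr_wpDl ?sqr_ge0// mulrC.
split=> a aR; rewrite dotDr; first by apply: h; exact: Hsc.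
by rewrite addrC; apply: h; rewrite mulrC; exact: Hsc.
Qed.

Lemma center_dominated : exists r s1 K c, [/\ 0 < r, 0 < s1, 0 <= K, 0 < c &
  dominated Rt E xi lam r s1 K c /\ dominated Rt E xi x r s1 K c].
Proof.
have [sl sx] := center_same_chamber.
have [r1 [s1 [K1 [c1 [r10 s10 K10 c10 h1]]]]] :=
  uniform_dominant HRt HRp Hk HE Epos sl.
have [r2 [s2 [K2 [c2 [r20 s20 K20 c20 h2]]]]] :=
  uniform_dominant HRt HRp Hk HE Epos sx.
exists (Num.min r1 r2), (Num.max s1 s2), (Num.max K1 K2), (Num.min c1 c2).
split; rewrite ?lt_min ?lt_max ?le_max ?r10 ?s10 ?K10 ?c10//; split.
  apply: (dominatedW Epos s10 _ _ _ _ h1);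
  by rewrite ?ge_min ?le_max ?lexx.
apply: (dominatedW Epos s20 _ _ _ _ h2);
by rewrite ?ge_min ?le_max ?lexx ?orbT.
Qed.

Lemma rho_log t eta : 0 < t -> (forall a, a \in Rt -> dot a eta != 0) ->
  rho t (t *: eta) = expR (log_kernel_part Rt k E lam t eta +
    log_kernel_part Rt k E x t eta + t * dot eta xi - t * q eta / 2 +
    2 * gam * ln t).
Proof.
move=> t0 reg.
have regt a : a \in Rt -> dot a (t *: eta) != 0.
  by move=> aR; rewrite dotZr mulf_neq0 ?reg// gt_eqF.
rewrite /rho (dunkl_weight_log HRt HRp Hk regt) (log_weightZ _ t0 reg).
rewrite -(lnK (_ : e (t *: eta) lam \in Num.pos)) ?posrE ?Epos//.
rewrite -(lnK (_ : e (t *: eta) x \in Num.pos)) ?posrE ?Epos//.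
rewrite -!expRD /log_kernel_part dotDr dotZl dotZr.
by congr expR; field; rewrite gt_eqF.
Qed.

Lemma rho_gt0 t eta : 0 < t -> (forall a, a \in Rt -> dot a eta != 0) ->
  0 < rho t (t *: eta).
Proof. by move=> t0 reg; rewrite rho_log// expR_gt0. Qed.

Lemma rho_ge0 t y : 0 <= rho t y.
Proof.
rewrite /rho !mulr_ge0 ?expR_ge0 ?(ltW (Epos _ _))//.
exact: dunkl_weight_ge0.
Qed.

Local Notation ratio t y := (rho t y / rho t (t *: xi)).

Lemma scaled_dist t y eta : t != 0 ->
  q (t^-1 *: y - eta) = q (y - t *: eta) / t ^+ 2.
Proof.
move=> tn0; have -> : t^-1 *: y - eta = t^-1 *: (y - t *: eta).
  by rewrite scalerBr scalerA mulVf// scale1r.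
by rewrite dotZl dotZr; field.
Qed.

Section dominated_center.
Variables (r s1 K c : R).
Hypotheses (r0 : 0 < r) (s10 : 0 < s1) (K0 : 0 <= K) (c0 : 0 < c).
Hypothesis dl : dominated Rt E xi lam r s1 K c.
Hypothesis dx : dominated Rt E xi x r s1 K c.
Local Notation K2 := (part_const Rt k r K c).

Lemma ball_regular eta : q (eta - xi) <= r ->
  forall a, a \in Rt -> dot a eta != 0.
Proof.
move=> /dl[h _] a aR; rewrite -normr_gt0; exact: lt_le_trans (h _ aR).
Qed.

Lemma center_regular a : a \in Rt -> dot a xi != 0.
Proof. by apply: ball_regular; rewrite subrr dot0l ltW. Qed.

(** In the ball the exponents combine to the exact Gaussian, up to the two
    nearly constant logarithmic parts. *)
Lemma ratio_main t y : s1 <= t -> 4 * K2 <= t ->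
  q (y - t *: xi) <= r * t ^+ 2 ->
  `|ratio t y - expR (- (q (y - t *: xi) / (2 * t)))| <=
  4 * K2 / t * expR (- (q (y - t *: xi) / (2 * t))).
Proof.
move=> s1t K2t yr; have t0 := lt_le_trans s10 s1t.
have tn0 : t != 0 by rewrite gt_eqF.
pose eta := t^-1 *: y.
have yE : y = t *: eta by rewrite /eta scalerA divff// scale1r.
have etar : q (eta - xi) <= r.
  by rewrite /eta scaled_dist// ler_pdivrMr// exprn_gt0.
have hl := log_kernel_part_close HRt HRp Hk HE Epos r0 s10 K0 c0 dl s1t etar.
have hx := log_kernel_part_close HRt HRp Hk HE Epos r0 s10 K0 c0 dx s1t etar.
set dL := _ - _ in hl; set dX := _ - _ in hx.
have rE : ratio t y = expR (- (q (y - t *: xi) / (2 * t))) * expR (dL + dX).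
  rewrite yE !rho_log//; last 2 first.
  - exact: ball_regular.
  - exact: center_regular.
  rewrite -expRN -!expRD; congr expR; rewrite /dL /dX.
  have -> : q (t *: eta - t *: xi) = t ^+ 2 * (q eta - 2 * dot eta xi + q xi).
    by rewrite -scalerBr dotZl dotZr dotBl !dotBr (dotC xi eta); ring.
  by field.
rewrite rE -[X in _ - X]mulr1 -mulrBr normrM gtr0_norm ?expR_gt0// mulrC.
rewrite ler_wpM2r ?expR_ge0//.
have hD : `|dL + dX| <= 2 * K2 / t.
  apply: le_trans (ler_normD _ _) _.
  by rewrite (_ : 2 * K2 / t = K2 / t + K2 / t); [exact: lerD|ring].
apply: le_trans (expR_sub1_le _) _.
  by apply: le_trans hD _; rewrite ler_pdivrMr//; lra.
by apply: le_trans (ler_wpM2l _ hD) _ => //; lra.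
Qed.

(** Near the other points of the orbit of the center both kernels are smaller
    by a factor [K/t] than at the corresponding point of the ball. *)
Lemma ratio_other t y g : s1 <= t -> g \in W -> g != 1%:M ->
  q (y *m g - t *: xi) <= r * t ^+ 2 ->
  ratio t y <= (K / t) ^+ 2 * ratio t (y *m g).
Proof.
move=> s1t gW g1 yr; have t0 := lt_le_trans s10 s1t.
have tn0 : t != 0 by rewrite gt_eqF.
pose eta := t^-1 *: (y *m g).
have yE : y *m g = t *: eta by rewrite /eta scalerA divff// scale1r.
have etar : q (eta - xi) <= r.
  by rewrite /eta scaled_dist// ler_pdivrMr// exprn_gt0.
have gTW := weylW_tr HRt gW.
have gT1 : g^T != 1%:M.
  by apply: contra g1 => /eqP h; rewrite -(trmxK g) h trmx1.
have yE' : y = t *: (eta *m g^T).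
  by rewrite scalemxAl -yE -mulmxA (weylW_orth HRt gW) mulmx1.
have [_ /(_ _ _ s1t gTW gT1)] := dl etar; rewrite -yE' -yE => hl.
have [_ /(_ _ _ s1t gTW gT1)] := dx etar; rewrite -yE' -yE => hx.
rewrite mulrA ler_wpM2r ?invr_ge0 ?rho_ge0//.
rewrite /rho (weylW_dot HRt _ _ gW) (dunkl_weight_mulr HRt HRp Hk _ gW).
set G := expR _; set w0 := w y.
have Gw : 0 <= G * w0 by rewrite mulr_ge0 ?expR_ge0 ?dunkl_weight_ge0.
rewrite (_ : G * _ * _ * _ = G * w0 * (e y lam * e y x)); last by ring.
rewrite (_ : (K / t) ^+ 2 * _ = G * w0 * (K * (t^-1 * e (y *m g) lam) *
  (K * (t^-1 * e (y *m g) x)))); last by ring.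
by rewrite ler_wpM2l// ler_pM ?(ltW (Epos _ _)).
Qed.

(** In the dominant chamber both kernels are bounded by exponentials, which makes
    [rho t y] at most a weight of polynomial growth times a Gaussian centered at
    [t *: xi], while [ray_growth] bounds [rho t (t *: xi)] from below by the value
    [exp (t |xi|^2 / 2)] of the same exponent at the center: the powers of [t]
    from the two kernels and from the weight cancel. With [z = |y - t xi|^2 / t],
    half of the exponent [z / 2] pays for the weight, a quarter of it for the
    factor [1/t], as [z] exceeds [r t], and a quarter is left. *)
Lemma ratio_tail : exists2 M, 0 <= M & forall t y g,
  s1 <= t -> g \in W -> (forall a, a \in Rt -> 0 <= dot a (y *m g) * dot a xi) ->
  r * t ^+ 2 < q (y *m g - t *: xi) ->
  ratio t y <= M / t * expR (- (q (y *m g - t *: xi) / (8 * t))).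
Proof.
pose CW : R := \sum_(g <- W) 1; have CW0 : 0 <= CW by exact: sumr_ge0.
pose C1 := \sum_(a <- Rt) q a + r^-1 + q xi / r ^+ 2.
have sq0 : 0 <= \sum_(a <- Rt) q a by apply: sumr_ge0 => a _; exact: dot_ge0.
have ri0 : 0 <= r^-1 by rewrite invr_ge0 ltW.
have xr0 : 0 <= q xi / r ^+ 2 by rewrite divr_ge0 ?dot_ge0 ?sqr_ge0.
have C10 : 0 <= C1 by rewrite /C1 !addr_ge0.
have e4 : 0 < 4^-1 :> R by rewrite invr_gt0.
have [Mw Mw0 hMw] := @prod_powR_le_expR R _ Rt k C1 4^-1
  (fun a aR => mult_ge0 Hk aR) C10 e4.
pose kap mu := ln (e (s1 *: xi) mu) - dot xi mu * s1 + gam * ln s1 +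
  log_weight Rt k xi / 2.
pose M0 := CW * CW * Mw * expR (- (kap lam + kap x)).
have M00 : 0 <= M0 by rewrite !mulr_ge0 ?expR_ge0// ltW.
exists (M0 * (8 / r)); first by rewrite mulr_ge0// divr_ge0// ltW.
move=> t y g s1t gW dom far; have t0 := lt_le_trans s10 s1t.
have tn0 : t != 0 by rewrite gt_eqF.
set v := y *m g in dom far *.
pose z := q (v - t *: xi) / t.
have zrt : r * t < z by rewrite ltr_pdivlMr// -mulrA -expr2.
have z0 : 0 < z by apply: le_lt_trans zrt; rewrite mulr_ge0// ltW.
have zE : q (v - t *: xi) = z * t by rewrite /z divfK.
have [sl sx] := center_same_chamber.
have kbound mu : same_chamber Rt xi mu -> e y mu <= CW * expR (dot v mu).
  move=> smu; apply: (real_kernel_le HRt HRp Hk HE Epos) => h hW.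
  have -> : y *m h = v *m (g^T *m h).
    by rewrite /v -mulmxA (mulmxA g) (weylW_orth HRt gW) mul1mx.
  apply: (weylW_le HRt).
  - exact/same_chamber_regl/same_chamber_sym/smu.
  - move=> a aR; have h1 := dom a aR; have h2 := smu a aR.
    rewrite leNgt; apply/negP => h3.
    have h4 : 0 < dot a xi ^+ 2 by rewrite lt0r sqr_ge0 sqrf_eq0 (same_chamber_regl smu).
    have h5 : dot a v * dot a mu * dot a xi ^+ 2 < 0 by rewrite pmulr_llt0.
    have h6 : 0 <= dot a v * dot a xi * (dot a xi * dot a mu).
      by rewrite mulr_ge0// ltW.
    by lra.
  - exact: (weylWM HRt (weylW_tr HRt gW) hW).
have denom : expR (kap lam + kap x + t * q xi / 2) <= rho t (t *: xi).
  rewrite (rho_log t0 center_regular) ler_expR /log_kernel_part /kap.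
  have := ray_growth HRt HRp Hk HE Epos xi lam s10 s1t.
  have := ray_growth HRt HRp Hk HE Epos xi x s10 s1t.
  by rewrite !dotDr /=; lra.
have wbound : w y <= Mw * expR (4^-1 * z).
  rewrite -(dunkl_weight_mulr HRt HRp Hk y gW) -/v (dunkl_weight_roots HRt HRp Hk).
  apply: hMw; first exact: ltW.
  move=> a aR; rewrite normr_ge0/=.
  have h1 := dot_young a v ltr01; rewrite invr1 !mul1r in h1.
  have h2 : q a <= \sum_(a <- Rt) q a.
    by rewrite (big_rem a)//= lerDl sumr_ge0// => b _; exact: dot_ge0.
  have h3 : q v <= 2 * (z * t) + 2 * (t ^+ 2 * q xi).
    have := dot_ge0 (v - t *: xi - t *: xi); rewrite -zE.
    rewrite !(dotBl, dotBr, dotZl, dotZr, dotDl, dotDr).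
    by have := dotC v; lra.
  have tz : t <= z / r by rewrite ler_pdivlMr// mulrC ltW.
  have h4 : z * t <= z ^+ 2 / r.
    by rewrite expr2 -mulrA ler_wpM2l// ltW.
  have h5 : t ^+ 2 * q xi <= z ^+ 2 * (q xi / r ^+ 2).
    rewrite [leRHS](_ : _ = (z / r) ^+ 2 * q xi); last by field; rewrite gt_eqF.
    rewrite ler_wpM2r ?dot_ge0// ler_pXn2r// nnegrE ?(ltW t0)//.
    by rewrite divr_ge0// ltW.
  have h6 : 0 <= (2 * z + z ^+ 2) * (\sum_(a <- Rt) q a).
    by rewrite mulr_ge0// addr_ge0 ?sqr_ge0// mulr_ge0// ltW.
  have h7 : 0 <= (1 + 2 * z) * (r^-1 + q xi / r ^+ 2).
    by rewrite mulr_ge0// addr_ge0// mulr_ge0// ltW.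
  by rewrite /C1; have := dot_ge0 a; lra.
have den0 : 0 < rho t (t *: xi) by exact: rho_gt0 center_regular.
rewrite ler_pdivrMr//.
have num : rho t y <= CW * CW * Mw * expR (4^-1 * z - z / 2 + t * q xi / 2).
  rewrite /rho -(weylW_dot HRt y y gW) -/v.
  apply: (@le_trans _ _ (expR (- (q v / (2 * t))) * (CW * expR (dot v lam)) *
     (CW * expR (dot v x)) * (Mw * expR (4^-1 * z)))).
    rewrite !ler_pM ?mulr_ge0 ?expR_ge0 ?kbound ?dunkl_weight_ge0 ?(ltW (Epos _ _))//.
  rewrite [leRHS](_ : _ = expR (- (q v / (2 * t))) * (CW * expR (dot v lam)) *
     (CW * expR (dot v x)) * (Mw * expR (4^-1 * z)))//.
  have -> : 4^-1 * z - z / 2 + t * q xi / 2 =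
     - (q v / (2 * t)) + dot v lam + dot v x + 4^-1 * z.
    rewrite {2}/z !(dotBl, dotBr, dotZl, dotZr) (dotC xi v) (dotDr v).
    by field.
  by rewrite !expRD; ring.
apply: (le_trans num).
have rt0 : 0 < r * t by rewrite mulr_gt0.
have dec : expR (- (z / 4)) <= 8 / r / t * expR (- (z / 8)).
  rewrite (_ : - (z / 4) = - (z / 8) + - (z / 8)); last by field.
  rewrite expRD ler_wpM2r ?expR_ge0//.
  apply: le_trans (expRN_le_inv _) _; first by rewrite divr_gt0.
  rewrite invf_div (_ : 8 / r / t = 8 / (r * t)); last by rewrite invfM mulrA.
  by rewrite ler_pM2l// lef_pV2 ?posrE// ltW.
have -> : q (v - t *: xi) / (8 * t) = z / 8 by rewrite zE; field.
apply: (@le_trans _ _ (M0 * (8 / r / t * expR (- (z / 8))) *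
    expR (kap lam + kap x + t * q xi / 2))); last first.
  rewrite [leRHS](_ : _ = M0 * (8 / r / t * expR (- (z / 8))) * rho t (t *: xi));
    last by field; rewrite tn0 gt_eqF.
  have h8 : 0 <= 8 / r / t by rewrite !divr_ge0// ltW.
  by rewrite ler_wpM2l// mulr_ge0// mulr_ge0// expR_ge0.
apply: (@le_trans _ _ (M0 * expR (- (z / 4)) * expR (kap lam + kap x + t * q xi / 2))).
  rewrite [leRHS](_ : _ = CW * CW * Mw * expR (- (kap lam + kap x) - z / 4 +
      (kap lam + kap x + t * q xi / 2))); last by rewrite /M0 !expRD; ring.
  rewrite ler_wpM2l ?ler_expR; first by lra.
    by rewrite !mulr_ge0// ltW.
  by lra.
by rewrite ler_wpM2r ?expR_ge0// ler_wpM2l.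
Qed.

End dominated_center.

(** Every point is, up to the Weyl group, in the dominant chamber, where it is
    either near the center or in the Gaussian tail. *)
Lemma gaussian_approximation : exists t0 M, [/\ 0 < t0, 0 <= M &
  forall t y, t0 <= t ->
    `|ratio t y - expR (- (q (y - t *: xi) / (2 * t)))| <=
    M / t * \sum_(g <- W) expR (- (q (y - t *: (xi *m g)) / (8 * t)))].
Proof.
have [r [s1 [K [c [r0 s10 K0 c0 [dl dx]]]]]] := center_dominated.
have [M M0 hM] := ratio_tail r0 s10 c0 dl.
pose K2 := part_const Rt k r K c.
have K20 : 0 <= K2 by exact: (part_const_ge0 Hk r0 K0 c0).
pose M2 := 4 * K2 + (K ^+ 2 * (1 + 4 * K2) + M + 8 / r).
have M20 : 0 <= K ^+ 2 * (1 + 4 * K2) by rewrite mulr_ge0 ?sqr_ge0// addr_ge0 ?mulr_ge0.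
have r80 : 0 <= 8 / r by rewrite divr_ge0// ltW.
have K40 : 0 <= 4 * K2 by rewrite mulr_ge0.
exists (Num.max 1 (Num.max s1 (4 * K2))), M2; split.
- by rewrite lt_max ltr01.
- by rewrite /M2 !addr_ge0.
move=> t y; rewrite !ge_max => /and3P[t1 s1t K2t].
have t0 : 0 < t by rewrite (lt_le_trans ltr01).
have ti0 : 0 <= t^-1 by rewrite invr_ge0 ltW.
pose D v := q (v - t *: xi).
have D0 v : 0 <= D v by exact: dot_ge0.
have S0 : 0 <= \sum_(g <- W) expR (- (q (y - t *: (xi *m g)) / (8 * t))).
  by apply: sumr_ge0 => g _; exact: expR_ge0.
have term g : g \in W -> expR (- (D (y *m g) / (8 * t))) <=
    \sum_(g <- W) expR (- (q (y - t *: (xi *m g)) / (8 * t))).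
  move=> gW; rewrite (big_rem g^T) ?(weylW_tr HRt)//=.
  have -> : D (y *m g) = q (y - t *: (xi *m g^T)).
    rewrite /D -(weylW_dot HRt (y - _) _ gW) mulmxBl scalemxAl -mulmxA.
    by rewrite (weylW_orthV HRt gW) mulmx1.
  by rewrite lerDl sumr_ge0// => h _; exact: expR_ge0.
have term1 : expR (- (D y / (8 * t))) <=
    \sum_(g <- W) expR (- (q (y - t *: (xi *m g)) / (8 * t))).
  by have := term _ (weylW1 HRt); rewrite mulmx1.
have wide v : expR (- (D v / (2 * t))) <= expR (- (D v / (8 * t))).
  rewrite ler_expR lerN2 ler_wpM2l//.
  by rewrite lef_pV2 ?posrE ?mulr_gt0// ler_wpM2r ?(ltW t0)//; lra.
have [near|far] := leP (D y) (r * t ^+ 2).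
  apply: le_trans (ratio_main r0 s10 K0 c0 dl dx s1t K2t near) _.
  apply: (@le_trans _ _ (4 * K2 / t * expR (- (D y / (8 * t))))).
    by rewrite ler_wpM2l ?mulr_ge0// wide.
  by apply: ler_pM; rewrite ?mulr_ge0 ?expR_ge0// ler_wpM2r// /M2 lerDl !addr_ge0.
apply: le_trans (ler_normB _ _) _.
rewrite ger0_norm; last by rewrite divr_ge0 ?rho_ge0.
rewrite ger0_norm ?expR_ge0//.
have tail_gauss : expR (- (D y / (2 * t))) <= 8 / r / t *
    \sum_(g <- W) expR (- (q (y - t *: (xi *m g)) / (8 * t))).
  have far' : r * t < D y / t by rewrite ltr_pdivlMr// -mulrA -expr2.
  have rt0 : 0 < r * t by rewrite mulr_gt0.
  apply: (@le_trans _ _ (8 / r / t * expR (- (D y / (8 * t))))); last first.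
    by rewrite ler_wpM2l// (mulr_ge0 r80).
  have -> : - (D y / (2 * t)) = - (D y / t * 3 / 8) + - (D y / (8 * t)).
    by field; rewrite gt_eqF.
  rewrite expRD ler_wpM2r ?expR_ge0//.
  have z0 : 0 < D y / t * 3 / 8 by lra.
  apply: le_trans (expRN_le_inv z0) _.
  rewrite (_ : 8 / r / t = (r * t / 8)^-1); last by field; rewrite !gt_eqF.
  by rewrite lef_pV2 ?posrE//; lra.
suff tail_ratio : ratio t y <= (K ^+ 2 * (1 + 4 * K2) + M) / t *
    \sum_(g <- W) expR (- (q (y - t *: (xi *m g)) / (8 * t))).
  apply: le_trans (lerD tail_ratio tail_gauss) _.
  rewrite -!mulrDl; apply: ler_wpM2r => //; apply: ler_wpM2r => //.
  by rewrite /M2; lra.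
have [sl sx] := center_same_chamber.
have [g gW dom] := weylW_dominant HRt y xi.
have [near|farg] := leP (D (y *m g)) (r * t ^+ 2); last first.
  apply: le_trans (hM t y g s1t gW dom farg) _.
  by apply: ler_pM; rewrite ?mulr_ge0 ?expR_ge0 ?term// ler_wpM2r// lerDr.
have g1 : g != 1%:M.
  by apply: contraTneq near => ->; rewrite mulmx1 -ltNge.
apply: le_trans (ratio_other s10 dl dx s1t gW g1 near) _.
have hmain := ratio_main r0 s10 K0 c0 dl dx s1t K2t near.
have h1 : ratio t (y *m g) <= (1 + 4 * K2) * expR (- (D (y *m g) / (8 * t))).
  have h2 : ratio t (y *m g) <= expR (- (D (y *m g) / (2 * t))) +
      4 * K2 / t * expR (- (D (y *m g) / (2 * t))).
    by have := le_trans (ler_norm _) hmain; rewrite lerBlDl.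
  apply: le_trans h2 _; rewrite -[X in X + _]mul1r -mulrDl.
  apply: ler_pM; rewrite ?expR_ge0 ?wide// ?addr_ge0 ?mulr_ge0//.
  by rewrite lerD2l ler_pdivrMr// ler_peMr.
have tt : (K / t) ^+ 2 <= K ^+ 2 / t.
  rewrite expr_div_n ler_wpM2l ?sqr_ge0// lef_pV2 ?posrE ?exprn_gt0//.
  by rewrite expr2 ler_peMr// ltW.
apply: (@le_trans _ _ (K ^+ 2 / t * ((1 + 4 * K2) * expR (- (D (y *m g) / (8 * t)))))).
  by apply: ler_pM; rewrite ?sqr_ge0// divr_ge0 ?rho_ge0.
rewrite mulrA; apply: ler_pM; rewrite ?expR_ge0 ?term//.
  by rewrite !mulr_ge0 ?sqr_ge0// addr_ge0.
by rewrite mulrAC ler_wpM2r// lerDl.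
Qed.

End gaussian_approximation.

(** * Integration on row vectors *)

Section density.
Local Open Scope ereal_scope.
Context d (T : measurableType d) (R : realType).
Variables (mu nu : {measure set T -> \bar R}) (h : T -> R).
Hypotheses (mh : measurable_fun setT h) (h0 : forall x, (0 <= h x)%R).
Hypothesis nuE : forall A, measurable A -> nu A = \int[mu]_(x in A) (h x)%:E.

Import HBNNSimple.

(** Both sides are monotone limits along simple functions, on which the formula
    is the hypothesis on [nu]. *)
Lemma ge0_integral_density (f : T -> \bar R) :
  measurable_fun setT f -> (forall x, 0 <= f x) ->
  \int[nu]_x f x = \int[mu]_x (f x * (h x)%:E).
Proof.
move=> mf f0; pose g := nnsfun_approx measurableT mf.
have gf x : EFin \o g^~ x @ \oo --> f x by apply: cvg_nnsfun_approx.
have mh' : measurable_fun setT (EFin \o h) by exact/measurable_EFinP.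
have -> : \int[nu]_x f x = limn (fun m => \int[nu]_x (g m x)%:E).
  rewrite -monotone_convergence//.
  - by apply: eq_integral => x _; apply/esym/cvg_lim => //; exact: gf.
  - by move=> m; exact/measurable_EFinP/measurable_funP.
  - by move=> m x _; rewrite lee_fin.
  - by move=> x _ a b ab; rewrite lee_fin; exact/lefP/nd_nnsfun_approx.
have -> : \int[mu]_x (f x * (h x)%:E) =
    limn (fun m => \int[mu]_x ((g m x)%:E * (h x)%:E)).
  rewrite -monotone_convergence//.
  - apply: eq_integral => x _; apply/esym/cvg_lim => //.
    by apply: cvgeZr => //; exact: gf.
  - move=> m; apply: emeasurable_funM => //.
    exact/measurable_EFinP/measurable_funP.
  - by move=> m x _; rewrite mule_ge0 ?lee_fin.
  - move=> x _ a b ab; rewrite lee_wpmul2r ?lee_fin//.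
    exact/lefP/nd_nnsfun_approx.
congr (limn _); apply/funext => m.
have mI r : measurable (g m @^-1` [set r]) by exact: measurable_sfunP.
transitivity (\sum_(r \in range (g m)) \int[nu]_x (r * \1_(g m @^-1` [set r]) x)%:E).
  rewrite -ge0_integral_fsum//.
  - by apply: eq_integral => x _; rewrite fsumEFin// -fimfunE.
  - by move=> r; exact/measurable_EFinP/measurable_funM.
  - by move=> r x _; rewrite nnfun_muleindic_ge0.
transitivity (\sum_(r \in range (g m))
    \int[mu]_x ((r * \1_(g m @^-1` [set r]) x)%:E * (h x)%:E)); last first.
  rewrite -ge0_integral_fsum//.
  - apply: eq_integral => x _; rewrite -ge0_mule_fsuml; last first.
      by move=> r; exact: nnfun_muleindic_ge0.
    by rewrite fsumEFin// -fimfunE.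
  - move=> r; apply: emeasurable_funM => //.
    exact/measurable_EFinP/measurable_funM.
  - by move=> r x _; rewrite mule_ge0 ?nnfun_muleindic_ge0// lee_fin.
apply: eq_fsbigr => r _.
rewrite integralZl_indic_nnsfun// integral_indic// setIT nuE//.
have [r0|r0] := ltP r 0%R.
  rewrite preimage_nnfun0// integral_set0 mule0 integral0_eq// => x _.
  by rewrite indicE in_set0 mulr0 mul0e.
rewrite -ge0_integralZl//.
- rewrite [LHS]integral_mkcond; apply: eq_integral => x _.
  by rewrite patchE indicE; case: ifPn => _; rewrite ?mulr1 ?mulr0 ?mul0e.
- exact: measurable_funTS.
- by move=> x _; rewrite lee_fin.
Qed.

End density.

Section affine_line.
Local Open Scope ereal_scope.
Variable R : realType.
Local Notation mu := (@lebesgue_measure R).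

(** Lebesgue measure is determined by the lengths of half-open intervals, which
    it shares with its scaled image under the affine map. *)
Lemma ge0_integral_affine (a s : R) (f : R -> \bar R) : (0 < s)%R ->
  measurable_fun setT f -> (forall x, 0 <= f x) ->
  \int[mu]_x f x = s%:E * \int[mu]_x f (a + s * x)%R.
Proof.
move=> s0 mf f0.
pose phi (u : measurableTypeR R) : measurableTypeR R := (a + s * u)%R.
have mphi : measurable_fun setT phi.
  by apply: measurable_funD => //; exact: measurable_funM.
pose sn : {nonneg R} := NngNum (ltW s0).
pose nu : {measure set _ -> \bar R} :=
  mscale sn (measure_function_pushforward__canonical__measure_function_Measure mu mphi).
have E A : measurable A -> mu A = nu A.
  apply: lebesgue_measure_unique => _ [[p q]] _ <-.
  rewrite /nu/= /mscale/= /pushforward.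
  have -> : phi @^-1` `]p, q] = `]((p - a) / s)%R, ((q - a) / s)%R]%classic.
    apply/seteqP; split=> u; rewrite /phi/= !in_itv/=.
      by rewrite ltr_pdivrMr// ler_pdivlMr// ltrBlDl lerBrDl (mulrC u).
    by rewrite ltr_pdivrMr// ler_pdivlMr// ltrBlDl lerBrDl (mulrC u).
  rewrite !lebesgue_measure_itv/= !lte_fin ltr_pM2r ?invr_gt0// ltrBlDr subrK.
  case: ifPn => _; last by rewrite mule0.
  by rewrite -!EFinB -EFinM; congr EFin; field; rewrite gt_eqF.
rewrite (eq_measure_integral nu); last by move=> A mA _; exact: E.
rewrite ge0_integral_mscale//=; congr (_ * _).
by rewrite ge0_integral_pushforward.
Qed.

End affine_line.

Section row_vectors.
Variable R : realType.
Implicit Types n : nat.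

Lemma measurable_continuous_rV n (f : 'rV[R]_n -> R) : continuous f ->
  measurable_fun setT (f : borelRV R n -> measurableTypeR R).
Proof.
move=> cf; apply: (measurability _ (RGenOpens.measurableE R)).
move=> _ [_ [a [b ->] <-]]; rewrite setTI.
by apply: sub_sigma_algebra; apply: open_comp; [move=> v _; exact: cf|exact: interval_open].
Qed.

Lemma measurable_continuous_rV_rV n m (f : 'rV[R]_n -> 'rV[R]_m) : continuous f ->
  measurable_fun setT (f : borelRV R n -> borelRV R m).
Proof.
move=> cf; apply: (@measurability _ _ (borelRV R n) (borelRV R m) setT _
  (@open 'rV[R]_m) erefl).
move=> _ [U oU <-]; rewrite setTI.
by apply: sub_sigma_algebra; apply: open_comp oU => v _; exact: cf.
Qed.

Lemma continuous_affine_rV n (a : 'rV[R]_n) (s : R) :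
  continuous (fun u : 'rV[R]_n => a + s *: u).
Proof.
move=> u; apply: (@continuousD _ _ _ (cst a) (fun u => s *: u)).
  exact: cst_continuous.
exact: scaler_continuous.
Qed.

Local Open Scope ereal_scope.

Section product.
Variable mu : {sigma_finite_measure set (measurableTypeR R) -> \bar R}.

Lemma ge0_integral_prod_rVS n (f : 'rV[R]_n.+1 -> \bar R) :
  measurable_fun setT (f : borelRV R n.+1 -> \bar R) -> (forall x, 0 <= f x) ->
  \int[prod_rV mu n.+1]_x f x =
  \int[mu]_r \int[prod_rV mu n]_v f (row_cons (r, v)).
Proof.
move=> mf f0.
have [m mE] := prod_rV_subproof mu n.
rewrite [LHS](_ : _ = \int[pushforward (mu \x m)
    (@row_cons R n : _ -> borelRV R n.+1)]_x f x); last by rewrite /= -mE.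
rewrite ge0_integral_pushforward//=; last exact: measurable_row_cons.
rewrite preimage_setT fubini_tonelli1//=.
  by rewrite /fubini_F -mE.
exact: measurableT_comp (@measurable_row_cons R n).
Qed.

End product.

Lemma row_cons_affine n (a : 'rV[R]_n.+1) (s r : R) (v : 'rV[R]_n) :
  (a + s *: row_cons (r, v) = row_cons (a 0 0 + s * r,
     (\row_j a 0 (lift ord0 j)) + s *: v))%R.
Proof.
apply/rowP => i; rewrite !mxE; by case: unliftP => [j ->|->]; rewrite ?mxE//=.
Qed.

Lemma measurable_row_consr n (r : R) :
  measurable_fun setT ((fun v => row_cons (r, v)) : borelRV R n -> borelRV R n.+1).
Proof.
exact: (measurableT_comp (@measurable_row_cons R n)
  (@measurable_pair1 _ _ (measurableTypeR R) (borelRV R n) r)).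
Qed.

Lemma measurable_fubini_row_cons n
    (m : {sigma_finite_measure set (borelRV R n) -> \bar R})
    (f : 'rV[R]_n.+1 -> \bar R) :
  measurable_fun setT (f : borelRV R n.+1 -> \bar R) -> (forall x, 0 <= f x) ->
  measurable_fun setT
    ((fun r => \int[m]_v f (row_cons (r, v))) : measurableTypeR R -> \bar R).
Proof.
move=> mf f0.
apply: (@measurable_fun_fubini_tonelli_F _ _ (measurableTypeR R) (borelRV R n) R
  m (fun z => f (row_cons z))) => //.
exact: measurableT_comp (@measurable_row_cons R n).
Qed.

Lemma ge0_integral_lebesgue_rVS n (f : 'rV[R]_n.+1 -> \bar R) :
  measurable_fun setT (f : borelRV R n.+1 -> \bar R) -> (forall x, 0 <= f x) ->
  \int[lebesgue_rV R n.+1]_x f x =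
  \int[@lebesgue_measure R]_r \int[lebesgue_rV R n]_v f (row_cons (r, v)).
Proof. exact: ge0_integral_prod_rVS. Qed.

Lemma ge0_integral_affine_rV n (a : 'rV[R]_n) (s : R) (f : 'rV[R]_n -> \bar R) :
  (0 < s)%R -> measurable_fun setT (f : borelRV R n -> \bar R) ->
  (forall x, 0 <= f x) ->
  \int[lebesgue_rV R n]_x f x =
  (s ^+ n)%:E * \int[lebesgue_rV R n]_u f (a + s *: u)%R.
Proof.
move=> s0; elim: n a f => [|n IH] a f mf f0.
  rewrite expr0 mul1e; apply: eq_integral => u _; congr f.
  by apply/rowP => -[].
rewrite ge0_integral_lebesgue_rVS//.
have mfa : measurable_fun setT ((fun u => f (a + s *: u)%R) : borelRV R n.+1 -> \bar R).
  exact: (measurableT_comp mf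
    (measurable_continuous_rV_rV (@continuous_affine_rV n.+1 a s))).
rewrite [in RHS]ge0_integral_lebesgue_rVS//.
pose a' : 'rV[R]_n := (\row_j a 0 (lift ord0 j))%R.
have mr (r : R) : measurable_fun setT ((fun v => f (row_cons (r, v))) : borelRV R n -> \bar R).
  exact: (measurableT_comp mf (measurable_row_consr r)).
have mF := measurable_fubini_row_cons (lebesgue_rV R n) mf f0.
rewrite (ge0_integral_affine (a 0 0)%R s0)//; last first.
  by move=> r; apply: integral_ge0 => v _.
rewrite exprS EFinM -muleA; congr (_ * _).
rewrite -ge0_integralZl//; last 3 first.
- exact: (measurable_fubini_row_cons (lebesgue_rV R n) mfa (fun x => f0 _)).
- by move=> r _; apply: integral_ge0 => v _.
- by rewrite lee_fin exprn_ge0// ltW.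
apply: eq_integral => r _.
rewrite (IH a')//; congr (_ * _); apply: eq_integral => v _.
by rewrite row_cons_affine.
Qed.

Lemma dot_row_cons n (r : R) (v : 'rV[R]_n) :
  dot (row_cons (r, v)) (row_cons (r, v)) = (r ^+ 2 + dot v v)%R.
Proof.
rewrite /dot big_ord_recl row_cons0/= expr2; congr (_ + _)%R.
by apply: eq_bigr => i _; rewrite row_consS.
Qed.

Definition gaussian_density n (v : 'rV[R]_n) : R :=
  (normal_peak 1 ^+ n * expR (- (dot v v / 2)))%R.

Lemma continuous_gaussian_dot n (a : 'rV[R]_n) (c : R) :
  continuous (fun v : 'rV[R]_n => expR (- (dot (v - a) (v - a) / c)))%R.
Proof.
move=> v.
have h := continuousM (@continuous_dot_sub R n a v)
  (@cst_continuous 'rV[R]_n R c^-1%R v).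
exact: (cvg_comp _ _ (continuousN h) (@continuous_expR R _)).
Qed.

Lemma measurable_gaussian_density n :
  measurable_fun setT (@gaussian_density n : borelRV R n -> R).
Proof.
apply: measurable_funM => //.
have := measurable_continuous_rV (@continuous_gaussian_dot n 0 2).
by under eq_fun do rewrite subr0.
Qed.

Lemma gaussian_density_ge0 n v : (0 <= @gaussian_density n v)%R.
Proof. by rewrite mulr_ge0 ?expR_ge0// exprn_ge0// normal_peak_ge0. Qed.

Lemma ge0_integral_normal_prob (f : R -> \bar R) :
  measurable_fun setT f -> (forall x, 0 <= f x) ->
  \int[normal_prob (0 : R) 1]_x f x =
  \int[lebesgue_measure]_x (f x * (normal_pdf 0 1 x)%:E).
Proof.
move=> mf f0; apply: (@ge0_integral_density _ _ R (@lebesgue_measure R) (normal_prob 0 1)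
  (normal_pdf 0 1)) => //.
- exact: measurable_normal_pdf.
- by move=> x; exact: normal_pdf_ge0.
Qed.

(** The product of standard normal laws has the usual rotation-invariant
    density. *)
Lemma ge0_integral_std_normal_rV n (f : 'rV[R]_n -> \bar R) :
  measurable_fun setT (f : borelRV R n -> \bar R) -> (forall x, 0 <= f x) ->
  \int[std_normal_rV R n]_x f x =
  \int[lebesgue_rV R n]_x (f x * (gaussian_density x)%:E).
Proof.
elim: n f => [|n IH] f mf f0.
  apply: eq_integral => u _; rewrite /gaussian_density expr0 mul1r /dot big_ord0.
  by rewrite mul0r oppr0 expR0 mule1.
have mg : measurable_fun setT ((fun x => f x * (gaussian_density x)%:E) : borelRV R n.+1 -> \bar R).
  by apply: emeasurable_funM => //; apply/measurable_EFinP; exact: measurable_gaussian_density.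
have g0 x : 0 <= f x * (gaussian_density x)%:E.
  by rewrite mule_ge0// lee_fin gaussian_density_ge0.
rewrite [RHS]ge0_integral_lebesgue_rVS//.
have mr (r : R) : measurable_fun setT ((fun v => f (row_cons (r, v))) : borelRV R n -> \bar R).
  exact: (measurableT_comp mf (measurable_row_consr r)).
rewrite [LHS](_ : _ = \int[normal_prob (0 : R) 1]_r \int[std_normal_rV R n]_v f (row_cons (r, v))); last first.
  exact: ge0_integral_prod_rVS.
rewrite ge0_integral_normal_prob; last 2 first.
- exact: (measurable_fubini_row_cons (std_normal_rV R n)).
- by move=> r; apply: integral_ge0.
apply: eq_integral => r _; rewrite IH// -ge0_integralZr//; last 3 first.
- by apply: emeasurable_funM => //; apply/measurable_EFinP; exact: measurable_gaussian_density.
- by move=> v _; rewrite mule_ge0// lee_fin gaussian_density_ge0.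
- by rewrite lee_fin normal_pdf_ge0.
apply: eq_integral => v _; rewrite -muleA; congr (_ * _).
rewrite -EFinM; congr EFin; rewrite /gaussian_density dot_row_cons.
rewrite normal_pdfE ?oner_neq0// /normal_fun subr0 expr1n mulrDl opprD expRD.
by rewrite [(normal_peak 1 ^+ n.+1)%R]exprS mulNr; ring.
Qed.

Lemma integral_gaussian n (a : 'rV[R]_n) (c : R) : (0 < c)%R ->
  \int[lebesgue_rV R n]_x (expR (- (dot (x - a) (x - a) / (2 * c ^+ 2))))%:E =
  (c ^+ n / normal_peak 1 ^+ n)%:E.
Proof.
move=> c0; have p0 : (0 < normal_peak (1 : R))%R by rewrite normal_peak_gt0.
rewrite (ge0_integral_affine_rV a c0); last 2 first.
- apply/measurable_EFinP.
  exact: (measurable_continuous_rV (@continuous_gaussian_dot n a _)).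
- by move=> x; rewrite lee_fin expR_ge0.
rewrite EFinM; congr (_ * _).
have h : \int[std_normal_rV R n]_x (1 : \bar R) = 1.
  by rewrite integral_cst// mul1e; exact: (@probability_setT _ _ _ (std_normal_rV R n)).
rewrite ge0_integral_std_normal_rV// in h.
rewrite -[RHS]mule1 -h -ge0_integralZl//; last 3 first.
- by apply: emeasurable_funM => //; apply/measurable_EFinP; exact: measurable_gaussian_density.
- by move=> v _; rewrite mule_ge0// lee_fin gaussian_density_ge0.
- by rewrite lee_fin invr_ge0 exprn_ge0// ltW.
apply: eq_integral => v _; rewrite mul1e -EFinM; congr EFin.
rewrite /gaussian_density mulKf ?gt_eqF ?exprn_gt0//.
rewrite addrAC subrr add0r dotZl dotZr; congr (expR (- _))%R.
by field; rewrite gt_eqF.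
Qed.

End row_vectors.

(** * Convergence of the Dunkl process *)

Section chamber_interior.
Variables (R : realType) (n : nat).
Local Notation V := 'rV[R]_n.
Implicit Types (y a : V).

(** From an interior point one can move a little in the direction [- a] without
    leaving the chamber, which strictly decreases [dot y a]. *)
Lemma interior_halfspaces (Rp : {fset V}) y a : 0 \notin Rp ->
  [set v : V | forall b, b \in Rp -> 0 <= dot v b]° y -> a \in Rp -> 0 < dot y a.
Proof.
move=> R0 yC aR; have a0 : a != 0 by apply: contraNneq R0 => <-.
have h : \forall s \near (0 : R)^'+,
    [set v : V | forall b, b \in Rp -> 0 <= dot v b] (y + s *: - a).
  have c0 : (fun s : R => y + s *: - a) @ (0 : R) --> y.
    rewrite -[X in _ --> X]addr0 -(scale0r (- a)).
    by apply: cvgD; [exact: cvg_cst|exact: scalel_continuous].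
  exact: (cvg_at_right_filter c0 yC).
near (0 : R)^'+ => s.
have s0 : 0 < s by near: s; exact: nbhs_right_gt.
have /(_ a aR) : [set v : V | forall b, b \in Rp -> 0 <= dot v b] (y + s *: - a).
  by near: s.
rewrite /= dotDl dotZl dotNl mulrN subr_ge0 => /(lt_le_trans _); apply.
by rewrite mulr_gt0// dot_gt0.
Unshelve. all: by end_near.
Qed.

Lemma regular_pair_same_chamber (Rt : {fset V}) y z : root_system Rt ->
  regular_pair Rt y z -> same_chamber Rt y z.
Proof.
move=> HRt [_ _ [C [[Rq [b breg RqE] CE] Cy Cz _]]] a aR.
have R0 : 0 \notin Rq.
  by apply/negP; rewrite RqE => /andP[/(root_neq0 HRt)]; rewrite eqxx.
rewrite CE in Cy Cz.
have pos c : c \in Rq -> 0 < dot c y * dot c z.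
  move=> cR; rewrite mulr_gt0// dotC.
    exact: interior_halfspaces Cy cR.
  exact: interior_halfspaces Cz cR.
have [ap|an] := boolP (a \in Rq); first exact: pos.
have : - a \in Rq.
  move: an; rewrite !RqE aR (root_systemN HRt aR)/= dotNl oppr_gt0 -leNgt.
  by rewrite le_eqVlt (negbTE (breg _ aR)).
by move=> /pos; rewrite !dotNl mulrNN.
Qed.

End chamber_interior.

Section feller_law.
Variables (R : realType) (n : nat).
Local Notation V := 'rV[R]_n.
Variables (K : R -> V -> set (borelRV R n) -> \bar R).
Variables (d : measure_display) (T : measurableType d) (P : probability T R).
Variables (X : R -> T -> V) (z : V).
Hypothesis HX : feller_process K P X z.
Local Open Scope ereal_scope.

(** Conditioning on the almost sure event that the process starts in [z] turns
    the Markov property into a formula for the one-dimensional laws. *)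
Lemma feller_law t (A : set (borelRV R n)) : (0 < t)%R -> measurable A ->
  P (X t @^-1` A) = K t z A.
Proof.
move=> t0 mA; pose F := [set w | X 0%R w = z].
have mz : measurable ([set z] : set (borelRV R n)).
  rewrite -[X in measurable X]setCK; apply: measurableC.
  apply: sub_sigma_algebra; apply: closed_openC.
  apply: accessible_closed_set1; apply: hausdorff_accessible.
  exact: (@norm_hausdorff R V).
have FE : F = X 0%R @^-1` [set z] by [].
have mF : measurable F.
  rewrite FE -[X in measurable X]setTI.
  exact: (feller_process_measurable HX (lexx 0%R)).
have pF : past X 0 F.
  apply: sub_sigma_algebra; exists 0%R; first by rewrite /= !lexx.
  by exists [set z].
have mXA : measurable (X t @^-1` A).
  rewrite -[X in measurable X]setTI.
  exact: (feller_process_measurable HX (ltW t0)).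
have PF1 : P F = 1 by exact: (feller_process_start HX).
have PFC : P (~` F) = 0 by rewrite probability_setC// PF1 subee.
have PD0 : P (X t @^-1` A `\` F) = 0.
  apply/eqP; rewrite eq_le measure_ge0 andbT -PFC le_measure ?inE//.
  - exact: measurableD.
  - exact: measurableC.
have <- : P (F `&` X t @^-1` A) = P (X t @^-1` A).
  have mD := measurableD mXA mF.
  rewrite -[RHS](congr1 P (setUIDK (X t @^-1` A) F)) measureU//.
  - by rewrite setIC -[LHS]adde0 -[in LHS]PD0.
  - exact: measurableI.
  - by apply/seteqP; split=> // w [[_ +] []].
rewrite (feller_process_markov HX (lexx 0%R) t0 mA pF) subr0.
rewrite (eq_integral (cst (K t z A))) => [|w].
  by rewrite integral_cst// -[RHS]mule1 -[in RHS]PF1.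
by rewrite inE => ->.
Qed.

End feller_law.

Section dunkl_convergence.
Variables (R : realType) (n : nat).
Local Notation V := 'rV[R]_n.
Local Notation C := R[i].
Variables (Rt Rp : {fset V}) (k : V -> R) (E : 'rV[C]_n -> 'rV[C]_n -> C).
Hypotheses (HRt : root_system Rt) (HRp : positive_subsystem Rt Rp).
Hypotheses (Hk : multiplicity Rt k) (HE : dunkl_kernel Rp k E).
Hypothesis Epos : forall x y : V, 0 < real_kernel E x y.
Variables (lam x : V).
Hypothesis Hsc : same_chamber Rt lam x.
Local Notation e := (real_kernel E).
Local Notation xi := (lam + x).
Local Notation q v := (dot v v).
Local Notation w := (dunkl_weight Rp k).
Local Notation rh := (rho Rp k E lam x).
Local Notation ratio t y := (rh t y / rh t (t *: xi)).
Implicit Types (t : R) (y : V) (g : V -> R).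

Lemma measurable_dunkl_weight : measurable_fun setT (w : borelRV R n -> R).
Proof.
apply: measurable_prod => a _.
apply: (measurableT_comp (@measurable_powR R (2 * k a))).
apply: measurableT_comp => //.
exact: (measurable_continuous_rV (@continuous_dotr R n a)).
Qed.

Lemma measurable_rho t : measurable_fun setT (rh t : borelRV R n -> R).
Proof.
apply: measurable_funM; last exact: measurable_dunkl_weight.
apply: measurable_funM; last first.
  exact: (measurable_continuous_rV (continuous_real_kernel HE (y := x))).
apply: measurable_funM; last first.
  exact: (measurable_continuous_rV (continuous_real_kernel HE (y := lam))).
have := measurable_continuous_rV (@continuous_gaussian_dot R n 0 (2 * t)).
by under eq_fun do rewrite subr0.
Qed.

Lemma center_rho_gt0 t : 0 < t -> 0 < rh t (t *: xi).
Proof.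
move=> t0; apply: (rho_gt0 HRt HRp Hk Epos) => // a aR.
have [sl _] := center_same_chamber Hsc.
exact: (same_chamber_regl sl).
Qed.

Lemma ratio_ge0 t y : 0 <= ratio t y.
Proof. by rewrite divr_ge0// rho_ge0. Qed.

(** The density of the process at time [t] at the point [t *: xi]. *)
Definition normalization t : R :=
  dunkl_const Rp k * expR (- (enorm lam ^+ 2 * t / 2))
      / t `^ (dunkl_gamma Rp k + n%:R / 2) *
  (expR (- (q (t *: x) / (2 * t))) / e (t *: x) lam) * rh t (t *: xi).

Lemma enorm_sqr y : enorm y ^+ 2 = q y.
Proof. by rewrite /enorm sqr_sqrtr// dot_ge0. Qed.

Lemma dunkl_const_ge0 : 0 <= dunkl_const Rp k.
Proof.
rewrite invr_ge0 fine_ge0//; apply: integral_ge0 => y _.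
by rewrite lee_fin mulr_ge0 ?expR_ge0// dunkl_weight_ge0.
Qed.

Lemma normalization_ge0 t : 0 < t -> 0 <= normalization t.
Proof.
move=> t0; apply: mulr_ge0; last exact/ltW/center_rho_gt0.
apply: mulr_ge0; last by rewrite divr_ge0 ?expR_ge0// ltW.
by rewrite divr_ge0 ?powR_ge0// mulr_ge0 ?expR_ge0// dunkl_const_ge0.
Qed.

(** Homogeneity and symmetry of the kernel put the time-[t] density from
    [t *: x] in the form [rh t], where [lam] and [x] play the same role. *)
Lemma dunkl_transition_ratio t (A : set (borelRV R n)) : 0 < t -> measurable A ->
  dunkl_transition Rp k E lam t (t *: x) A =
  (\int[lebesgue_rV R n]_(y in A) (normalization t * ratio t y)%:E)%E.
Proof.
move=> t0 mA; rewrite /dunkl_transition.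
set c := dunkl_const _ _ * _ / _.
have c0 : 0 <= c.
  by rewrite divr_ge0 ?powR_ge0// mulr_ge0 ?expR_ge0// dunkl_const_ge0.
pose b := expR (- (q (t *: x) / (2 * t))) / e (t *: x) lam.
have b0 : 0 <= b by rewrite divr_ge0 ?expR_ge0// ltW.
have rho0 := center_rho_gt0 t0.
rewrite (@eq_integral _ (borelRV R n) _ _ _ (fun y => (b * rh t y)%:E)) => [|y _]; last first.
  have -> : e ((Num.sqrt t)^-1 *: (t *: x)) ((Num.sqrt t)^-1 *: y) = e y x.
    rewrite (real_kernel_sym HRt HRp Hk HE y x) !(real_kernelZ HRt HRp Hk HE).
    by rewrite !scalerA -mulrA -invfM -expr2 sqr_sqrtr ?ltW// divff ?scale1r ?gt_eqF.
  congr EFin; rewrite !enorm_sqr /b /rho mulrDl opprD expRD.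
  by field; rewrite gt_eqF ?Epos.
rewrite -ge0_integralZl//; last 2 first.
- apply/measurable_EFinP; apply: measurable_funM => //.
  exact: measurable_funTS (measurable_rho t).
- by move=> y _; rewrite lee_fin mulr_ge0 ?(rho_ge0 Rp k Epos).
apply: eq_integral => y _; rewrite -EFinM; congr EFin.
by rewrite /normalization -/c -/b; field; rewrite gt_eqF.
Qed.

Section one_time.
Variables (d : measure_display) (T : measurableType d) (P : probability T R).
Variables (X : R -> T -> V) (t : R).
Hypothesis t0 : 0 < t.
Hypothesis HX : feller_process (dunkl_transition Rp k E lam) P X (t *: x).

Lemma expectation_ratio g : continuous g -> (forall y, 0 <= g y) ->
  (\int[P]_u (g (X t u))%:E = (normalization t)%:E *
   \int[lebesgue_rV R n]_y (g y * ratio t y)%:E)%E.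
Proof.
move=> cg g0.
have mX := feller_process_measurable HX (ltW t0).
have mg : measurable_fun setT (EFin \o g : borelRV R n -> \bar R).
  by apply/measurable_EFinP; exact: measurable_continuous_rV.
have mr : measurable_fun setT ((fun y => ratio t y) : borelRV R n -> R).
  by apply: measurable_funM => //; exact: measurable_rho.
have c0 := normalization_ge0 t0.
pose nu : {measure set (borelRV R n) -> \bar R} :=
  measure_function_pushforward__canonical__measure_function_Measure P mX.
transitivity (\int[nu]_y (g y)%:E)%E.
  by rewrite ge0_integral_pushforward// => y _; rewrite lee_fin.
rewrite (@ge0_integral_density _ _ R (lebesgue_rV R n) nu
  (fun y => normalization t * ratio t y)) => [| | |A mA|//|y].
- rewrite -ge0_integralZl//; last 2 first.
  + by apply/measurable_EFinP; apply: measurable_funM => //; exact: measurable_continuous_rV.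
  + by move=> y _; rewrite lee_fin mulr_ge0 ?ratio_ge0.
  by apply: eq_integral => y _; rewrite -!EFinM mulrCA.
- exact: measurable_funM.
- by move=> y; rewrite mulr_ge0 ?ratio_ge0.
- rewrite -dunkl_transition_ratio//; exact: (feller_law HX).
- by rewrite lee_fin.
Qed.

End one_time.

Local Notation rescale t y := ((Num.sqrt t)^-1 *: (y - t *: xi)).

Lemma continuous_rescale t : continuous (fun y : V => rescale t y).
Proof.
move=> y.
rewrite (_ : (fun y => _) = fun y => - ((Num.sqrt t)^-1 *: (t *: xi)) +
    (Num.sqrt t)^-1 *: y); first exact: continuous_affine_rV.
by apply/funext => z; rewrite scalerBr addrC.
Qed.

Local Notation gauss t a c y := (expR (- (q (y - a) / (c * t)))).

(** The integral of [exp (- |y|^2 / (2 t))], as [normal_peak 1] is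
    [(2 pi)^(-1/2)]. *)
Definition gaussian_mass t : R := Num.sqrt t ^+ n / normal_peak 1 ^+ n.

Lemma gaussian_mass_gt0 t : 0 < t -> 0 < gaussian_mass t.
Proof.
by move=> t0; rewrite divr_gt0 ?exprn_gt0 ?sqrtr_gt0// normal_peak_gt0.
Qed.

Lemma integral_rescaled_gaussian t g : 0 < t -> continuous g ->
  (forall y, 0 <= g y) ->
  (\int[lebesgue_rV R n]_y (g (rescale t y) * gauss t (t *: xi) 2 y)%:E =
   (gaussian_mass t)%:E * \int[std_normal_rV R n]_u (g u)%:E)%E.
Proof.
move=> t0 cg g0; have s0 : 0 < Num.sqrt t by rewrite sqrtr_gt0.
have p0 : 0 < normal_peak (1 : R) by rewrite normal_peak_gt0.
have mg : measurable_fun setT (EFin \o g : borelRV R n -> \bar R).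
  by apply/measurable_EFinP; exact: measurable_continuous_rV.
have mgr : measurable_fun setT
    ((fun y => g (rescale t y)) : borelRV R n -> R).
  apply: measurable_continuous_rV => y.
  exact: (cvg_comp _ _ (@continuous_rescale t y) (cg _)).
rewrite (ge0_integral_affine_rV (t *: xi) s0); last 2 first.
- apply/measurable_EFinP; apply: measurable_funM => //.
  exact: (measurable_continuous_rV (@continuous_gaussian_dot R n _ _)).
- by move=> y; rewrite lee_fin mulr_ge0 ?expR_ge0.
rewrite /gaussian_mass EFinM -muleA; congr (_ * _)%E.
rewrite ge0_integral_std_normal_rV//.
rewrite -ge0_integralZl//; last 3 first.
- apply: emeasurable_funM => //.
  by apply/measurable_EFinP; exact: measurable_gaussian_density.
- by move=> v _; rewrite mule_ge0// lee_fin// gaussian_density_ge0.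
- by rewrite lee_fin invr_ge0 exprn_ge0// ltW.
apply: eq_integral => u _; rewrite -!EFinM; congr EFin.
rewrite addrC addKr scalerA mulVf ?gt_eqF// scale1r dotZl dotZr mulrA -expr2.
rewrite sqr_sqrtr ?ltW// /gaussian_density.
rewrite (_ : t * q u / (2 * t) = q u / 2); last by field; rewrite gt_eqF.
by field; rewrite expf_neq0// gt_eqF.
Qed.

(** [8 t = 2 (2 sqrt t)^2]: the standard deviation is doubled. *)
Lemma integral_wide_gaussian t (a : V) : 0 < t ->
  (\int[lebesgue_rV R n]_y (gauss t a 8 y)%:E =
   (2 ^+ n * gaussian_mass t)%:E)%E.
Proof.
move=> t0; have s0 : 0 < 2 * Num.sqrt t by rewrite mulr_gt0 ?sqrtr_gt0.
have := integral_gaussian a s0.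
rewrite exprMn sqr_sqrtr ?ltW// /gaussian_mass exprMn -[in RHS]mulrA => <-.
by apply: eq_integral => y _; congr (expR (- (_ / _)))%:E; ring.
Qed.

Local Notation W := (weylW Rt).
Local Notation card_W := (\sum_(h <- W) (1 : R)).

(** A Gaussian has the same mass wherever it is centered, so the error terms at
    all the orbit points together contribute a fraction of order [1/t] of the
    main mass. *)
Lemma integral_ratio_close t M B g : 0 < t -> 0 <= M ->
  (forall y, `|ratio t y - gauss t (t *: xi) 2 y| <=
    M / t * \sum_(h <- W) gauss t (t *: (xi *m h)) 8 y) ->
  continuous g -> (forall y, 0 <= g y <= B) ->
  let J := (\int[lebesgue_rV R n]_y (g (rescale t y) * ratio t y)%:E)%E in
  let A := ((gaussian_mass t)%:E * \int[std_normal_rV R n]_u (g u)%:E)%E in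
  let D := (B * (M / t * (card_W * (2 ^+ n * gaussian_mass t))))%:E in
  (J <= A + D)%E /\ (A <= J + D)%E.
Proof.
move=> t0 M0 hM cg gB J A D.
have g0 y : 0 <= g y by case/andP: (gB y).
have B0 : 0 <= B by case/andP: (gB 0) => /le_trans h /h.
have mgr : measurable_fun setT
    ((fun y => g (rescale t y)) : borelRV R n -> R).
  apply: measurable_continuous_rV => y.
  exact: (cvg_comp _ _ (@continuous_rescale t y) (cg _)).
have mgau (a : V) (c : R) : measurable_fun setT
    ((fun y => gauss t a c y) : borelRV R n -> R).
  exact: (measurable_continuous_rV (@continuous_gaussian_dot R n _ _)).
have mrat : measurable_fun setT ((fun y => ratio t y) : borelRV R n -> R).
  by apply: measurable_funM => //; exact: measurable_rho.
pose err y := B * (M / t * \sum_(h <- W) gauss t (t *: (xi *m h)) 8 y).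
have err0 y : 0 <= err y.
  apply: mulr_ge0 => //; apply: mulr_ge0; first by rewrite divr_ge0// ltW.
  by apply: sumr_ge0 => h _; exact: expR_ge0.
have merr : measurable_fun setT (err : borelRV R n -> R).
  apply: measurable_funM => //; apply: measurable_funM => //.
  by apply: measurable_sum => h.
have errE : (\int[lebesgue_rV R n]_y (err y)%:E = D)%E.
  rewrite (@eq_integral _ (borelRV R n) _ _ _ (fun y => (B * (M / t))%:E *
      (\sum_(h <- W) gauss t (t *: (xi *m h)) 8 y)%:E)%E); last first.
    by move=> y _; rewrite -EFinM -mulrA.
  have MB0 : 0 <= B * (M / t) by rewrite mulr_ge0// divr_ge0// ltW.
  rewrite ge0_integralZl//; last 2 first.
  - by apply/measurable_EFinP; apply: measurable_sum => h.
  - by move=> y _; rewrite lee_fin sumr_ge0// => h _; exact: expR_ge0.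
  rewrite (@eq_integral _ (borelRV R n) _ _ _ (fun y =>
      \sum_(h <- W) (gauss t (t *: (xi *m h)) 8 y)%:E)%E); last first.
    by move=> y _; rewrite sumEFin.
  rewrite ge0_integral_sum//.
    under eq_bigr do rewrite integral_wide_gaussian//.
    have hS : \sum_(h <- W) (2 ^+ n * gaussian_mass t) =
        card_W * (2 ^+ n * gaussian_mass t).
      by rewrite mulr_suml; apply: eq_bigr => h _; rewrite mul1r.
    by rewrite sumEFin hS -EFinM /D; congr EFin; ring.
  by move=> h; apply/measurable_EFinP.
have AE := integral_rescaled_gaussian t0 cg g0; rewrite -/A in AE.
have pw y : `|g (rescale t y) * ratio t y - g (rescale t y) * gauss t (t *: xi) 2 y| <= err y.
  rewrite -mulrBr normrM ger0_norm//; apply: ler_pM => //.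
  by case/andP: (gB (rescale t y)).
have r0 y := ratio_ge0 t y.
have gr0 y : 0 <= g (rescale t y) * ratio t y by rewrite mulr_ge0.
have gg0 y : 0 <= g (rescale t y) * gauss t (t *: xi) 2 y.
  by rewrite mulr_ge0 ?expR_ge0.
have mgrr := measurable_funM mgr mrat.
have mgrg := measurable_funM mgr (mgau (t *: xi) 2).
have merrE : measurable_fun setT (EFin \o err : borelRV R n -> \bar R).
  exact/measurable_EFinP.
have mgrrE : measurable_fun setT
    ((fun y => (g (rescale t y) * ratio t y)%:E) : borelRV R n -> \bar R).
  exact/measurable_EFinP.
have mgrgE : measurable_fun setT
    ((fun y => (g (rescale t y) * gauss t (t *: xi) 2 y)%:E) : borelRV R n -> \bar R).
  exact/measurable_EFinP.
have addE (f1 : V -> R) : (forall y, 0 <= f1 y) ->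
    measurable_fun setT ((fun y => (f1 y)%:E) : borelRV R n -> \bar R) ->
    (\int[lebesgue_rV R n]_y (f1 y)%:E + \int[lebesgue_rV R n]_y (err y)%:E =
     \int[lebesgue_rV R n]_y ((f1 y)%:E + (err y)%:E))%E.
  by move=> f10 mf1; rewrite ge0_integralD// => y _; rewrite lee_fin.
rewrite -AE -errE /J !addE//; split; apply: ge0_le_integral => //.
- by move=> y _; rewrite lee_fin.
- exact: (emeasurable_funD mgrgE merrE).
- move=> y _; rewrite -EFinD lee_fin.
  by have := pw y; rewrite ler_norml => /andP[_]; rewrite lerBlDl.
- by move=> y _; rewrite lee_fin.
- exact: (emeasurable_funD mgrrE merrE).
- move=> y _; rewrite -EFinD lee_fin.
  by have := pw y; rewrite ler_norml => /andP[+ _]; rewrite lerNl opprB lerBlDl.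
Qed.

End dunkl_convergence.

(** The law of the process has an unknown normalization [c], but its total mass is
    1; expectations are therefore quotients of an integral [j] by the mass [j1],
    and errors relative to the Gaussian mass [s] pass to the quotient. *)
Lemma quotient_close (R : realFieldType) (j j1 s eps G B c : R) :
  0 < s -> 0 <= eps <= 2^-1 -> 0 <= G <= B ->
  `|j - s * G| <= B * (s * eps) -> `|j1 - s| <= s * eps -> c * j1 = 1 ->
  `|c * j - G| <= 4 * B * eps.
Proof.
move=> s0 /andP[e0 e2] /andP[G0 GB] hj hj1 cj.
have se : s * eps <= s / 2 by rewrite ler_pM2l.
have j1s : s / 2 <= j1.
  by move: hj1; rewrite ler_norml => /andP[h _]; lra.
have j10 : 0 < j1 by lra.
have cE : c = j1^-1 by rewrite -[LHS]mulr1 -(mulfV (lt0r_neq0 j10)) mulrA cj mul1r.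
have c2 : c <= 2 / s.
  by rewrite cE -[leRHS]invrK invf_div lef_pV2// posrE// divr_gt0.
have c0 : 0 < c by rewrite cE invr_gt0.
have -> : c * j - G = c * ((j - s * G) + G * (s - j1)).
  by rewrite -[X in _ - X]mul1r -cj; ring.
rewrite normrM gtr0_norm//.
have h : `|j - s * G + G * (s - j1)| <= 2 * (B * (s * eps)).
  apply: le_trans (ler_normD _ _) _; rewrite mulr2n mulrDl mul1r lerD//.
  by rewrite normrM ger0_norm// distrC ler_pM.
apply: le_trans (ler_pM (ltW c0) (normr_ge0 _) c2 h) _.
by rewrite le_eqVlt; apply/orP; left; apply/eqP; field; rewrite gt_eqF.
Qed.

Lemma integral_probability_cst (R : realType) d (T : measurableType d)
    (Q : probability T R) (c : R) : (\int[Q]_u c%:E = c%:E)%E.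
Proof.
rewrite integral_cst// [X in (_ * X)%E](_ : _ = 1%E) ?mule1//.
exact: (@probability_setT _ _ _ Q).
Qed.

(** Adding the bound makes the integrand nonnegative, so that its integral can be
    computed from densities without integrability conditions. *)
Lemma bounded_integral_shift (R : realType) d (T : measurableType d)
    (Q : probability T R) (h : T -> R) (B : R) :
  measurable_fun setT h -> (forall u, `|h u| <= B) ->
  (\int[Q]_u (h u)%:E = \int[Q]_u (h u + B)%:E - B%:E)%E.
Proof.
move=> mh hB.
have iB := @finite_measure_integrable_cst _ _ R Q setT B measurableT.
have ih : Q.-integrable setT (EFin \o h).
  apply: le_integrable iB => //; first exact/measurable_EFinP.
  move=> u _ /=; rewrite lee_fin; apply: le_trans (hB u) _; exact: ler_norm.
under [in RHS]eq_integral do rewrite EFinD.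
by rewrite integralD_EFin//= integral_probability_cst addeK.
Qed.

Theorem theorem1p5 (R : realType) (N : nat) (N1 : (1 <= N)%N)
  (Rt Rp : {fset 'rV[R]_N}) (k : 'rV[R]_N -> R)
  (E : 'rV[R[i]]_N -> 'rV[R[i]]_N -> R[i])
  (HRt : root_system Rt) (HRp : positive_subsystem Rt Rp)
  (Hk : multiplicity Rt k) (HE : dunkl_kernel Rp k E)
  (d : measure_display) (T : 'rV[R]_N -> 'rV[R]_N -> measurableType d)
  (P : forall lam z : 'rV[R]_N, probability (T lam z) R)
  (X : forall lam z : 'rV[R]_N, R -> T lam z -> 'rV[R]_N)
  (HX : forall lam z : 'rV[R]_N,
     feller_process (dunkl_transition Rp k E lam) (P lam z) (X lam z) z)
  (lam x : 'rV[R]_N) (Hreg : regular_pair Rt lam x) :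
  cvg_in_distribution (fun t : R => P lam (t *: x))
    (fun (t : R) (w : T lam (t *: x)) =>
       (Num.sqrt t)^-1 *: (X lam (t *: x) t w - t *: (lam + x)))
    (std_normal_rV R N).
Proof.
(* the transition probabilities have mass 1, whereas a zero of the kernel in the
   denominator would make the density vanish *)
have En0 (z mu : 'rV[R]_N) : real_kernel E z mu != 0.
  apply/eqP => e0.
  have := feller_law (HX mu z) (ltr01 : (0 : R) < 1) measurableT.
  rewrite preimage_setT (@probability_setT _ _ _ (P mu z)).
  rewrite /dunkl_transition e0 invr0 integral0_eq => [|y _].
    by rewrite mule0 => /eqP; rewrite onee_eq0.
  by rewrite mulr0 mulr0 mul0r.
have Epos := real_kernel_gt0 HE En0.
have Hsc := regular_pair_same_chamber HRt Hreg.
have [t1 [M [t10 M0 hM]]] := gaussian_approximation HRt HRp Hk HE Epos Hsc.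
move=> f cf [B0 hB0].
pose B := `|B0|; have hB y : `|f y| <= B by apply: le_trans (hB0 y) (ler_norm _).
have Bge0 : 0 <= B by exact: normr_ge0.
pose g y := f y + B.
have gB y : 0 <= g y <= 2 * B.
  by have := hB y; rewrite ler_norml /g => /andP[h1 h2]; apply/andP; split; lra.
have cg : continuous g.
  by move=> y; exact: (continuousD (cf y) (@cst_continuous 'rV[R]_N R B y)).
have g0 y : 0 <= g y by case/andP: (gB y).
have mf : measurable_fun setT (f : borelRV R N -> R) by exact: measurable_continuous_rV.
pose nu := std_normal_rV R N.
have mg : measurable_fun setT (g : borelRV R N -> R) by exact: measurable_continuous_rV.
have [G GE /andP[G0 GB]] : exists2 G, (\int[nu]_y (g y)%:E = G%:E)%E & 0 <= G <= 2 * B.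
  have h0 : (0 <= \int[nu]_y (g y)%:E)%E.
    by apply: integral_ge0 => y _; rewrite lee_fin.
  have h2 : (\int[nu]_y (g y)%:E <= (2 * B)%:E)%E.
    rewrite -[leRHS](integral_probability_cst nu); apply: ge0_le_integral => //.
    - by move=> y _; rewrite lee_fin.
    - exact/measurable_EFinP.
    - by move=> y _; rewrite lee_fin; case/andP: (gB y).
  move: h0 h2; case: (integral _ _ _) => [r| |]//.
  by rewrite !lee_fin => h0 h2; exists r => //; rewrite h0.
pose cW : R := \sum_(h <- weylW Rt) 1.
have cW0 : 0 <= cW by exact: sumr_ge0.
pose Q := M * (cW * 2 ^+ N).
have Q0 : 0 <= Q by rewrite mulr_ge0// mulr_ge0// exprn_ge0.
pose Y t (w : T lam (t *: x)) := (Num.sqrt t)^-1 *: (X lam (t *: x) t w - t *: (lam + x)).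
have close t : Num.max t1 (2 * Q) <= t -> exists2 r,
    (\int[P lam (t *: x)]_w (g (Y t w))%:E = r%:E)%E &
    `|r - G| <= 8 * B * (Q / t).
  rewrite ge_max => /andP[t1t Qt]; have t0 := lt_le_trans t10 t1t.
  have hMt y := hM t y t1t.
  have crg : continuous (fun y : 'rV[R]_N => g ((Num.sqrt t)^-1 *: (y - t *: (lam + x)))).
    by move=> y; exact: (cvg_comp _ _ (@continuous_rescale R N lam x t y) (cg _)).
  have EE := expectation_ratio HRt HRp Hk HE Epos Hsc t0 (HX lam (t *: x)) crg (fun y => g0 _).
  have E1 := expectation_ratio HRt HRp Hk HE Epos Hsc t0 (HX lam (t *: x))
    (@cst_continuous _ _ (1 : R)) (fun y => ler01).
  pose s := gaussian_mass N t; have s0 : 0 < s by exact: gaussian_mass_gt0.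
  have [h1 h2] := integral_ratio_close HE Epos t0 M0 hMt cg gB.
  have one01 (y : 'rV[R]_N) : 0 <= (cst 1 y : R) <= 1 by rewrite /= ler01 lexx.
  have [h3 h4] := integral_ratio_close HE Epos t0 M0 hMt
    (@cst_continuous _ _ (1 : R)) one01.
  have rat0 y : 0 <= rho Rp k E lam x t y / rho Rp k E lam x t (t *: (lam + x)).
    exact: ratio_ge0.
  pose J := (\int[lebesgue_rV R N]_y
    (g ((Num.sqrt t)^-1 *: (y - t *: (lam + x))) *
      (rho Rp k E lam x t y / rho Rp k E lam x t (t *: (lam + x))))%:E)%E.
  pose J1 := (\int[lebesgue_rV R N]_y
    (1 * (rho Rp k E lam x t y / rho Rp k E lam x t (t *: (lam + x))))%:E)%E.
  rewrite -/J -/s in EE h1 h2; rewrite -/J1 -/s in E1 h3 h4.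
  rewrite GE in h1 h2; rewrite !integral_probability_cst in E1 h3 h4.
  have fin (I : \bar R) (b : R) : (0 <= I)%E -> (I <= b%:E)%E -> exists i, I = i%:E.
    by case: I => [i| |]//; exists i.
  have [j jE] : exists j, J = j%:E.
    by apply: fin h1; apply: integral_ge0 => y _; rewrite lee_fin mulr_ge0.
  have [j1 j1E] : exists j1, J1 = j1%:E.
    by apply: fin h3; apply: integral_ge0 => y _; rewrite lee_fin mulr_ge0.
  rewrite jE -!EFinM -?EFinD !lee_fin in EE h1 h2.
  rewrite j1E -!EFinM -?EFinD !lee_fin in E1 h3 h4.
  exists (normalization Rp k E lam x t * j) => //.
  have -> : 8 * B * (Q / t) = 4 * (2 * B) * (Q / t) by ring.
  have DE : M / t * (cW * (2 ^+ N * s)) = s * (Q / t) by rewrite /Q; ring.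
  rewrite -/cW DE in h1 h2 h3 h4.
  apply: (quotient_close (s := s) (j1 := j1)) => //.
  - by rewrite divr_ge0 ?(ltW t0)// ler_pdivrMr//; lra.
  - by rewrite G0 GB.
  - by rewrite ler_norml; apply/andP; split; lra.
  - by rewrite ler_norml; apply/andP; split; lra.
  - by case: E1.
pose t2 := Num.max t1 (2 * Q).
have EfE t : t2 <= t -> exists2 r,
    ('E_(P lam (t *: x))[(fun w => f (Y t w))] = (r - B)%:E)%E &
    `|r - G| <= 8 * B * (Q / t).
  move=> t2t; have [r rE rG] := close t t2t; exists r => //.
  have t0 : 0 <= t.
    by apply: ltW; apply: lt_le_trans t2t; rewrite lt_max t10.
  have mY : measurable_fun setT (fun w => f (Y t w)).
    apply: (measurableT_comp (measurable_continuous_rV (f := fun y : 'rV[R]_N =>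
      f ((Num.sqrt t)^-1 *: (y - t *: (lam + x)))) _)
      (feller_process_measurable (HX lam (t *: x)) t0)).
    by move=> y; exact: (cvg_comp _ _ (@continuous_rescale R N lam x t y) (cf _)).
  rewrite unlock (bounded_integral_shift (P lam (t *: x)) mY (fun w => hB _)).
  by rewrite EFinB -rE.
rewrite (bounded_integral_shift nu mf hB) GE -EFinB.
apply: cvg_EFin.
  near=> t; have [|r -> _] := EfE t; last by [].
  by near: t; exact: nbhs_pinfty_ge (num_real _).
apply/cvgrPdist_le => eps eps0; near=> t.
have t2t : t2 <= t by near: t; exact: nbhs_pinfty_ge (num_real _).
have te : 8 * B * Q / eps <= t by near: t; exact: nbhs_pinfty_ge (num_real _).
have t0 : 0 < t by apply: lt_le_trans t2t; rewrite lt_max t10.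
have [r rE rG] := EfE t t2t; rewrite /= rE /=.
rewrite opprB addrA subrK distrC; apply: (le_trans rG).
by rewrite mulrA ler_pdivrMr// (mulrC eps) -ler_pdivrMr.
Unshelve. all: by end_near.
Qed.
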